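(* Let $1<\gamma<2$, $0\le\delta\le1$, let $X$ be a Banach space, let $\{C_{\gamma,\delta}(t)\}_{t>0}$ be a general fractional cosine operator function of order $\gamma$ and type $\delta$ on $X$, and let $\mathcal{A}$ be its generator. Then: (a) $C_{\gamma,\delta}(t)$ maps $D(\mathcal{A})$ into $D(\mathcal{A})$ and $C_{\gamma,\delta}(t)\mathcal{A}x=\mathcal{A}C_{\gamma,\delta}(t)x$ for all $x\in D(\mathcal{A})$, $t>0$; (b) for all $x\in X$ and $t>0$, $J_t^{\gamma}C_{\gamma,\delta}(t)x\in D(\mathcal{A})$ and $$C_{\gamma,\delta}(t)x=\frac{t^{\gamma+\delta(2-\gamma)-2}}{\Gamma(\gamma+\delta(2-\gamma)-1)}x+\mathcal{A}J_t^{\gamma}C_{\gamma,\delta}(t)x;$$ (c) for all $x\in D(\mathcal{A})$ and $t>0$, $$C_{\gamma,\delta}(t)x=\frac{t^{\gamma+\delta(2-\gamma)-2}}{\Gamma(\gamma+\delta(2-\gamma)-1)}x+J_t^{\gamma}C_{\gamma,\delta}(t)\mathcal{A}x;$$ (d) $\mathcal{A}$ is a closed and densely defined operator; (e) $\mathcal{A}$ corresponds to at most one general fractional cosine operator function of order $\gamma$ and type $\delta$ (i.e. two such functions with the same generator $\mathcal{A}$ coincide); (f) $C_{\gamma,\delta}(\cdot)x\in C^{1}((0,\infty);X)$ if $x\in D(\mathcal{A})$.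
   Context: For $\alpha>0$, $J_t^{\alpha}f(t)=\frac{1}{\Gamma(\alpha)}\int_0^t(t-s)^{\alpha-1}f(s)\,ds$; for an operator family, $J_t^\alpha C(t)x$ denotes $J_t^\alpha$ applied to $t\mapsto C(t)x$. A general fractional cosine operator function of order $\gamma\in(1,2)$ and type $\delta\in[0,1]$ is a family $\{C_{\gamma,\delta}(t)\}_{t>0}$ of bounded linear operators on $X$ such that: (i) $C_{\gamma,\delta}(t)$ is strongly continuous (on $t>0$); (ii) $\lim_{t\to0+}\frac{C_{\gamma,\delta}(t)x}{t^{\gamma+\delta(2-\gamma)-2}}=\frac{x}{\Gamma(\gamma+\delta(2-\gamma)-1)}$ for all $x\in X$; (iii) $C_{\gamma,\delta}(t)C_{\gamma,\delta}(s)=C_{\gamma,\delta}(s)C_{\gamma,\delta}(t)$ for all $t,s>0$; (iv) for all $t,s>0$, $$C_{\gamma,\delta}(s)J_t^{\gamma}C_{\gamma,\delta}(t)-J_s^{\gamma}C_{\gamma,\delta}(s)C_{\gamma,\delta}(t)=\frac{s^{\gamma+\delta(2-\gamma)-2}}{\Gamma(\gamma+\delta(2-\gamma)-1)}J_t^{\gamma}C_{\gamma,\delta}(t)-\frac{t^{\gamma+\delta(2-\gamma)-2}}{\Gamma(\gamma+\delta(2-\gamma)-1)}J_s^{\gamma}C_{\gamma,\delta}(s).$$ Its generator is the linear operator $\mathcal{A}:D(\mathcal{A})\subset X\to X$ given by $$\mathcal{A}x=\Gamma(2\gamma+\delta(2-\gamma)-1)\lim_{t\to0+}\frac{C_{\gamma,\delta}(t)x-\frac{t^{\gamma+\delta(2-\gamma)-2}}{\Gamma(\gamma+\delta(2-\gamma)-1)}x}{t^{2\gamma+\delta(2-\gamma)-2}},$$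 with $D(\mathcal{A})$ the set of all $x\in X$ for which this limit exists. *)

(* Defs.v *)
From Stdlib Require Import Reals.
From Coquelicot Require Import Coquelicot.

Set Implicit Arguments.
Unset Strict Implicit.

Open Scope R_scope.

(* Euler's integral; meaningful for z > 0. *)
Definition Gamma (z : R) : R :=
  RInt_gen (fun u : R => Rpower u (z - 1) * exp (- u))
           (at_right 0) (Rbar_locally p_infty).

(* Riemann-Liouville fractional integral of order alpha > 0.  The integral is
   improper at both ends: f may be singular at 0, and the kernel is singular
   at t when alpha < 1. *)
Definition J {X : CompleteNormedModule R_AbsRing}
    (alpha : R) (f : R -> X) (t : R) : X :=
  scal (/ Gamma alpha)
    (RInt_gen (fun s : R => scal (Rpower (t - s) (alpha - 1)) (f s))
              (at_right 0) (at_left t)).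

Section FractionalCosine.

Context {X : CompleteNormedModule R_AbsRing}.

Definition cos_weight (gamma delta t : R) : R :=
  Rpower t (gamma + delta * (2 - gamma) - 2)
  / Gamma (gamma + delta * (2 - gamma) - 1).

(* Coquelicot's is_linear includes boundedness.  Only the values C t with
   0 < t matter. *)
Record general_fractional_cosine (gamma delta : R) (C : R -> X -> X) : Prop := {
  gfc_bounded_linear : forall t : R, 0 < t -> is_linear (C t);
  gfc_strongly_continuous :
    forall (x : X) (t : R), 0 < t -> continuous (fun r : R => C r x) t;
  gfc_initial :
    forall x : X,
      filterlim
        (fun t : R => scal (/ Rpower t (gamma + delta * (2 - gamma) - 2)) (C t x))
        (at_right 0)
        (locally (scal (/ Gamma (gamma + delta * (2 - gamma) - 1)) x));
  gfc_commute :
    forall (t s : R) (x : X), 0 < t -> 0 < s -> C t (C s x) = C s (C t x);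
  gfc_functional_equation :
    forall (t s : R) (x : X), 0 < t -> 0 < s ->
      minus (C s (J gamma (fun r : R => C r x) t))
            (J gamma (fun r : R => C r (C t x)) s)
      = minus (scal (cos_weight gamma delta s) (J gamma (fun r : R => C r x) t))
              (scal (cos_weight gamma delta t) (J gamma (fun r : R => C r x) s))
}.

(* A partially defined operator in X; the values of app outside dom are
   irrelevant. *)
Record operator : Type := Operator { dom : X -> Prop; app : X -> X }.

Definition generator_quotient
    (gamma delta : R) (C : R -> X -> X) (x : X) (t : R) : X :=
  scal (/ Rpower t (2 * gamma + delta * (2 - gamma) - 2))
       (minus (C t x) (scal (cos_weight gamma delta t) x)).

Definition generator (gamma delta : R) (C : R -> X -> X) : operator :=
  {| dom := fun x : X =>
       exists y : X,
         filterlim (generator_quotient gamma delta C x) (at_right 0) (locally y);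
     app := fun x : X =>
       scal (Gamma (2 * gamma + delta * (2 - gamma) - 1))
            (lim (filtermap (generator_quotient gamma delta C x) (at_right 0))) |}.

Definition same_operator (A B : operator) : Prop :=
  (forall x : X, dom A x <-> dom B x) /\
  (forall x : X, dom A x -> app A x = app B x).

Definition linear_operator (A : operator) : Prop :=
  dom A zero /\
  (forall x y : X, dom A x -> dom A y ->
     dom A (plus x y) /\ app A (plus x y) = plus (app A x) (app A y)) /\
  (forall (k : R) (x : X), dom A x ->
     dom A (scal k x) /\ app A (scal k x) = scal k (app A x)).

Definition closed_operator (A : operator) : Prop :=
  closed (fun p : X * X => dom A (fst p) /\ snd p = app A (fst p)).

Definition densely_defined (A : operator) : Prop :=
  forall (x : X) (eps : posreal), exists y : X, dom A y /\ ball x eps y.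

Definition C1_pos (f : R -> X) : Prop :=
  exists f' : R -> X,
    forall t : R, 0 < t -> is_derive f t (f' t) /\ continuous f' t.

End FractionalCosine.

Arguments operator X : clear implicits.

(* Main.v *)
(* With theta = gamma + delta (2 - gamma) - 1 in (0, 1], every orbit f = C(.)x behaves like
   t^(theta-1) at 0, so the substitution s = r^(1/theta) turns J^gamma f into a Riemann integral of
   a function continuous up to 0, and the constant in the generator comes from the Beta-Gamma
   identity.  Put K(t) = J^gamma C(t).  The functional equation reads
   (C(s) - w(s)) K(t) = K(s) (C(t) - w(t)) with w the scalar weight; dividing by s^(gamma+theta-1)
   and letting s -> 0 gives (b), and (c) too, because K(t) is bounded by the uniform boundedness
   principle.  Closedness and density of the domain follow from (c) and (b).

   For uniqueness let z be the difference of two orbits from the same x and y = J^gamma z, so that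
   A y = z.  By (c), integrated once in t, C(s) Y(t) - w(s) Y(t) = K(s) y(t) with Y = J^gamma y.
   Integrating in s and putting U(s, t) = K(s) y(t),
   J_s U = J_t U - c s^(gamma+theta-1) Y(t).  On the diagonal s = T - t the integrals over t of
   J_s U and J_t U coincide, so Y convolved with a power vanishes, hence Y = 0, y = 0 and z = 0. *)

Require Import Defs.
From Stdlib Require Import Reals Lra Lia Classical ClassicalEpsilon.
From Coquelicot Require Import Coquelicot.

(** * Integrals depending on a parameter *)

(** No growth bound on [C] is assumed, so Laplace transforms cannot give uniqueness; this is why a
    convolution argument is used. It integrates once more in t because z may blow up at 0 when theta
    < 1, whereas y is continuous on the whole line and makes U jointly continuous. The final
    cancellation meets only the exponents gamma - 1 and gamma + theta - 1, both in (0, 2) because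
    theta <= 1.

    Boundedness of K(t) matters for (c) because K(t) is applied to the limit that defines [A x], and
    this needs K(t) to be continuous.

    [RInt_gen] and [Rpower] return arbitrary values where they have no meaning. Kernels are
    therefore cut off to 0 on the left of the origin and orbits are desingularized: each integral
    becomes a Riemann integral of a function continuous on all of R, its upper limit may be any
    number beyond t, and parameter theorems with fixed limits apply.

    For (f), after (c), the obstacle is the t-derivative of the kernel, of exponent gamma - 2 < 0:
    it is singular at s = t, where the orbit is only continuous. Cutting the integral at some a < t
    separates this singularity from the one at 0. *)

Lemma filterlim_normP {T : Type} {X : NormedModule R_AbsRing} (F : (T -> Prop) -> Prop)
    {FF : Filter F} (f : T -> X) (l : X) :
  filterlim f F (locally l) <->
  (forall eps : posreal, F (fun x => norm (minus (f x) l) < eps)).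
Proof. exact (filterlim_locally_ball_norm f l). Qed.

Lemma continuous_normP {U : UniformSpace} {X : NormedModule R_AbsRing} (f : U -> X) (x : U) :
  continuous f x <-> forall eps : posreal, locally x (fun y => norm (minus (f y) (f x)) < eps).
Proof. apply (filterlim_normP (locally x)). Qed.

Lemma minus_plus_cancel {X : AbelianGroup} (a b c : X) :
  plus (minus a b) (minus b c) = minus a c.
Proof.
unfold minus. rewrite <- plus_assoc, (plus_assoc (opp b) b).
now rewrite plus_opp_l, plus_zero_l.
Qed.

Lemma norm_minus_triangle {X : NormedModule R_AbsRing} (a b c : X) :
  norm (minus a c) <= norm (minus a b) + norm (minus b c).
Proof. rewrite <- (minus_plus_cancel a b c). apply norm_triangle. Qed.

Lemma norm_minus_sym {X : NormedModule R_AbsRing} (a b : X) :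
  norm (minus a b) = norm (minus b a).
Proof. now rewrite <- (opp_minus b a), norm_opp. Qed.

Lemma minus_eq_zero_eq {X : AbelianGroup} (a b : X) : minus a b = zero -> a = b.
Proof.
intros H. transitivity (plus (minus a b) b).
- unfold minus. now rewrite <- plus_assoc, plus_opp_l, plus_zero_r.
- now rewrite H, plus_zero_l.
Qed.

Definition jointly_continuous {X : UniformSpace} (h : R -> R -> X) (s t : R) : Prop :=
  continuous (fun p : R * R => h (fst p) (snd p)) (s, t).

(** Compactness of the segment over [x]: each of its points has a square on which [h] varies by less
    than eps / 2, and a finite subcover makes the radius uniform in [t]. Two values in the same
    square are compared through its centre. *)
Lemma tube {X : NormedModule R_AbsRing} (h : R -> R -> X) (x c d : R) :
  (forall t, c <= t <= d -> jointly_continuous h x t) ->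
  forall eps : posreal, exists delta : posreal, forall s t,
    Rabs (s - x) < delta -> c <= t <= d -> norm (minus (h s t) (h x t)) < eps.
Proof.
intros H eps.
assert (He : 0 < eps / 2) by (destruct eps as [e He]; simpl; lra).
(* The gauge has to be defined on all of R; outside [[c, d]] the radius 1 is a dummy. *)
assert (Hd : forall t, exists delta : posreal, c <= t <= d -> forall s t',
  Rabs (s - x) < delta -> Rabs (t' - t) < delta ->
  norm (minus (h s t') (h x t)) < eps / 2).
{ intros t. destruct (classic (c <= t <= d)) as [Ht|Ht].
  - specialize (H t Ht). apply (proj1 (filterlim_normP _ _ _)) with (eps := mkposreal _ He) in H.
    destruct H as [del Hdel]. exists del. intros _ s t' Hs Ht'.
    exact (Hdel (s, t') (conj Hs Ht')).
  - exists (mkposreal 1 Rlt_0_1). tauto. }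
set (delta := fun t => proj1_sig (constructive_indefinite_description _ (Hd t))).
destruct (compactness_value_1d c d delta) as [del Hdel].
exists del. intros s t Hs Ht.
specialize (Hdel t Ht). apply NNPP in Hdel.
destruct Hdel as [t0 [Ht0 [Htt0 Hle]]].
assert (Hq : forall s t', Rabs (s - x) < delta t0 -> Rabs (t' - t0) < delta t0 ->
  norm (minus (h s t') (h x t0)) < eps / 2).
{ intros s' t' A B.
  exact (proj2_sig (constructive_indefinite_description _ (Hd t0)) Ht0 s' t' A B). }
eapply Rle_lt_trans. apply (norm_minus_triangle _ (h x t0)).
rewrite (norm_minus_sym (h x t0)).
assert (A : norm (minus (h s t) (h x t0)) < eps / 2) by (apply Hq; lra).
assert (B : norm (minus (h x t) (h x t0)) < eps / 2).
{ apply Hq; [|lra]. rewrite Rminus_diag, Rabs_R0. apply cond_pos. }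
lra.
Qed.

Lemma jointly_continuous_1 {X : UniformSpace} (h : R -> R -> X) (s t : R) :
  jointly_continuous h s t -> continuous (fun s => h s t) s.
Proof.
intros H. refine (continuous_comp_2 (fun s => s) (fun _ => t) h s _ _ H).
apply continuous_id. apply continuous_const.
Qed.

Lemma jointly_continuous_2 {X : UniformSpace} (h : R -> R -> X) (s t : R) :
  jointly_continuous h s t -> continuous (h s) t.
Proof.
intros H. refine (continuous_comp_2 (fun _ => s) (fun t => t) h t _ _ H).
apply continuous_const. apply continuous_id.
Qed.

Lemma jointly_continuous_swap {X : UniformSpace} (h : R -> R -> X) (s t : R) :
  jointly_continuous h s t -> jointly_continuous (fun t s => h s t) t s.
Proof.
intros H. unfold jointly_continuous.
refine (continuous_comp_2 (fun p : R * R => snd p) (fun p => fst p) h (t, s) _ _ H).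
apply continuous_snd. apply continuous_fst.
Qed.

Lemma RInt_minus_norm_le {X : CompleteNormedModule R_AbsRing} (f g : R -> X) (a b e : R) :
  a <= b -> ex_RInt f a b -> ex_RInt g a b ->
  (forall t, a <= t <= b -> norm (minus (f t) (g t)) <= e) ->
  norm (minus (RInt f a b) (RInt g a b)) <= (b - a) * e.
Proof.
intros Hab Hf Hg H.
apply (norm_RInt_le_const (fun t => minus (f t) (g t)) a b); trivial.
apply (is_RInt_minus f g); now apply RInt_correct.
Qed.

Lemma continuous_RInt_param {X : CompleteNormedModule R_AbsRing} (h : R -> R -> X) (x c d : R) :
  c <= d ->
  (forall t, c <= t <= d -> jointly_continuous h x t) ->
  locally x (fun s => ex_RInt (h s) c d) ->
  continuous (fun s => RInt (h s) c d) x.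
Proof.
intros Hcd H Hex. refine (proj2 (continuous_normP (U := R_UniformSpace) (X := X) _ _) _).
intros eps.
(* The [+ 1] covers the degenerate interval and leaves the margin that makes the final inequality
   strict. *)
assert (He : 0 < eps / (d - c + 1)).
{ apply Rdiv_lt_0_compat; [apply cond_pos|lra]. }
destruct (tube h x c d H (mkposreal _ He)) as [del Hdel]. simpl in Hdel.
pose proof (locally_singleton _ _ Hex) as Hx.
generalize (filter_and _ _ Hex (locally_ball x del)). apply filter_imp.
intros s [Hs Hb].
eapply Rle_lt_trans.
{ apply RInt_minus_norm_le with (e := eps / (d - c + 1)); trivial.
  intros t Ht. left. now apply Hdel. }
assert (E : (d - c) * (eps / (d - c + 1)) = eps - eps / (d - c + 1)) by (field; lra).
rewrite E. lra.
Qed.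

Lemma continuous_RInt_param_global {X : CompleteNormedModule R_AbsRing} (h : R -> R -> X) (x c d : R) :
  c <= d -> (forall s t, jointly_continuous h s t) ->
  continuous (fun s => RInt (h s) c d) x.
Proof.
intros Hcd H. apply continuous_RInt_param; trivial.
apply filter_forall. intros s. apply ex_RInt_continuous.
intros z _. now apply jointly_continuous_2.
Qed.

Lemma minus_minus_opp {G : AbelianGroup} (a b s : G) :
  minus (minus a b) s = opp (minus (minus b a) (opp s)).
Proof.
rewrite opp_minus. unfold minus at 1 3. rewrite opp_minus. apply plus_comm.
Qed.

Lemma norm_minus_scal_swap {X : NormedModule R_AbsRing} (a b l : X) (x y : R) :
  norm (minus (minus a b) (scal (x - y) l)) = norm (minus (minus b a) (scal (y - x) l)).
Proof.
rewrite minus_minus_opp, norm_opp. do 2 f_equal.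
refine (eq_trans (eq_sym (scal_opp_l (V := X) (x - y) l)) _).
f_equal. change (- (x - y) = y - x). ring.
Qed.

(* The derivative must be continuous for the fundamental theorem of calculus, which replaces
   the mean value inequality here. *)
Lemma mean_value_inequality {X : CompleteNormedModule R_AbsRing} (f df : R -> X) (x y e : R) (l : X) :
  (forall z, Rmin x y <= z <= Rmax x y ->
    is_derive f z (df z) /\ continuous df z /\ norm (minus (df z) l) <= e) ->
  norm (minus (minus (f y) (f x)) (scal (y - x) l)) <= e * Rabs (y - x).
Proof.
assert (Main : forall x y, x <= y ->
  (forall z, Rmin x y <= z <= Rmax x y ->
    is_derive f z (df z) /\ continuous df z /\ norm (minus (df z) l) <= e) ->
  norm (minus (minus (f y) (f x)) (scal (y - x) l)) <= e * Rabs (y - x)).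
{ clear x y. intros x y Hxy H.
  rewrite Rabs_pos_eq, Rmult_comm by lra.
  apply (norm_RInt_le_const (fun t => minus (df t) l) x y); trivial.
  - intros t Ht. apply H. rewrite Rmin_left, Rmax_right by lra. lra.
  - apply (is_RInt_minus df (fun _ => l)).
    + apply is_RInt_derive; intros z Hz; apply H; trivial.
    + apply (is_RInt_const x y l). }
intros H. destruct (Rle_dec x y) as [Hxy|Hxy].
- now apply Main.
- rewrite Rabs_minus_sym.
  eapply Rle_trans; [right; apply (norm_minus_scal_swap (X := X))|].
  apply Main. lra. intros z. rewrite Rmin_comm, Rmax_comm. apply H.
Qed.

Lemma is_derive_normP {X : NormedModule R_AbsRing} (f : R -> X) (x : R) (l : X) :
  (forall eps : posreal, locally x (fun y =>
     norm (minus (minus (f y) (f x)) (scal (y - x) l)) <= eps * Rabs (y - x))) ->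
  is_derive f x l.
Proof.
intros H. split. apply is_linear_scal_l.
intros y Hy. rewrite <- (is_filter_lim_locally_unique (V := R_NormedModule) x y Hy). intros eps. apply H.
Qed.

(** By [tube], [dh s t] stays close to [dh x t] uniformly in [t]; the mean value inequality turns
    this into a uniform estimate of the increments of [h], which is then integrated over
    [[a, b]]. *)
Lemma is_derive_RInt_param_vec {X : CompleteNormedModule R_AbsRing} (h dh : R -> R -> X) (x a b : R) :
  a <= b ->
  locally x (fun s => forall t, a <= t <= b ->
    is_derive (fun s => h s t) s (dh s t) /\ continuous (fun s => dh s t) s) ->
  (forall t, a <= t <= b -> jointly_continuous dh x t) ->
  locally x (fun s => ex_RInt (h s) a b) ->
  is_derive (fun s => RInt (h s) a b) x (RInt (dh x) a b).
Proof.
intros Hab [d1 Hd] Hc Hex.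
assert (Hdex : ex_RInt (dh x) a b).
{ apply ex_RInt_continuous. rewrite Rmin_left, Rmax_right by lra.
  intros z Hz. apply (jointly_continuous_2 dh). now apply Hc. }
apply is_derive_normP. intros eps.
assert (He : 0 < eps / (b - a + 1)).
{ apply Rdiv_lt_0_compat; [apply cond_pos|lra]. }
destruct (tube dh x a b Hc (mkposreal _ He)) as [d2 Hd2]. simpl in Hd2.
pose proof (locally_singleton _ _ Hex) as Hx.
generalize (filter_and _ _ Hex (filter_and _ _ (locally_ball x d1) (locally_ball x d2))).
apply filter_imp. intros y [Hy [Hb1 Hb2]].
change (Rabs (y - x) < d1) in Hb1. change (Rabs (y - x) < d2) in Hb2.
assert (E : (b - a) * (eps / (b - a + 1) * Rabs (y - x)) <= eps * Rabs (y - x)).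
{ replace ((b - a) * (eps / (b - a + 1) * Rabs (y - x)))
    with ((eps - eps / (b - a + 1)) * Rabs (y - x)) by (field; lra).
  apply Rmult_le_compat_r. apply Rabs_pos. lra. }
eapply Rle_trans; [|exact E].
apply (norm_RInt_le_const (fun t => minus (minus (h y t) (h x t)) (scal (y - x) (dh x t))) a b); trivial.
- intros t Ht.
  apply (mean_value_inequality (fun s => h s t) (fun s => dh s t)).
  intros z Hz.
  assert (Hz' : Rabs (z - x) <= Rabs (y - x)).
  { revert Hz. unfold Rmin, Rmax. destruct (Rle_dec x y); intros Hz;
    unfold Rabs; destruct (Rcase_abs (z - x)), (Rcase_abs (y - x)); lra. }
  destruct (fun A => Hd z A t Ht) as [D1 D2]. { change (Rabs (z - x) < d1). lra. }
  split; [exact D1|split; [exact D2|]]. left. apply Hd2; trivial. lra.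
- apply (is_RInt_minus (fun t => minus (h y t) (h x t)) (fun t => scal (y - x) (dh x t))).
  + apply (is_RInt_minus (h y) (h x)); now apply RInt_correct.
  + apply (is_RInt_scal (dh x)). now apply RInt_correct.
Qed.

Lemma is_derive_RInt_cont {X : CompleteNormedModule R_AbsRing} (f : R -> X) (a x : R) :
  (forall t, continuous f t) -> is_derive (fun y => RInt f a y) x (f x).
Proof.
intros H. apply (is_derive_RInt f _ a); trivial.
apply filter_forall. intros y. apply RInt_correct, ex_RInt_continuous. intros; apply H.
Qed.

Lemma ex_RInt_cont {X : CompleteNormedModule R_AbsRing} (f : R -> X) (a b : R) :
  (forall t, continuous f t) -> ex_RInt f a b.
Proof. intros H. apply ex_RInt_continuous. intros; apply H. Qed.

(** Both sides, as functions of the upper limit [b], vanish at [a] and have the same derivative: one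
    by the fundamental theorem, the other by differentiation under the integral. *)
Lemma Fubini {X : CompleteNormedModule R_AbsRing} (h : R -> R -> X) (a b c d : R) :
  a <= b -> c <= d -> (forall s t, jointly_continuous h s t) ->
  RInt (fun s => RInt (fun t => h s t) c d) a b =
  RInt (fun t => RInt (fun s => h s t) a b) c d.
Proof.
intros Hab Hcd Hc.
destruct Hab as [Hab| <-].
2:{ rewrite RInt_point. rewrite (RInt_ext _ (fun _ => zero)).
    2:{ intros; apply RInt_point. } rewrite RInt_const. symmetry. exact (scal_zero_r (V := X) _). }
assert (C1 : forall s, continuous (fun s => RInt (fun t => h s t) c d) s).
{ intros s. now apply continuous_RInt_param_global. }
apply minus_eq_zero_eq.
set (D := fun x => minus (RInt (fun s => RInt (fun t => h s t) c d) a x)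
  (RInt (fun t => RInt (fun s => h s t) a x) c d)).
change (D b = zero).
rewrite <- (eq_is_derive D a b); trivial.
- unfold D. rewrite RInt_point. rewrite (RInt_ext _ (fun _ => zero)).
  2:{ intros; apply RInt_point. }
  rewrite RInt_const. transitivity (minus (zero : X) zero); [|apply minus_eq_zero].
  f_equal. exact (scal_zero_r (V := X) (d - c)).
- intros x Hx.
  refine (eq_ind _ (fun l : X => is_derive D x l) _ zero
    (minus_eq_zero (RInt (fun t => h x t) c d : X))).
  apply (is_derive_minus (V := X)).
  + now apply (is_derive_RInt_cont (fun s => RInt (fun t => h s t) c d)).
  + apply (is_derive_RInt_param_vec (fun x t => RInt (fun s => h s t) a x)); trivial.
    * apply filter_forall. intros s t Ht. split.
      -- apply (is_derive_RInt_cont (fun s => h s t)). intros; now apply jointly_continuous_1.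
      -- now apply jointly_continuous_1.
    * exists (mkposreal (x - a + 1) ltac:(lra)). intros y Hy.
      apply ex_RInt_cont. intros t.
      (* The neighbourhood of [x] may reach below [a], while the continuity lemma wants ordered
         limits; there the integral is reversed. *)
      destruct (Rle_dec a y) as [Hay|Hay].
      -- apply continuous_RInt_param_global; trivial. intros. now apply jointly_continuous_swap.
      -- apply continuous_ext with (fun t => opp (RInt (fun s => h s t) y a)).
         { intros u. apply opp_RInt_swap. apply ex_RInt_cont. intros; now apply jointly_continuous_1. }
         apply (continuous_opp (V := X)). apply continuous_RInt_param_global; [lra|].
         intros. now apply jointly_continuous_swap.
Qed.

Lemma is_linear_is_derive {X Y : NormedModule R_AbsRing} (L : X -> Y) (f : R -> X) (x : R) (l : X) :
  is_linear L -> is_derive f x l -> is_derive (fun t => L (f t)) x (L l).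
Proof.
intros HL Hf. unfold is_derive.
apply (filterdiff_ext_lin (U := R_NormedModule) (V := Y) (fun t : R => L (f t)) (fun t : R => L (scal t l))).
- refine (filterdiff_comp (U := R_NormedModule) f L _ L Hf _). now apply filterdiff_linear.
- intros y. exact (linear_scal L HL y l).
Qed.

Lemma is_linear_continuous {X Y : NormedModule R_AbsRing} (L : X -> Y) (x : X) :
  is_linear L -> continuous L x.
Proof. intros HL. apply (filterdiff_continuous L). exists L. now apply filterdiff_linear. Qed.

(** [L] maps a primitive of [f] to a primitive of [L] after [f], so no Riemann sums are needed. *)
Lemma is_linear_RInt {X Y : CompleteNormedModule R_AbsRing} (L : X -> Y) (f : R -> X) (a b : R) :
  is_linear L -> (forall t, continuous f t) ->
  RInt (fun t => L (f t)) a b = L (RInt f a b).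
Proof.
intros HL Hf. apply is_RInt_unique.
replace (L (RInt f a b)) with (minus (L (RInt f a b)) (L (RInt f a a))).
- apply (is_RInt_derive (fun x => L (RInt f a x))).
  + intros x _. apply (is_linear_is_derive (X := X) (Y := Y)); trivial. now apply is_derive_RInt_cont.
  + intros x _. apply (continuous_comp f L); trivial. now apply (is_linear_continuous (X := X) (Y := Y)).
- rewrite RInt_point. transitivity (minus (L (RInt f a b)) (zero : Y)).
  + f_equal. exact (linear_zero (U := X) (V := Y) L HL).
  + apply (minus_zero_r (G := Y)).
Qed.

Lemma jointly_continuous_scal {X : NormedModule R_AbsRing} (k : R -> R -> R) (f : R -> R -> X) (s t : R) :
  jointly_continuous k s t -> jointly_continuous f s t ->
  jointly_continuous (fun s t => scal (k s t) (f s t)) s t.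
Proof.
intros Hk Hf. exact (continuous_scal (fun p : R * R => k (fst p) (snd p)) _ _ Hk Hf).
Qed.

Lemma jointly_continuous_fst {X : UniformSpace} (f : R -> X) (s t : R) :
  continuous f s -> jointly_continuous (fun s _ => f s) s t.
Proof. intros H. apply (continuous_comp (fun p : R * R => fst p) f); [apply continuous_fst|exact H]. Qed.

Lemma jointly_continuous_snd {X : UniformSpace} (f : R -> X) (s t : R) :
  continuous f t -> jointly_continuous (fun _ t => f t) s t.
Proof. intros H. apply (continuous_comp (fun p : R * R => snd p) f); [apply continuous_snd|exact H]. Qed.

Lemma jointly_continuous_comp {X : UniformSpace} (k : R -> R -> R) (f : R -> X) (s t : R) :
  jointly_continuous k s t -> continuous f (k s t) ->
  jointly_continuous (fun s t => f (k s t)) s t.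
Proof. intros Hk Hf. exact (continuous_comp (fun p : R * R => k (fst p) (snd p)) f _ Hk Hf). Qed.

Lemma jointly_continuous_minus (k l : R -> R -> R) (s t : R) :
  jointly_continuous k s t -> jointly_continuous l s t ->
  jointly_continuous (fun s t => k s t - l s t) s t.
Proof.
intros Hk Hl. exact (continuous_minus (fun p : R * R => k (fst p) (snd p)) _ _ Hk Hl).
Qed.

(** * Truncated powers and the desingularizing substitution *)

(* [Rpower x a] is [1] for [x <= 0], so it is not continuous at 0. *)
Definition tpow (a x : R) : R := if Rle_dec x 0 then 0 else Rpower x a.

Lemma tpow_pos (a x : R) : 0 < x -> tpow a x = Rpower x a.
Proof. intros H. unfold tpow. destruct (Rle_dec x 0); [lra|reflexivity]. Qed.

Lemma tpow_npos (a x : R) : x <= 0 -> tpow a x = 0.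
Proof. intros H. unfold tpow. destruct (Rle_dec x 0); [reflexivity|lra]. Qed.

Lemma Rpower_gt_0 (x a : R) : 0 < Rpower x a.
Proof. apply exp_pos. Qed.

Lemma tpow_gt_0 (a x : R) : 0 < x -> 0 < tpow a x.
Proof. intros H. rewrite tpow_pos by trivial. apply Rpower_gt_0. Qed.

Lemma tpow_ge_0 (a x : R) : 0 <= tpow a x.
Proof. unfold tpow. destruct (Rle_dec x 0); [lra|]. left; apply Rpower_gt_0. Qed.

Lemma tpow_le (a x y : R) : 0 <= a -> x <= y -> tpow a x <= tpow a y.
Proof.
intros Ha Hxy. destruct (Rle_dec x 0) as [Hx|Hx].
- rewrite (tpow_npos a x) by trivial. apply tpow_ge_0.
- rewrite !tpow_pos by lra. apply Rle_Rpower_l; lra.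
Qed.

Lemma tpow_lt (a x y : R) : 0 < a -> 0 <= x -> x < y -> tpow a x < tpow a y.
Proof.
intros Ha Hx Hxy. destruct (Rle_dec x 0) as [Hx0|Hx0].
- rewrite (tpow_npos a x) by trivial. apply tpow_gt_0. lra.
- rewrite !tpow_pos by lra. apply Rlt_Rpower_l; lra.
Qed.

Lemma Rpower_mult_base (x y a : R) : 0 < x -> 0 < y -> Rpower (x * y) a = Rpower x a * Rpower y a.
Proof. intros. symmetry. now apply Rpower_mult_distr. Qed.

Lemma tpow_mult_base (a x y : R) : 0 < x -> tpow a (x * y) = Rpower x a * tpow a y.
Proof.
intros Hx. destruct (Rle_dec y 0) as [Hy|Hy].
- rewrite !tpow_npos. ring. trivial. rewrite <- (Rmult_0_r x). apply Rmult_le_compat_l; lra.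
- assert (Hy' : 0 < y) by lra. rewrite !tpow_pos by (trivial; now apply Rmult_lt_0_compat).
  now apply Rpower_mult_base.
Qed.

Lemma tpow_tpow (a b x : R) : tpow a (tpow b x) = tpow (b * a) x.
Proof.
destruct (Rle_dec x 0) as [Hx|Hx].
- rewrite (tpow_npos b x), !tpow_npos; trivial. lra.
- assert (Hx' : 0 < x) by lra. rewrite (tpow_pos b x), (tpow_pos (b * a) x), tpow_pos; trivial.
  apply Rpower_mult. apply Rpower_gt_0.
Qed.

Lemma tpow_1 (x : R) : 0 <= x -> tpow 1 x = x.
Proof.
intros [Hx| <-]; [|apply tpow_npos; lra]. rewrite tpow_pos by trivial. now apply Rpower_1.
Qed.

Lemma tpow_inv_l (a x : R) : 0 < a -> 0 <= x -> tpow (/ a) (tpow a x) = x.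
Proof. intros Ha Hx. rewrite tpow_tpow, Rinv_r by lra. now apply tpow_1. Qed.

Lemma tpow_inv_r (a x : R) : 0 < a -> 0 <= x -> tpow a (tpow (/ a) x) = x.
Proof. intros Ha Hx. rewrite tpow_tpow, Rinv_l by lra. now apply tpow_1. Qed.

Lemma is_derive_Rpower (a x : R) : 0 < x -> is_derive (fun x => Rpower x a) x (a * Rpower x (a - 1)).
Proof. intros Hx. apply is_derive_Reals. now apply derivable_pt_lim_power. Qed.

Lemma locally_pos (x : R) : 0 < x -> locally x (fun y => 0 < y).
Proof. intros Hx. now apply (open_gt 0). Qed.

Lemma is_derive_tpow_pos (a x : R) : 0 < x -> is_derive (tpow a) x (a * tpow (a - 1) x).
Proof.
intros Hx. rewrite tpow_pos by trivial.
apply is_derive_ext_loc with (fun x => Rpower x a).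
- generalize (locally_pos x Hx). apply filter_imp. intros y Hy. now rewrite tpow_pos.
- now apply is_derive_Rpower.
Qed.

Lemma locally_neg (x : R) : x < 0 -> locally x (fun y => y < 0).
Proof. intros Hx. now apply (open_lt 0). Qed.

Lemma tpow_near_0 (a : R) : 0 < a -> forall eps : posreal, exists d : posreal, forall x,
  Rabs x < d -> tpow a x < eps.
Proof.
intros Ha eps. exists (mkposreal (Rpower eps (/ a)) (Rpower_gt_0 _ _)). simpl.
intros x Hx. destruct (Rle_dec x 0) as [H0|H0].
- rewrite tpow_npos by trivial. apply cond_pos.
- rewrite Rabs_pos_eq in Hx by lra.
  rewrite <- (tpow_inv_r a eps) by (trivial; left; apply cond_pos).
  apply tpow_lt; trivial. lra. now rewrite (tpow_pos _ eps) by apply cond_pos.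
Qed.

Lemma continuous_tpow (a x : R) : 0 < a -> continuous (tpow a) x.
Proof.
intros Ha. destruct (Rtotal_order x 0) as [Hx|[->|Hx]].
- apply continuous_ext_loc with (fun _ => 0); [|apply continuous_const].
  generalize (locally_neg x Hx). apply filter_imp. intros y Hy. rewrite tpow_npos; lra.
- refine (proj2 (continuous_normP (U := R_UniformSpace) (X := R_NormedModule) _ _) _).
  intros eps. destruct (tpow_near_0 a Ha eps) as [d Hd]. exists d. intros y Hy.
  change (Rabs (tpow a y - tpow a 0) < eps). rewrite (tpow_npos a 0) by lra.
  rewrite Rminus_0_r, Rabs_pos_eq by apply tpow_ge_0. apply Hd.
  change (Rabs (y - 0) < d) in Hy. now rewrite Rminus_0_r in Hy.
- apply (ex_derive_continuous (V := R_NormedModule)). eexists. now apply is_derive_tpow_pos.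
Qed.

Lemma is_derive_tpow (a x : R) : 1 < a -> is_derive (tpow a) x (a * tpow (a - 1) x).
Proof.
intros Ha. destruct (Rtotal_order x 0) as [Hx|[->|Hx]].
- rewrite tpow_npos, Rmult_0_r by lra. apply is_derive_ext_loc with (fun _ => 0); [|apply @is_derive_const].
  generalize (locally_neg x Hx). apply filter_imp. intros y Hy. rewrite tpow_npos; lra.
- rewrite tpow_npos, Rmult_0_r by lra. apply (is_derive_normP (X := R_NormedModule)).
  intros eps. destruct (tpow_near_0 (a - 1) ltac:(lra) eps) as [d Hd]. exists d. intros y Hy.
  change (Rabs (y - 0) < d) in Hy. rewrite Rminus_0_r in Hy.
  change (Rabs (tpow a y - tpow a 0 - (y - 0) * 0) <= eps * Rabs (y - 0)).
  rewrite (tpow_npos a 0) by lra. rewrite !Rminus_0_r, Rmult_0_r, Rminus_0_r.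
  rewrite Rabs_pos_eq by apply tpow_ge_0.
  destruct (Rle_dec y 0) as [H0|H0].
  + rewrite tpow_npos by trivial. apply Rmult_le_pos. left; apply cond_pos. apply Rabs_pos.
  + replace (tpow a y) with (tpow (a - 1) y * y).
    * rewrite (Rabs_pos_eq y) by lra. apply Rmult_le_compat_r. lra. left. now apply Hd.
    * rewrite !tpow_pos by lra. rewrite <- (Rpower_1 y) at 2 by lra. rewrite <- Rpower_plus.
      f_equal. ring.
- now apply is_derive_tpow_pos.
Qed.

(** The filter at the upper end is left free so that the same statement serves [J], with
    [at_left t], and [Gamma], with [p_infty]. *)
Lemma is_RInt_gen_primitive {X : CompleteNormedModule R_AbsRing} (f Phi : R -> X) (c : R)
    (Fb : (R -> Prop) -> Prop) {FF : ProperFilter Fb} (P : R -> Prop) (l0 l1 : X) :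
  0 < c -> Fb P ->
  (forall a b, 0 < a < c -> P b -> is_RInt f a b (minus (Phi b) (Phi a))) ->
  filterlim Phi (at_right 0) (locally l0) -> filterlim Phi Fb (locally l1) ->
  is_RInt_gen f (at_right 0) Fb (minus l1 l0).
Proof.
intros Hc HP Hint H0 H1 Q HQ. unfold filtermapi.
assert (HL : filterlim (fun ab : R * R => minus (Phi (snd ab)) (Phi (fst ab)))
  (filter_prod (at_right 0) Fb) (locally (minus l1 l0))).
{ apply (filterlim_comp_2 (G := locally l1) (H := locally (opp l0))
    (fun ab : R * R => Phi (snd ab)) (fun ab : R * R => opp (Phi (fst ab))) plus).
  - exact (filterlim_comp _ _ _ (fun ab : R * R => snd ab) Phi _ _ _ filterlim_snd H1).
  - refine (filterlim_comp _ _ _ (fun ab : R * R => Phi (fst ab)) opp _ _ _ _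
      (filterlim_opp (V := X) l0)).
    exact (filterlim_comp _ _ _ (fun ab : R * R => fst ab) Phi _ _ _ filterlim_fst H0).
  - apply (filterlim_plus (V := X)). }
specialize (HL Q HQ). unfold filtermap in HL.
assert (HR : filter_prod (at_right 0) Fb (fun ab => 0 < fst ab < c /\ P (snd ab))).
{ exists (fun a => 0 < a < c) P; trivial.
  - exists (mkposreal c Hc). intros y Hy Hy0. split; trivial.
    change (Rabs (y - 0) < c) in Hy. rewrite Rminus_0_r, Rabs_pos_eq in Hy; lra.
  - simpl. tauto. }
generalize (filter_and _ _ HL HR). apply filter_imp.
intros [a b] [HQab [Ha HPb]]. simpl in *. eexists. split; [now apply Hint|exact HQab].
Qed.

Lemma RInt_minus_Chasles {X : CompleteNormedModule R_AbsRing} (f : R -> X) (a b c : R) :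
  (forall t, continuous f t) -> RInt f a b = minus (RInt f c b) (RInt f c a).
Proof.
intros H. rewrite <- (RInt_Chasles f c a b) by now apply ex_RInt_cont.
unfold minus. rewrite plus_comm, plus_assoc.
transitivity (plus (zero : X) (RInt f a b)). now rewrite plus_zero_l.
f_equal. symmetry. apply (plus_opp_l (G := X)).
Qed.

Lemma continuous_RInt_end {X : CompleteNormedModule R_AbsRing} (f : R -> X) (a x : R) :
  (forall t, continuous f t) -> continuous (fun y => RInt f a y) x.
Proof.
intros H. apply (ex_derive_continuous (V := X)). eexists. now apply is_derive_RInt_cont.
Qed.

Lemma continuous_at_right {U : UniformSpace} (f : R -> U) (x : R) :
  continuous f x -> filterlim f (at_right x) (locally (f x)).
Proof. intros H. apply filterlim_filter_le_1 with (2 := H). apply filter_le_within. Qed.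

Lemma continuous_at_left {U : UniformSpace} (f : R -> U) (x : R) :
  continuous f x -> filterlim f (at_left x) (locally (f x)).
Proof. intros H. apply filterlim_filter_le_1 with (2 := H). apply filter_le_within. Qed.

(** The asymptotic class of the orbits: f(t) behaves like l t^(theta-1) at 0. For [theta = 1] it
    contains the continuous functions, so [J] of orbits and [J] of continuous functions share one
    theory. *)
Definition regular {X : NormedModule R_AbsRing} (theta : R) (f : R -> X) (l : X) : Prop :=
  (forall t, 0 < t -> continuous f t) /\
  filterlim (fun t => scal (/ Rpower t (theta - 1)) (f t)) (at_right 0) (locally l).

(* The substitution [s = r^(1/theta)] turns [f s ds] into [desing theta f l r dr], which is
   continuous up to [r = 0]. *)
Definition desing {X : NormedModule R_AbsRing} (theta : R) (f : R -> X) (l : X) (r : R) : X :=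
  if Rle_dec r 0 then scal (/ theta) l
  else scal (/ theta * / Rpower (Rpower r (/ theta)) (theta - 1)) (f (Rpower r (/ theta))).

Lemma continuous_extend {X : NormedModule R_AbsRing} (f : R -> X) (l : X) :
  (forall t, 0 < t -> continuous f t) -> filterlim f (at_right 0) (locally l) ->
  forall t, continuous (fun r => if Rle_dec r 0 then l else f r) t.
Proof.
intros Hc H0 t. destruct (Rtotal_order t 0) as [Ht|[->|Ht]].
- apply continuous_ext_loc with (fun _ => l); [|apply continuous_const].
  generalize (locally_neg t Ht). apply filter_imp. intros y Hy. destruct (Rle_dec y 0); trivial; lra.
- refine (proj2 (continuous_normP (U := R_UniformSpace) (X := X) _ _) _).
  intros eps. destruct (proj1 (filterlim_normP _ _ _) H0 eps) as [d Hd]. exists d. intros y Hy.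
  destruct (Rle_dec 0 0); [|lra]. destruct (Rle_dec y 0).
  + rewrite minus_eq_zero. eapply Rle_lt_trans; [right; apply (norm_zero (V := X))|apply cond_pos].
  + apply Hd; trivial. lra.
- apply continuous_ext_loc with f; [|now apply Hc].
  generalize (locally_pos t Ht). apply filter_imp. intros y Hy. destruct (Rle_dec y 0); trivial; lra.
Qed.

Lemma continuous_Rpower (a x : R) : 0 < x -> continuous (fun x => Rpower x a) x.
Proof.
intros Hx. apply (ex_derive_continuous (V := R_NormedModule)). eexists. now apply is_derive_Rpower.
Qed.

Lemma continuous_desing {X : NormedModule R_AbsRing} (theta : R) (f : R -> X) (l : X) :
  0 < theta -> regular theta f l -> forall r, continuous (desing theta f l) r.
Proof.
intros Hth [Hc H0]. apply continuous_extend.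
- intros t Ht.
  apply (continuous_scal (fun r => / theta * / Rpower (Rpower r (/ theta)) (theta - 1))
    (fun r => f (Rpower r (/ theta)))).
  + apply (continuous_mult (fun _ => / theta) (fun r => / Rpower (Rpower r (/ theta)) (theta - 1))).
    apply continuous_const.
    apply (continuous_comp (fun r => Rpower (Rpower r (/ theta)) (theta - 1)) Rinv).
    * apply (continuous_comp (fun r => Rpower r (/ theta)) (fun s => Rpower s (theta - 1))).
      now apply continuous_Rpower. apply continuous_Rpower, Rpower_gt_0.
    * apply continuous_Rinv. apply Rgt_not_eq, Rpower_gt_0.
  + apply (continuous_comp (fun r => Rpower r (/ theta)) f). now apply continuous_Rpower.
    apply Hc, Rpower_gt_0.
- apply filterlim_ext with
    (fun r => scal (/ theta) (scal (/ Rpower (Rpower r (/ theta)) (theta - 1)) (f (Rpower r (/ theta))))).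
  { intros r. apply (scal_assoc (/ theta) (/ Rpower (Rpower r (/ theta)) (theta - 1))). }
  apply filterlim_comp with (locally l).
  2: apply (filterlim_scal_r (V := X) (/ theta) l).
  apply (filterlim_comp R R X (fun r => Rpower r (/ theta))
    (fun s => scal (/ Rpower s (theta - 1)) (f s)) _ (at_right 0)); trivial.
  intros P [d Hd]. destruct (tpow_near_0 (/ theta) (Rinv_0_lt_compat _ Hth) d) as [e He].
  exists e. intros y Hy Hy0. change (Rabs (y - 0) < e) in Hy. rewrite Rminus_0_r in Hy.
  apply Hd; [|apply Rpower_gt_0].
  change (Rabs (Rpower y (/ theta) - 0) < d).
  rewrite Rminus_0_r, Rabs_pos_eq by (left; apply Rpower_gt_0).
  rewrite <- tpow_pos by trivial. now apply He.
Qed.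

(** Away from 0 this is the ordinary change of variable s = r^(1/theta); the factor [phi] stands for
    the kernel in [J] and for the exponential in [Gamma]. *)
Lemma is_RInt_desing {X : CompleteNormedModule R_AbsRing} (theta : R) (f : R -> X) (l : X)
    (phi : R -> R) (a b : R) :
  0 < theta -> regular theta f l -> (forall x, continuous phi x) ->
  0 < a -> 0 < b ->
  is_RInt (fun s => scal (phi s) (f s)) a b
    (RInt (fun r => scal (phi (tpow (/ theta) r)) (desing theta f l r)) (tpow theta a) (tpow theta b)).
Proof.
intros Hth [Hc H0] Hphi Ha Hb.
assert (Hcg : forall s, 0 < s -> continuous (fun s => scal (phi s) (f s)) s).
{ intros s Hs. apply (continuous_scal phi f). apply Hphi. now apply Hc. }
assert (Hmin : forall x, 0 < x -> 0 < tpow theta x) by (intros; now apply tpow_gt_0).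
assert (E : RInt (fun r => scal (phi (tpow (/ theta) r)) (desing theta f l r)) (tpow theta a) (tpow theta b)
  = RInt (fun s => scal (phi s) (f s)) a b).
{ rewrite <- (tpow_inv_l theta a) at 2 by lra. rewrite <- (tpow_inv_l theta b) at 2 by lra.
  rewrite <- (RInt_comp (fun s => scal (phi s) (f s)) (tpow (/ theta)) (fun r => / theta * tpow (/ theta - 1) r)).
  - apply RInt_ext. intros r Hr.
    assert (Hr0 : 0 < r).
    { eapply Rlt_trans; [|exact (proj1 Hr)]. apply Rmin_glb_lt; now apply Hmin. }
    unfold desing. destruct (Rle_dec r 0); [lra|].
    rewrite (tpow_pos (/ theta) r), (tpow_pos (/ theta - 1) r) by trivial.
    rewrite Rpower_mult, <- Rpower_Ropp.
    (* The weight in [desing] is exactly the Jacobian: s^(1-theta) equals r^(1/theta-1) at s =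
       r^(1/theta). *)
    replace (- (/ theta * (theta - 1))) with (/ theta - 1) by (field; lra).
    refine (eq_trans (scal_assoc (V := X) _ _ _) (eq_sym (eq_trans (scal_assoc (V := X) _ _ _) _))).
    f_equal. apply (Rmult_comm).
  - intros x Hx. apply Hcg. apply tpow_gt_0. eapply Rlt_le_trans; [|exact (proj1 Hx)].
    apply Rmin_glb_lt; now apply Hmin.
  - intros x Hx. assert (Hx0 : 0 < x).
    { eapply Rlt_le_trans; [|exact (proj1 Hx)]. apply Rmin_glb_lt; now apply Hmin. }
    split. now apply is_derive_tpow_pos.
    apply (continuous_mult (fun _ => / theta)). apply continuous_const.
    apply (ex_derive_continuous (V := R_NormedModule)). eexists. now apply is_derive_tpow_pos. }
rewrite E. apply RInt_correct, ex_RInt_continuous. intros z Hz. apply Hcg.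
eapply Rlt_le_trans; [|exact (proj1 Hz)]. now apply Rmin_glb_lt.
Qed.

Lemma continuous_kernel (a t r theta : R) : 0 < a -> 0 < theta ->
  continuous (fun r => tpow a (t - tpow (/ theta) r)) r.
Proof.
intros Ha Hth. apply (continuous_comp (fun r => t - tpow (/ theta) r) (tpow a)).
- apply (continuous_minus (fun _ => t) (tpow (/ theta))). apply continuous_const.
  apply continuous_tpow. now apply Rinv_0_lt_compat.
- now apply continuous_tpow.
Qed.

Lemma RInt_zero {X : CompleteNormedModule R_AbsRing} (f : R -> X) (a b : R) :
  (forall t, Rmin a b < t < Rmax a b -> f t = zero) -> RInt f a b = zero.
Proof.
intros H. rewrite (RInt_ext f (fun _ => zero)) by trivial.
rewrite RInt_const. exact (scal_zero_r (V := X) _).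
Qed.

(** The truncated kernel vanishes beyond s = t, so the range may end at any [b] past t^theta. This
    frees the limits from [t], and [1 < alpha] makes the truncated kernel continuous. *)
Lemma J_desing {X : CompleteNormedModule R_AbsRing} (theta alpha : R) (f : R -> X) (l : X) (t b : R) :
  0 < theta -> 1 < alpha -> regular theta f l -> 0 < t -> tpow theta t <= b ->
  J alpha f t = scal (/ Gamma alpha)
    (RInt (fun r => scal (tpow (alpha - 1) (t - tpow (/ theta) r)) (desing theta f l r)) 0 b).
Proof.
intros Hth Hal Hf Ht Hb. unfold J. f_equal.
set (h := fun r => scal (tpow (alpha - 1) (t - tpow (/ theta) r)) (desing theta f l r)).
assert (Hh : forall r, continuous h r).
{ intros r. apply (continuous_scal (fun r => tpow (alpha - 1) (t - tpow (/ theta) r)) (desing theta f l)).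
  apply continuous_kernel; lra. now apply continuous_desing. }
assert (HPhi : forall x, continuous (fun b => RInt h 0 (tpow theta b)) x).
{ intros x. apply (continuous_comp (tpow theta) (fun b => RInt h 0 b)).
  now apply continuous_tpow. now apply continuous_RInt_end. }
assert (E : RInt h 0 b = RInt h 0 (tpow theta t)).
{ rewrite <- (RInt_Chasles h 0 (tpow theta t) b) by now apply ex_RInt_cont.
  rewrite (RInt_zero h (tpow theta t) b). apply (plus_zero_r (G := X)).
  intros r Hr. rewrite Rmin_left in Hr by trivial. unfold h. rewrite tpow_npos.
  exact (scal_zero_l (V := X) _). apply Rle_minus.
  rewrite <- (tpow_inv_l theta t) by lra. apply tpow_le; [|lra]. left. now apply Rinv_0_lt_compat. }
rewrite E.
transitivity (minus (RInt h 0 (tpow theta t)) (RInt h 0 (tpow theta 0))).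
- apply (is_RInt_gen_unique (Fa := at_right 0) (Fb := at_left t)).
  apply (is_RInt_gen_primitive _ (fun b => RInt h 0 (tpow theta b)) (t / 2) _ (fun b => t / 2 < b < t)).
  + lra.
  + exists (mkposreal (t / 2) ltac:(lra)). intros y Hy Hyt. split; trivial.
    change (Rabs (y - t) < t / 2) in Hy. apply Rabs_lt_between in Hy. lra.
  + intros a b' Ha Hb'.
    rewrite <- RInt_minus_Chasles by trivial.
    apply is_RInt_ext with (fun s => scal (tpow (alpha - 1) (t - s)) (f s)).
    * intros s Hs. rewrite tpow_pos; trivial. rewrite Rmax_right in Hs; lra.
    * apply (is_RInt_desing theta f l (fun s => tpow (alpha - 1) (t - s))); trivial; try lra.
      intros x. apply (continuous_comp (fun r => t - r) (tpow (alpha - 1))).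
      apply (continuous_minus (fun _ => t) (fun r => r)). apply continuous_const. apply continuous_id.
      apply continuous_tpow. lra.
  + apply (continuous_at_right (fun b => RInt h 0 (tpow theta b))). apply HPhi.
  + apply (continuous_at_left (fun b => RInt h 0 (tpow theta b))). apply HPhi.
- rewrite (tpow_npos theta 0), RInt_point by lra. apply (minus_zero_r (G := X)).
Qed.

Lemma regular_continuous {X : NormedModule R_AbsRing} (f : R -> X) :
  (forall t, continuous f t) -> regular 1 f (f 0).
Proof.
intros Hf. split. intros; apply Hf.
apply filterlim_ext_loc with f; [|now apply continuous_at_right].
exists (mkposreal 1 Rlt_0_1). intros y _ Hy.
rewrite Rminus_diag, Rpower_O, Rinv_1 by trivial. symmetry. exact (scal_one (V := X) _).
Qed.

Lemma J_continuous {X : CompleteNormedModule R_AbsRing} (alpha : R) (f : R -> X) (t b : R) :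
  1 < alpha -> (forall r, continuous f r) -> 0 < t -> t <= b ->
  J alpha f t = scal (/ Gamma alpha) (RInt (fun r => scal (tpow (alpha - 1) (t - r)) (f r)) 0 b).
Proof.
intros Hal Hf Ht Hb.
assert (Hreg := regular_continuous (X := X) f Hf).
rewrite (J_desing 1 alpha f (f 0) t b); trivial; try lra.
2:{ rewrite tpow_1; lra. }
f_equal. apply RInt_ext. intros r Hr. rewrite Rmin_left in Hr by lra.
rewrite Rinv_1, tpow_1 by lra. f_equal. unfold desing. destruct (Rle_dec r 0); [lra|].
rewrite Rinv_1, Rminus_diag, Rpower_1, Rpower_O, Rinv_1, Rmult_1_l by lra. exact (scal_one (V := X) _).
Qed.

(** * The Beta-Gamma identity *)

(** Substituting r = s^theta u yields s^theta from the differential and s^(gamma-1) from the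
    homogeneous kernel. What is left depends on [s] only through the argument of [F]. *)
Lemma kernel_scaling {X : CompleteNormedModule R_AbsRing} (theta gamma s : R) (F : R -> X) :
  0 < theta -> 1 < gamma -> 0 < s -> (forall r, continuous F r) ->
  RInt (fun r => scal (tpow (gamma - 1) (s - tpow (/ theta) r)) (F r)) 0 (tpow theta s) =
  scal (Rpower s (gamma + theta - 1))
    (RInt (fun u => scal (tpow (gamma - 1) (1 - tpow (/ theta) u)) (F (tpow theta s * u))) 0 1).
Proof.
intros Hth Hga Hs HF.
assert (Hps : 0 < tpow theta s) by now apply tpow_gt_0.
set (h := fun r => scal (tpow (gamma - 1) (s - tpow (/ theta) r)) (F r)).
assert (Hh : forall r, continuous h r).
{ intros r. apply (continuous_scal (fun r => tpow (gamma - 1) (s - tpow (/ theta) r)) F); trivial.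
  apply continuous_kernel; lra. }
assert (E := RInt_comp_lin h (tpow theta s) 0 0 1).
rewrite Rmult_0_r, Rmult_1_r, !Rplus_0_r in E. rewrite <- E by now apply ex_RInt_cont.
rewrite <- RInt_scal.
2:{ apply ex_RInt_cont. intros r.
    apply (continuous_scal (fun u => tpow (gamma - 1) (1 - tpow (/ theta) u)) (fun u => F (tpow theta s * u))).
    apply continuous_kernel; lra.
    apply (continuous_comp (fun u => tpow theta s * u) F); trivial.
    apply (continuous_scal_r (V := R_NormedModule) (tpow theta s) (fun u => u)). apply continuous_id. }
apply RInt_ext. intros u Hu. unfold h. rewrite Rplus_0_r.
refine (eq_trans (scal_assoc (V := X) _ _ _) (eq_sym (eq_trans (scal_assoc (V := X) _ _ _) _))).
f_equal.
change (Rpower s (gamma + theta - 1) * tpow (gamma - 1) (1 - tpow (/ theta) u)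
  = tpow theta s * tpow (gamma - 1) (s - tpow (/ theta) (tpow theta s * u))).
rewrite tpow_mult_base by trivial.
rewrite <- (tpow_pos (/ theta) (tpow theta s)), tpow_inv_l by lra.
replace (s - s * tpow (/ theta) u) with (s * (1 - tpow (/ theta) u)) by ring.
rewrite (tpow_mult_base (gamma - 1) s) by trivial.
rewrite (tpow_pos theta s), <- Rmult_assoc, <- Rpower_plus by trivial.
f_equal. f_equal. ring.
Qed.

(** Euler's Beta(gamma, theta) in the variable u = v^theta, which removes the singularity of
    v^(theta-1) at 0. *)
Definition Beta_desing (gamma theta : R) : R :=
  RInt (fun u => tpow (gamma - 1) (1 - tpow (/ theta) u) * / theta) 0 1.

Definition lower_gamma (z N : R) : R := RInt (fun x => tpow (z - 1) x * exp (- x)) 0 N.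

(** The incomplete Gamma integral over (0, N) in the variable r = x^theta; unlike [lower_gamma], it
    is proper for [theta <= 1] too. *)
Definition lower_gamma_desing (theta N : R) : R :=
  RInt (fun r => exp (- tpow (/ theta) r) * / theta) 0 (tpow theta N).

Lemma continuous_exp_opp (x : R) : continuous (fun x => exp (- x)) x.
Proof.
apply (continuous_comp Ropp exp). apply (continuous_opp (fun x : R => x)), continuous_id.
apply continuous_exp.
Qed.

Lemma continuous_lower_gamma_integrand (z x : R) :
  1 < z -> continuous (fun x => tpow (z - 1) x * exp (- x)) x.
Proof.
intros Hz. apply (continuous_mult (tpow (z - 1)) (fun x => exp (- x))).
apply continuous_tpow; lra. apply continuous_exp_opp.
Qed.

Lemma continuous_desing_integrand (theta x : R) :
  0 < theta -> continuous (fun r => exp (- tpow (/ theta) r) * / theta) x.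
Proof.
intros Hth. apply (continuous_mult (fun r => exp (- tpow (/ theta) r)) (fun _ => / theta)).
2: apply continuous_const.
apply (continuous_comp (tpow (/ theta)) (fun x => exp (- x))). 2: apply continuous_exp_opp.
apply continuous_tpow. now apply Rinv_0_lt_compat.
Qed.

(** [Gamma] is a total function and says nothing about convergence; its value becomes usable only
    once the truncated integrals are known to converge. *)
Lemma Gamma_lower_gamma (z L : R) : 1 < z ->
  filterlim (lower_gamma z) (Rbar_locally p_infty) (locally L) -> Gamma z = L.
Proof.
intros Hz HL. unfold Gamma. rewrite <- (Rminus_0_r L).
apply (is_RInt_gen_unique (Fa := at_right 0) (Fb := Rbar_locally p_infty)).
assert (Hc := fun x => continuous_lower_gamma_integrand z x Hz).
apply (is_RInt_gen_primitive (X := R_CompleteNormedModule) _ (lower_gamma z) 1 _ (fun b => 1 < b)).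
- lra.
- exists 1. trivial.
- intros a b Ha Hb. unfold lower_gamma.
  rewrite <- RInt_minus_Chasles by trivial.
  apply is_RInt_ext with (fun x => tpow (z - 1) x * exp (- x)).
  + intros x Hx. rewrite Rmin_left in Hx by lra. rewrite tpow_pos; lra.
  + apply (RInt_correct (V := R_CompleteNormedModule)). now apply ex_RInt_cont.
- replace 0 with (lower_gamma z 0) at 2 by apply (RInt_point (V := R_CompleteNormedModule)).
  apply (continuous_at_right (lower_gamma z)).
  apply (continuous_RInt_end (X := R_CompleteNormedModule)). trivial.
- exact HL.
Qed.

Lemma regular_Rpower {X : NormedModule R_AbsRing} (theta k : R) (x : X) :
  regular theta (fun t => scal (k * Rpower t (theta - 1)) x) (scal k x).
Proof.
split.
- intros t Ht. apply (continuous_scal_l (V := X) (fun t => k * Rpower t (theta - 1)) x).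
  apply (continuous_scal_r (V := R_NormedModule) k (fun t => Rpower t (theta - 1))).
  now apply continuous_Rpower.
- apply filterlim_ext with (fun _ => scal k x); [|apply filterlim_const].
  intros t. refine (eq_sym (eq_trans (scal_assoc (V := X) _ _ _) _)). f_equal.
  change (/ Rpower t (theta - 1) * (k * Rpower t (theta - 1)) = k). field.
  apply Rgt_not_eq, Rpower_gt_0.
Qed.

Lemma desing_Rpower {X : NormedModule R_AbsRing} (theta k : R) (x : X) (r : R) :
  desing theta (fun t => scal (k * Rpower t (theta - 1)) x) (scal k x) r = scal (/ theta * k) x.
Proof.
unfold desing. destruct (Rle_dec r 0); refine (eq_trans (scal_assoc (V := X) _ _ _) _).
- reflexivity.
- f_equal. set (q := Rpower (Rpower r (/ theta)) (theta - 1)).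
  assert (0 < q) by apply Rpower_gt_0.
  change (/ theta * / q * (k * q) = / theta * k).
  rewrite Rmult_assoc. f_equal. field. lra.
Qed.

Lemma Gamma_lower_gamma_desing (theta L : R) : 0 < theta ->
  filterlim (lower_gamma_desing theta) (Rbar_locally p_infty) (locally L) -> Gamma theta = L.
Proof.
intros Hz HL. unfold Gamma. rewrite <- (Rminus_0_r L).
apply (is_RInt_gen_unique (Fa := at_right 0) (Fb := Rbar_locally p_infty)).
assert (Hc := fun x => continuous_desing_integrand theta x Hz).
apply (is_RInt_gen_primitive (X := R_CompleteNormedModule) _ (lower_gamma_desing theta) 1 _ (fun b => 1 < b)).
- lra.
- exists 1. trivial.
- intros a b Ha Hb. unfold lower_gamma_desing.
  rewrite <- RInt_minus_Chasles by trivial.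
  assert (H := is_RInt_desing theta _ _ (fun x => exp (- x)) a b Hz
    (regular_Rpower (X := R_NormedModule) theta 1 1) continuous_exp_opp ltac:(lra) ltac:(lra)).
  rewrite (RInt_ext _ (fun r => exp (- tpow (/ theta) r) * / theta)) in H.
  + revert H. apply is_RInt_ext. intros x Hx.
    change (exp (- x) * (1 * Rpower x (theta - 1) * 1) = Rpower x (theta - 1) * exp (- x)). ring.
  + intros r Hr. rewrite desing_Rpower.
    change (exp (- tpow (/ theta) r) * (/ theta * 1 * 1) = exp (- tpow (/ theta) r) * / theta). ring.
- replace 0 with (lower_gamma_desing theta 0) at 2.
  2:{ unfold lower_gamma_desing. rewrite tpow_npos by lra. apply (RInt_point (V := R_CompleteNormedModule)). }
  apply (continuous_at_right (lower_gamma_desing theta)). unfold lower_gamma_desing.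
  apply (continuous_comp (tpow theta) (fun b => RInt (fun r => exp (- tpow (/ theta) r) * / theta) 0 b)).
  now apply continuous_tpow.
  apply (continuous_RInt_end (X := R_CompleteNormedModule)). trivial.
- exact HL.
Qed.

Lemma RInt_ge_0_cont (f : R -> R) (a b : R) :
  (forall x, continuous f x) -> a <= b -> (forall x, a < x < b -> 0 <= f x) -> 0 <= RInt f a b.
Proof.
intros Hf Hab H. apply RInt_ge_0; trivial.
now apply (ex_RInt_cont (X := R_CompleteNormedModule)).
Qed.

Lemma RInt_nondecreasing (f : R -> R) (a b c : R) :
  (forall x, continuous f x) -> (forall x, 0 <= f x) -> b <= c -> RInt f a b <= RInt f a c.
Proof.
intros Hf H Hbc.
assert (E := RInt_Chasles f a b c ltac:(now apply (ex_RInt_cont (X := R_CompleteNormedModule)))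
  ltac:(now apply (ex_RInt_cont (X := R_CompleteNormedModule)))).
assert (0 <= RInt f b c) by (apply RInt_ge_0_cont; auto).
change (RInt f a b + RInt f b c = RInt f a c) in E. lra.
Qed.

Lemma lower_gamma_nondecreasing (z M N : R) : 1 < z -> M <= N -> lower_gamma z M <= lower_gamma z N.
Proof.
intros Hz HMN. apply RInt_nondecreasing; trivial.
- intros; now apply continuous_lower_gamma_integrand.
- intros x. apply Rmult_le_pos. apply tpow_ge_0. left; apply exp_pos.
Qed.

Lemma desing_integrand_ge_0 (theta r : R) : 0 < theta -> 0 <= exp (- tpow (/ theta) r) * / theta.
Proof.
intros H. apply Rmult_le_pos; left. apply exp_pos. now apply Rinv_0_lt_compat.
Qed.

Lemma lower_gamma_desing_nondecreasing (theta M N : R) : 0 < theta -> M <= N ->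
  lower_gamma_desing theta M <= lower_gamma_desing theta N.
Proof.
intros Hz HMN. apply RInt_nondecreasing.
- intros; now apply continuous_desing_integrand.
- intros x. now apply desing_integrand_ge_0.
- apply tpow_le; lra.
Qed.

Lemma lower_gamma_gt_0 (z N : R) : 1 < z -> 0 < N -> 0 < lower_gamma z N.
Proof.
intros Hz HN. apply RInt_gt_0; trivial.
- intros x Hx. apply Rmult_lt_0_compat. apply tpow_gt_0; lra. apply exp_pos.
- intros; now apply continuous_lower_gamma_integrand.
Qed.

Lemma lower_gamma_desing_gt_0 (theta N : R) : 0 < theta -> 0 < N -> 0 < lower_gamma_desing theta N.
Proof.
intros Hz HN. apply RInt_gt_0.
- now apply tpow_gt_0.
- intros x Hx. apply Rmult_lt_0_compat. apply exp_pos. now apply Rinv_0_lt_compat.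
- intros; now apply continuous_desing_integrand.
Qed.

(** From ln y <= y at y = x / (2a), multiplied by [a] and exponentiated. Half of the exponential
    decay is thereby left over in the Gamma integrand. *)
Lemma Rpower_le_exp (a x : R) : 0 < a -> 0 < x -> Rpower x a <= Rpower (2 * a) a * exp (x / 2).
Proof.
intros Ha Hx. unfold Rpower. rewrite <- exp_plus.
assert (H : ln x <= x / (2 * a) + ln (2 * a)).
{ replace x with (x / (2 * a) * (2 * a)) at 1 by (field; lra).
  assert (0 < x / (2 * a)) by (apply Rdiv_lt_0_compat; lra).
  rewrite ln_mult by lra.
  assert (ln (x / (2 * a)) <= x / (2 * a)).
  { rewrite <- (ln_exp (x / (2 * a))) at 2. apply ln_le; trivial.
    left. eapply Rlt_trans; [|apply exp_ineq1; lra]. lra. }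
  lra. }
apply (Rmult_le_compat_l a) in H; [|lra].
replace (a * (x / (2 * a) + ln (2 * a))) with (a * ln (2 * a) + x / 2) in H by (field; lra).
destruct H as [H| ->]; [left; now apply exp_increasing|lra].
Qed.

Lemma lower_gamma_bounded (z : R) : 1 < z -> exists M, forall N, lower_gamma z N <= M.
Proof.
(* [Rpower_le_exp] with a = z - 1 bounds the integrand by c exp(-x/2), whose integral over the half
   line is 2c. *)
intros Hz. exists (Rpower (2 * (z - 1)) (z - 1) * 2). set (c := Rpower (2 * (z - 1)) (z - 1)).
assert (Hc : 0 < c) by apply Rpower_gt_0.
assert (Hpos : forall N, 0 <= N -> lower_gamma z N <= c * 2).
{ intros N HN.
  assert (HI : is_RInt (fun x => c * exp (- (x / 2))) 0 N
    (minus (- 2 * c * exp (- (N / 2))) (- 2 * c * exp (- (0 / 2))))).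
  { apply (is_RInt_derive (fun x => - 2 * c * exp (- (x / 2)))).
    - intros x _. auto_derive; trivial. unfold Rdiv. field.
    - intros x _. apply (ex_derive_continuous (V := R_NormedModule)). auto_derive. trivial. }
  apply Rle_trans with (RInt (fun x => c * exp (- (x / 2))) 0 N).
  - apply RInt_le; trivial.
    + apply (ex_RInt_cont (X := R_CompleteNormedModule)). intros; now apply continuous_lower_gamma_integrand.
    + eexists; exact HI.
    + intros x Hx. rewrite tpow_pos by lra.
      replace (- (x / 2)) with (x / 2 + - x) by field. rewrite exp_plus, <- Rmult_assoc.
      apply Rmult_le_compat_r. left; apply exp_pos. apply Rpower_le_exp; lra.
  - rewrite (is_RInt_unique _ _ _ _ HI).
    change (- 2 * c * exp (- (N / 2)) - - 2 * c * exp (- (0 / 2)) <= c * 2).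
    replace (- (0 / 2)) with 0 by field. rewrite exp_0.
    assert (0 < c * exp (- (N / 2))) by (apply Rmult_lt_0_compat; [lra|apply exp_pos]). lra. }
intros N. destruct (Rle_dec 0 N) as [HN|HN]; [now apply Hpos|].
eapply Rle_trans; [|apply (Hpos 0); lra]. apply lower_gamma_nondecreasing; lra.
Qed.

Lemma nondecreasing_bounded_lim (f : R -> R) (M : R) :
  (forall x y, x <= y -> f x <= f y) -> (forall x, f x <= M) ->
  exists L, filterlim f (Rbar_locally p_infty) (locally L) /\ forall x, f x <= L.
Proof.
intros Hf HM.
destruct (completeness (fun y => exists x, y = f x)) as [L [HL1 HL2]].
- exists M. intros y [x ->]. apply HM.
- exists (f 0). now exists 0.
- exists L. assert (Hle : forall x, f x <= L) by (intros x; apply HL1; now exists x).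
  split; trivial.
  refine (proj2 (filterlim_normP (X := R_NormedModule) _ _ _) _). intros eps.
  assert (Hx : exists x, L - eps < f x).
  { apply NNPP. intros H. assert (L <= L - eps).
    { apply HL2. intros y [x ->]. destruct (Rle_dec (f x) (L - eps)); trivial.
      exfalso; apply H. exists x. lra. }
    pose proof (cond_pos eps). lra. }
  destruct Hx as [x0 Hx0]. exists x0. intros y Hy.
  change (Rabs (f y - L) < eps). rewrite Rabs_left1 by (specialize (Hle y); lra).
  assert (f x0 <= f y) by (apply Hf; lra). lra.
Qed.

(** Substitute x = T - rho; the integrand is zero for negative x, so the part of the range with T <
    rho is harmless, even when N < rho. *)
Lemma lower_gamma_shift (gamma rho N : R) : 1 < gamma -> 0 <= rho ->
  RInt (fun T => exp (- T) * tpow (gamma - 1) (T - rho)) 0 N = exp (- rho) * lower_gamma gamma (N - rho).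
Proof.
intros Hga Hrho.
set (g := fun x => tpow (gamma - 1) x * exp (- x)).
assert (Hg : forall x, continuous g x) by (intros; now apply continuous_lower_gamma_integrand).
assert (E : lower_gamma gamma (N - rho) = RInt g (- rho) (N - rho)).
{ unfold lower_gamma. fold g.
  rewrite <- (RInt_Chasles g (- rho) 0 (N - rho))
    by (apply (ex_RInt_cont (X := R_CompleteNormedModule)); trivial).
  rewrite (RInt_zero (X := R_CompleteNormedModule) g (- rho) 0).
  symmetry. apply (plus_zero_l (G := R_AbelianGroup)).
  intros t Ht. rewrite Rmax_right in Ht by lra. unfold g. rewrite tpow_npos by lra. apply Rmult_0_l. }
rewrite E.
assert (E2 := RInt_comp_lin g 1 (- rho) 0 N).
replace (1 * 0 + - rho) with (- rho) in E2 by ring.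
replace (1 * N + - rho) with (N - rho) in E2 by ring.
rewrite <- E2 by (apply (ex_RInt_cont (X := R_CompleteNormedModule)); trivial).
rewrite <- (RInt_scal (V := R_CompleteNormedModule)).
- apply RInt_ext. intros T _. unfold g.
  change (exp (- T) * tpow (gamma - 1) (T - rho) =
    exp (- rho) * (1 * (tpow (gamma - 1) (1 * T + - rho) * exp (- (1 * T + - rho))))).
  replace (1 * T + - rho) with (T - rho) by ring.
  replace (exp (- T)) with (exp (- rho) * exp (- (T - rho))). ring.
  rewrite <- exp_plus. f_equal. ring.
- apply (ex_RInt_cont (X := R_CompleteNormedModule)). intros t.
  apply (continuous_scal_r (V := R_NormedModule) 1 (fun y => g (1 * y + - rho))).
  apply (continuous_comp (fun y => 1 * y + - rho) g); trivial.
  apply (ex_derive_continuous (V := R_NormedModule)). auto_derive. trivial.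
Qed.

Lemma convolution_Rpower (gamma theta T b : R) : 1 < gamma -> 0 < theta -> 0 <= T -> tpow theta T <= b ->
  RInt (fun r => tpow (gamma - 1) (T - tpow (/ theta) r) * / theta) 0 b =
  Beta_desing gamma theta * tpow (gamma + theta - 1) T.
Proof.
intros Hga Hth HT Hb.
set (h := fun r => tpow (gamma - 1) (T - tpow (/ theta) r) * / theta).
assert (Hh : forall r, continuous h r).
{ intros r. apply (continuous_mult (fun r => tpow (gamma - 1) (T - tpow (/ theta) r)) (fun _ => / theta)).
  apply continuous_kernel; lra. apply continuous_const. }
rewrite <- (RInt_Chasles h 0 (tpow theta T) b) by (apply (ex_RInt_cont (X := R_CompleteNormedModule)); trivial).
rewrite (RInt_zero (X := R_CompleteNormedModule) h (tpow theta T) b).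
2:{ intros r Hr. rewrite Rmin_left in Hr by trivial. unfold h. rewrite tpow_npos. apply Rmult_0_l.
    apply Rle_minus. rewrite <- (tpow_inv_l theta T) by lra. apply tpow_le; [|lra].
    left. now apply Rinv_0_lt_compat. }
rewrite (plus_zero_r (G := R_AbelianGroup)).
destruct HT as [HT| <-].
- refine (eq_trans (kernel_scaling (X := R_CompleteNormedModule) theta gamma T (fun _ => / theta) Hth Hga HT _) _).
  + intros; apply continuous_const.
  + rewrite Rmult_comm, (tpow_pos (gamma + theta - 1)) by trivial. reflexivity.
- rewrite (tpow_npos theta), (tpow_npos (gamma + theta - 1)), Rmult_0_r by lra.
  apply (RInt_point (V := R_CompleteNormedModule)).
Qed.

(* Multiplied by [exp (- T)], the convolution of two powers becomes that of two gamma densities;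
   integrating over [T] in [0, N] turns it into an incomplete product of Gamma integrals. *)
Lemma lower_gamma_product (gamma theta N : R) : 1 < gamma -> 0 < theta -> 0 <= N ->
  Beta_desing gamma theta * lower_gamma (gamma + theta) N =
  RInt (fun r => exp (- tpow (/ theta) r) * / theta * lower_gamma gamma (N - tpow (/ theta) r)) 0 (tpow theta N).
Proof.
intros Hga Hth HN.
set (b := tpow theta N). assert (Hb : 0 <= b) by apply tpow_ge_0.
assert (Hthi : 0 < / theta) by now apply Rinv_0_lt_compat.
set (h := fun T r => exp (- T) * (tpow (gamma - 1) (T - tpow (/ theta) r) * / theta)).
assert (Hh : forall s t, jointly_continuous h s t).
{ intros s t. apply (jointly_continuous_scal (X := R_NormedModule) (fun T _ => exp (- T))
    (fun T r => tpow (gamma - 1) (T - tpow (/ theta) r) * / theta)).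
  - apply (jointly_continuous_fst (fun T => exp (- T))). apply continuous_exp_opp.
  - apply (jointly_continuous_scal (X := R_NormedModule) (fun T r => tpow (gamma - 1) (T - tpow (/ theta) r))
      (fun _ _ => / theta)). 2: apply continuous_const.
    apply (jointly_continuous_comp (fun T r => T - tpow (/ theta) r) (tpow (gamma - 1))).
    + apply (jointly_continuous_minus (fun T _ => T) (fun _ r => tpow (/ theta) r)).
      * apply (jointly_continuous_fst (fun T => T)), continuous_id.
      * apply (jointly_continuous_snd (tpow (/ theta))). now apply continuous_tpow.
    + apply continuous_tpow. lra. }
transitivity (RInt (fun T => RInt (fun r => h T r) 0 b) 0 N).
- unfold lower_gamma. rewrite <- (RInt_scal (V := R_CompleteNormedModule)).
  2:{ apply (ex_RInt_cont (X := R_CompleteNormedModule)). intros. apply continuous_lower_gamma_integrand. lra. }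
  apply RInt_ext. intros T HT. rewrite Rmin_left, Rmax_right in HT by trivial.
  unfold h. rewrite (RInt_scal (V := R_CompleteNormedModule)
    (fun r => tpow (gamma - 1) (T - tpow (/ theta) r) * / theta)).
  + rewrite convolution_Rpower; trivial; try lra.
    2: apply tpow_le; lra.
    change (Beta_desing gamma theta * (tpow (gamma + theta - 1) T * exp (- T)) =
      exp (- T) * (Beta_desing gamma theta * tpow (gamma + theta - 1) T)). ring.
  + apply (ex_RInt_cont (X := R_CompleteNormedModule)). intros r.
    apply (continuous_mult (fun r => tpow (gamma - 1) (T - tpow (/ theta) r)) (fun _ => / theta)).
    apply continuous_kernel; lra. apply continuous_const.
- rewrite (Fubini (X := R_CompleteNormedModule)) by trivial.
  apply RInt_ext. intros r Hr. rewrite Rmin_left, Rmax_right in Hr by trivial.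
  unfold h.
  rewrite (RInt_ext _ (fun T => scal (/ theta) (exp (- T) * tpow (gamma - 1) (T - tpow (/ theta) r)))).
  2:{ intros T _. change (exp (- T) * (tpow (gamma - 1) (T - tpow (/ theta) r) * / theta) =
        / theta * (exp (- T) * tpow (gamma - 1) (T - tpow (/ theta) r))). ring. }
  rewrite (RInt_scal (V := R_CompleteNormedModule)).
  + rewrite lower_gamma_shift; trivial. 2: apply tpow_ge_0.
    change (/ theta * (exp (- tpow (/ theta) r) * lower_gamma gamma (N - tpow (/ theta) r)) =
      exp (- tpow (/ theta) r) * / theta * lower_gamma gamma (N - tpow (/ theta) r)). ring.
  + apply (ex_RInt_cont (X := R_CompleteNormedModule)). intros T.
    apply (continuous_mult (fun T => exp (- T)) (fun T => tpow (gamma - 1) (T - tpow (/ theta) r))).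
    apply continuous_exp_opp.
    apply (continuous_comp (fun T => T - tpow (/ theta) r) (tpow (gamma - 1))).
    apply (ex_derive_continuous (V := R_NormedModule)). auto_derive. trivial. apply continuous_tpow. lra.
Qed.

Lemma continuous_lower_gamma_product (gamma theta N r : R) : 1 < gamma -> 0 < theta ->
  continuous (fun r => exp (- tpow (/ theta) r) * / theta * lower_gamma gamma (N - tpow (/ theta) r)) r.
Proof.
intros Hga Hth.
apply (continuous_mult (fun r => exp (- tpow (/ theta) r) * / theta) (fun r => lower_gamma gamma (N - tpow (/ theta) r))).
now apply continuous_desing_integrand.
apply (continuous_comp (fun r => N - tpow (/ theta) r) (lower_gamma gamma)).
- apply (continuous_minus (fun _ => N) (tpow (/ theta))). apply continuous_const.
  apply continuous_tpow. now apply Rinv_0_lt_compat.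
- apply (continuous_RInt_end (X := R_CompleteNormedModule)). intros; now apply continuous_lower_gamma_integrand.
Qed.

(** In the original variables, the triangle x + y <= N lies in the square [0, N]^2. *)
Lemma lower_gamma_product_le (gamma theta N : R) : 1 < gamma -> 0 < theta -> 0 <= N ->
  Beta_desing gamma theta * lower_gamma (gamma + theta) N <= lower_gamma gamma N * lower_gamma_desing theta N.
Proof.
intros Hga Hth HN. rewrite lower_gamma_product by trivial. unfold lower_gamma_desing.
rewrite <- (RInt_scal (V := R_CompleteNormedModule)).
2:{ apply (ex_RInt_cont (X := R_CompleteNormedModule)). intros; now apply continuous_desing_integrand. }
apply RInt_le.
- apply tpow_ge_0.
- apply (ex_RInt_cont (X := R_CompleteNormedModule)). intros; now apply continuous_lower_gamma_product.
- apply (ex_RInt_cont (X := R_CompleteNormedModule)). intros.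
  apply (continuous_scal_r (V := R_NormedModule) (lower_gamma gamma N)
    (fun r => exp (- tpow (/ theta) r) * / theta)). now apply continuous_desing_integrand.
- intros r _. rewrite Rmult_comm. apply Rmult_le_compat_r.
  + now apply desing_integrand_ge_0.
  + apply lower_gamma_nondecreasing; trivial. pose proof (tpow_ge_0 (/ theta) r). lra.
Qed.

(** Conversely, the square [0, N]^2 lies in the triangle x + y <= 2N. As N grows, the two inclusions
    squeeze the product of Gamma values. *)
Lemma lower_gamma_product_ge (gamma theta N : R) : 1 < gamma -> 0 < theta -> 0 <= N ->
  lower_gamma gamma N * lower_gamma_desing theta N <= Beta_desing gamma theta * lower_gamma (gamma + theta) (2 * N).
Proof.
intros Hga Hth HN. rewrite lower_gamma_product by lra. unfold lower_gamma_desing.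
assert (Hc := fun r => continuous_lower_gamma_product gamma theta (2 * N) r Hga Hth).
assert (Hle : tpow theta N <= tpow theta (2 * N)) by (apply tpow_le; lra).
assert (Hthi : 0 < / theta) by now apply Rinv_0_lt_compat.
match goal with |- _ <= RInt ?f _ _ =>
  assert (E := RInt_Chasles f 0 (tpow theta N) (tpow theta (2 * N))
    ltac:(now apply (ex_RInt_cont (X := R_CompleteNormedModule)))
    ltac:(now apply (ex_RInt_cont (X := R_CompleteNormedModule))));
  change (RInt f 0 (tpow theta N) + RInt f (tpow theta N) (tpow theta (2 * N)) = RInt f 0 (tpow theta (2 * N))) in E;
  assert (H0 : 0 <= RInt f (tpow theta N) (tpow theta (2 * N)));
  [|rewrite <- E; enough (lower_gamma gamma N * RInt (fun r => exp (- tpow (/ theta) r) * / theta) 0 (tpow theta N)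
      <= RInt f 0 (tpow theta N)) by lra]
end.
- apply RInt_ge_0_cont; trivial. intros r Hr. apply Rmult_le_pos. now apply desing_integrand_ge_0.
  replace 0 with (lower_gamma gamma 0) by apply (RInt_point (V := R_CompleteNormedModule)).
  apply lower_gamma_nondecreasing; trivial.
  enough (tpow (/ theta) r <= 2 * N) by lra. rewrite <- (tpow_inv_l theta (2 * N)) by lra. apply tpow_le; lra.
- rewrite <- (RInt_scal (V := R_CompleteNormedModule)).
  2:{ apply (ex_RInt_cont (X := R_CompleteNormedModule)). intros; now apply continuous_desing_integrand. }
  apply RInt_le.
  + apply tpow_ge_0.
  + apply (ex_RInt_cont (X := R_CompleteNormedModule)). intros.
    apply (continuous_scal_r (V := R_NormedModule) (lower_gamma gamma N)
      (fun r => exp (- tpow (/ theta) r) * / theta)). now apply continuous_desing_integrand.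
  + now apply (ex_RInt_cont (X := R_CompleteNormedModule)).
  + intros r Hr.
    change (lower_gamma gamma N * (exp (- tpow (/ theta) r) * / theta) <=
      exp (- tpow (/ theta) r) * / theta * lower_gamma gamma (2 * N - tpow (/ theta) r)).
    rewrite Rmult_comm. apply Rmult_le_compat_l.
    * now apply desing_integrand_ge_0.
    * apply lower_gamma_nondecreasing; trivial.
      assert (tpow (/ theta) r <= N). { rewrite <- (tpow_inv_l theta N) by lra. apply tpow_le; lra. }
      lra.
Qed.

Lemma Gamma_gt_1 (z : R) : 1 < z ->
  filterlim (lower_gamma z) (Rbar_locally p_infty) (locally (Gamma z)) /\
  0 < Gamma z /\ forall x, lower_gamma z x <= Gamma z.
Proof.
intros Hz. destruct (lower_gamma_bounded z Hz) as [M HM].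
destruct (nondecreasing_bounded_lim (lower_gamma z) M) as [L [HL HLx]]; trivial.
{ intros; now apply lower_gamma_nondecreasing. }
rewrite (Gamma_lower_gamma z L Hz HL). split; [|split]; trivial.
eapply Rlt_le_trans; [|apply (HLx 1)]. apply lower_gamma_gt_0; lra.
Qed.

Lemma Beta_desing_gt_0 (gamma theta : R) : 1 < gamma -> 0 < theta -> 0 < Beta_desing gamma theta.
Proof.
intros Hga Hth. assert (Hthi : 0 < / theta) by now apply Rinv_0_lt_compat.
apply RInt_gt_0. lra.
- intros u Hu. apply Rmult_lt_0_compat; trivial. apply tpow_gt_0.
  assert (H : tpow (/ theta) u < tpow (/ theta) 1) by (apply tpow_lt; lra).
  rewrite (tpow_pos _ 1) in H by lra. unfold Rpower in H. rewrite ln_1, Rmult_0_r, exp_0 in H. lra.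
- intros r _. apply (continuous_mult (fun r => tpow (gamma - 1) (1 - tpow (/ theta) r)) (fun _ => / theta)).
  apply continuous_kernel; lra. apply continuous_const.
Qed.

(** Convergence for small [theta] comes without a new estimate: [lower_gamma_product_ge] with gamma
    = 2 bounds the desingularized integral by quantities at arguments above 1, after division by the
    fixed positive number [lower_gamma 2 1]. *)
Lemma Gamma_pos (theta : R) : 0 < theta ->
  filterlim (lower_gamma_desing theta) (Rbar_locally p_infty) (locally (Gamma theta)) /\ 0 < Gamma theta.
Proof.
intros Hth.
destruct (nondecreasing_bounded_lim (lower_gamma_desing theta)
  (Beta_desing 2 theta * Gamma (2 + theta) / lower_gamma 2 1)) as [L [HL HLx]].
{ intros; now apply lower_gamma_desing_nondecreasing. }
{ assert (H1 : 0 < lower_gamma 2 1) by (apply lower_gamma_gt_0; lra).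
  assert (Hbig : forall x, 1 <= x ->
    lower_gamma_desing theta x <= Beta_desing 2 theta * Gamma (2 + theta) / lower_gamma 2 1).
  { intros x Hx. apply Rmult_le_reg_l with (lower_gamma 2 1); trivial.
    replace (lower_gamma 2 1 * (Beta_desing 2 theta * Gamma (2 + theta) / lower_gamma 2 1))
      with (Beta_desing 2 theta * Gamma (2 + theta)) by (field; lra).
    apply Rle_trans with (lower_gamma 2 x * lower_gamma_desing theta x).
    - apply Rmult_le_compat_r. left; apply lower_gamma_desing_gt_0; lra.
      apply lower_gamma_nondecreasing; lra.
    - eapply Rle_trans. apply lower_gamma_product_ge; lra.
      apply Rmult_le_compat_l. left; apply Beta_desing_gt_0; lra. apply Gamma_gt_1. lra. }
  intros x. destruct (Rle_dec 1 x) as [Hx|Hx]. now apply Hbig.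
  eapply Rle_trans; [|apply (Hbig 1); lra]. apply lower_gamma_desing_nondecreasing; lra. }
rewrite (Gamma_lower_gamma_desing theta L Hth HL). split; trivial.
eapply Rlt_le_trans; [|apply (HLx 1)]. apply lower_gamma_desing_gt_0; lra.
Qed.

Lemma filterlim_le_R (f g : R -> R) (F : (R -> Prop) -> Prop) {FF : ProperFilter F} (a b : R) :
  F (fun x => f x <= g x) -> filterlim f F (locally a) -> filterlim g F (locally b) -> a <= b.
Proof. intros H Hf Hg. exact (filterlim_le (F := F) f g (Finite a) (Finite b) H Hf Hg). Qed.

Lemma Gamma_mult (gamma theta : R) : 1 < gamma -> 0 < theta ->
  Gamma gamma * Gamma theta = Beta_desing gamma theta * Gamma (gamma + theta).
Proof.
intros Hga Hth.
destruct (Gamma_gt_1 gamma Hga) as [L1 _]. destruct (Gamma_pos theta Hth) as [L2 _].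
destruct (Gamma_gt_1 (gamma + theta) ltac:(lra)) as [L3 [_ Hle]].
assert (Lp : filterlim (fun N => lower_gamma gamma N * lower_gamma_desing theta N)
  (Rbar_locally p_infty) (locally (Gamma gamma * Gamma theta))).
{ exact (filterlim_comp_2 _ _ _ L1 L2 (filterlim_mult (Gamma gamma) (Gamma theta))). }
assert (HF : Rbar_locally p_infty (fun N => 0 <= N)) by (exists 0; intros; lra).
apply Rle_antisym.
- apply (filterlim_le_R _ (fun _ => Beta_desing gamma theta * Gamma (gamma + theta)) (Rbar_locally p_infty))
    with (2 := Lp); [|apply filterlim_const].
  revert HF. apply filter_imp. intros N HN.
  eapply Rle_trans. now apply lower_gamma_product_ge.
  apply Rmult_le_compat_l. left; now apply Beta_desing_gt_0. apply Hle.
- apply (filterlim_le_R (fun N => Beta_desing gamma theta * lower_gamma (gamma + theta) N) _ (Rbar_locally p_infty))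
    with (3 := Lp).
  + revert HF. apply filter_imp. intros N HN. now apply lower_gamma_product_le.
  + apply filterlim_comp with (1 := L3).
    apply (filterlim_scal_r (V := R_NormedModule) (Beta_desing gamma theta) (Gamma (gamma + theta))).
Qed.

(** * The uniform boundedness principle *)

Lemma norm_le_minus {X : NormedModule R_AbsRing} (a b : X) : norm a <= norm (minus a b) + norm b.
Proof.
replace a with (plus (minus a b) b) at 1; [apply norm_triangle|].
unfold minus. now rewrite <- plus_assoc, plus_opp_l, plus_zero_r.
Qed.

Lemma norm_le_of_approx {X : NormedModule R_AbsRing} (x : X) (c : R) :
  (forall eps : posreal, exists y, norm (minus x y) < eps /\ norm y <= c) -> norm x <= c.
Proof.
intros H. apply le_epsilon. intros e He. destruct (H (mkposreal e He)) as [y [Hy Hyc]]. simpl in Hy.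
pose proof (norm_le_minus x y). lra.
Qed.

Lemma minusE {G : AbelianGroup} (x y : G) : minus x y = plus x (opp y).
Proof. reflexivity. Qed.

Lemma plus_minus_swap {G : AbelianGroup} (x u : G) : minus (plus x u) x = u.
Proof. now rewrite minusE, (plus_comm x), <- plus_assoc, plus_opp_r, plus_zero_r. Qed.

Lemma plus_minus_minus {G : AbelianGroup} (x u : G) : minus (plus x u) (minus x u) = plus u u.
Proof.
rewrite !minusE, opp_plus, opp_opp, (plus_comm x), <- plus_assoc. f_equal.
now rewrite plus_assoc, plus_opp_r, plus_zero_l.
Qed.

Lemma minus_minus_cancel {G : AbelianGroup} (s x0 xn xm : G) :
  minus (plus s x0) xn = plus (minus xm xn) (minus s (minus xm x0)).
Proof.
rewrite !minusE, opp_plus, opp_opp, (plus_comm xm (opp xn)), <- (plus_assoc (opp xn)).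
rewrite (plus_assoc s (opp xm)), (plus_comm s (opp xm)), <- (plus_assoc (opp xm)).
rewrite (plus_assoc xm (opp xm)), plus_opp_r, plus_zero_l. apply plus_comm.
Qed.

Lemma norm_scal_le {X : NormedModule R_AbsRing} (k : R) (x : X) :
  0 <= k -> norm (scal k x) <= k * norm x.
Proof.
intros Hk. eapply Rle_trans; [apply (norm_scal (V := X))|].
change (Rabs k * norm x <= k * norm x). rewrite Rabs_pos_eq; lra.
Qed.

(** Since 2 T u = T (x + u) - T (x - u), one of T (x + u) and T (x - u) is at least as large as T u.
    With u the multiple of [v] of norm r, this finds a large value near any centre [x]. *)
Lemma linear_large_value {X Y : NormedModule R_AbsRing} (T : X -> Y) (x v : X) (K r : R) :
  is_linear T -> 0 < r -> 0 < K -> K * norm v < norm (T v) ->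
  exists x', norm (minus x' x) <= r /\ K * r <= norm (T x').
Proof.
intros HT Hr HK Hv.
assert (Hnv : 0 < norm v).
{ destruct (norm_ge_0 v) as [H|H]; trivial.
  exfalso. assert (Ev : v = zero) by (apply norm_eq_zero; now rewrite <- H).
  rewrite Ev, (linear_zero T HT), !norm_zero in Hv. lra. }
set (c := r / norm v). assert (Hc : 0 < c) by now apply Rdiv_lt_0_compat.
set (u := scal c v).
assert (Hu : norm u <= r).
{ eapply Rle_trans; [apply norm_scal_le; lra|]. unfold c. right. field. lra. }
assert (HTu : K * r <= norm (T u)).
{ assert (E : norm (T v) <= / c * norm (T u)).
  { replace (T v) with (scal (/ c) (T u)).
    - apply norm_scal_le. left; now apply Rinv_0_lt_compat.
    - rewrite <- (linear_scal T HT). f_equal. unfold u.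
      refine (eq_trans (scal_assoc (V := X) _ _ _) _).
      transitivity (scal (one : R_AbsRing) v); [|apply (scal_one (V := X))].
      f_equal. change (/ c * c = 1). field. lra. }
  apply Rmult_le_reg_l with (/ c); [now apply Rinv_0_lt_compat|].
  eapply Rle_trans; [|exact E]. left. replace (/ c * (K * r)) with (K * norm v); trivial.
  unfold c. field. lra. }
assert (Hsum : 2 * (K * r) <= norm (T (plus x u)) + norm (T (minus x u))).
{ eapply Rle_trans. apply Rmult_le_compat_l; [lra|exact HTu].
  assert (Ed : minus (T (plus x u)) (T (minus x u)) = plus (T u) (T u)).
  { rewrite <- linear_minus, <- linear_plus by trivial. f_equal.
    apply (plus_minus_minus (G := X)). }
  assert (E2 : norm (T u) <= / 2 * norm (plus (T u) (T u))).
  { replace (T u) with (scal (/ 2) (plus (T u) (T u))) at 1.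
    - apply norm_scal_le. lra.
    - refine (eq_trans (scal_distr_l (V := Y) _ _ _) _).
      refine (eq_trans (eq_sym (scal_distr_r (V := Y) _ _ _)) _).
      transitivity (scal (one : R_AbsRing) (T u)); [|apply (scal_one (V := Y))].
      f_equal. change (/ 2 + / 2 = 1). field. }
  rewrite <- Ed in E2.
  assert (E3 : norm (minus (T (plus x u)) (T (minus x u))) <= norm (T (plus x u)) + norm (T (minus x u))).
  { rewrite (minusE (T (plus x u))). eapply Rle_trans; [apply norm_triangle|]. rewrite norm_opp. lra. }
  lra. }
destruct (Rle_dec (K * r) (norm (T (plus x u)))) as [H|H].
- exists (plus x u). split; trivial. replace (minus (plus x u) x) with u; trivial.
  symmetry. apply (plus_minus_swap (G := X)).
- exists (minus x u). split; [|lra]. eapply Rle_trans; [|exact Hu]. right.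
  transitivity (norm (opp u)); [|apply (norm_opp (V := X))].
  f_equal. apply (plus_minus_swap (G := X) x (opp u)).
Qed.

(** The increments are dominated by a geometric series, so the centres converge. The inclusions
    telescope to a distance of at most r n - r (n + k) between centres, which places the limit in
    every closed ball. *)
Lemma nested_balls {X : CompleteNormedModule R_AbsRing} (x : nat -> X) (r : nat -> R) :
  (forall n, 0 < r n) -> (forall n, norm (minus (x (S n)) (x n)) + r (S n) <= r n) ->
  (forall n, r n <= (/ 2) ^ n) ->
  exists l, forall n, norm (minus l (x n)) <= r n.
Proof.
intros Hr Hx Hr2.
assert (Hnest : forall n k, norm (minus (x (n + k)%nat) (x n)) <= r n - r (n + k)%nat).
{ intros n k. induction k as [|k IH].
  - rewrite Nat.add_0_r, minus_eq_zero. eapply Rle_trans; [right; apply (norm_zero (V := X))|lra].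
  - rewrite Nat.add_succ_r. eapply Rle_trans; [apply (norm_minus_triangle (X := X) _ (x (n + k)%nat))|].
    assert (Har : forall p q u v w, p + u <= v -> q <= w - v -> p + q <= w - u) by (intros; lra).
    exact (Har _ _ _ _ _ (Hx (n + k)%nat) IH). }
assert (Hser : ex_series (fun n => minus (x (S n)) (x n))).
{ apply (ex_series_le (V := X) _ (fun n => (/ 2) ^ n)).
  - intros n. eapply Rle_trans; [|apply Hr2]. eapply Rle_trans; [|apply Hx].
    rewrite <- (Rplus_0_r (norm _)) at 1. apply Rplus_le_compat_l. left. apply Hr.
  - apply ex_series_geom. rewrite Rabs_pos_eq; lra. }
destruct Hser as [s Hs].
assert (Hsum : forall n, sum_n (fun n => minus (x (S n)) (x n)) n = minus (x (S n)) (x O)).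
{ induction n as [|n IH].
  - now rewrite sum_O.
  - rewrite sum_Sn, IH. rewrite plus_comm. apply (minus_plus_cancel (X := X)). }
exists (plus s (x O)). intros n. apply (norm_le_of_approx (X := X)). intros eps.
destruct (proj1 (filterlim_normP (X := X) _ _ _) Hs eps) as [N HN].
(* The sum of increments up to index n + N telescopes to the centre of index n + N + 1, hence the
   shift. *)
set (m := (n + S N)%nat).
exists (minus (x m) (x n)). split.
- specialize (HN (n + N)%nat ltac:(lia)). rewrite Hsum in HN.
  replace (S (n + N)) with m in HN by (unfold m; lia).
  eapply Rle_lt_trans; [|exact HN]. right.
  transitivity (norm (minus s (minus (x m) (x O)))); [|apply (norm_minus_sym (X := X))].
  f_equal.
  refine (eq_trans (f_equal (fun w => minus w (minus (x m) (x n)))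
    (minus_minus_cancel (G := X) s (x O) (x n) (x m))) _).
  apply (plus_minus_swap (G := X)).
- unfold m. eapply Rle_trans; [apply Hnest|]. specialize (Hr (n + S N)%nat). lra.
Qed.

(** Gliding hump in place of Baire category: if no bound exists, every ball contains a smaller one
    on which some [T i] has norm at least n. A point common to all these balls contradicts the
    pointwise bound. *)
Lemma uniform_boundedness {I : Type} {X : CompleteNormedModule R_AbsRing} {Y : NormedModule R_AbsRing}
    (T : I -> X -> Y) :
  (forall i, is_linear (T i)) -> (forall x, exists M, forall i, norm (T i x) <= M) ->
  exists M, 0 < M /\ forall i x, norm (T i x) <= M * norm x.
Proof.
intros HT Hb. apply NNPP. intros Hno.
assert (Hlarge : forall M, 0 < M -> exists i x, M * norm x < norm (T i x)).
{ intros M HM. apply NNPP. intros H. apply Hno. exists M. split; trivial. intros i x.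
  destruct (Rle_dec (norm (T i x)) (M * norm x)) as [Hle|Hle]; trivial.
  exfalso; apply H. exists i, x. lra. }
assert (Hstep : forall (n : nat) (p : X * posreal), exists q : X * posreal,
  norm (minus (fst q) (fst p)) + snd q <= snd p /\ snd q <= snd p / 2 /\
  exists i, forall y, norm (minus y (fst q)) <= snd q -> INR n <= norm (T i y)).
{ intros n [x [r Hr]]. simpl.
  (* At distance at most r / 2 from the old centre this slope guarantees a value of norm at least n
     + 1. *)
  set (K := (INR n + 1) / (r / 2)).
  assert (Hn : 0 <= INR n) by apply pos_INR.
  assert (HK : 0 < K) by (apply Rdiv_lt_0_compat; lra).
  destruct (Hlarge K HK) as [i [v Hv]].
  destruct (linear_large_value (X := X) (T i) x v K (r / 2) (HT i) ltac:(lra) HK Hv) as [x' [Hx' HTx']].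
  destruct (linear_norm (T i) (HT i)) as [B [HB HBx]].
  (* Radius r / 2 keeps the new ball inside the old one; radius 1 / B lets [T i] vary by at most 1
     on it, so n remains of n + 1. *)
  assert (Hr' : 0 < Rmin (r / 2) (/ B)).
  { apply Rmin_glb_lt. lra. now apply Rinv_0_lt_compat. }
  exists (x', mkposreal _ Hr'). simpl. split; [|split].
  - pose proof (Rmin_l (r / 2) (/ B)). eapply Rle_trans; [apply Rplus_le_compat; [exact Hx'|exact H]|]. lra.
  - apply Rmin_l.
  - exists i. intros y Hy.
    replace (K * (r / 2)) with (INR n + 1) in HTx' by (unfold K; field; lra).
    assert (Hd : norm (minus (T i y) (T i x')) <= 1).
    { rewrite <- (linear_minus (U := X)) by trivial. eapply Rle_trans; [apply HBx|].
      apply Rle_trans with (B * / B); [|right; field; lra].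
      apply Rmult_le_compat_l; [lra|]. eapply Rle_trans; [exact Hy|apply Rmin_r]. }
    assert (Ht := norm_le_minus (T i x') (T i y)).
    rewrite (norm_minus_sym (T i x')) in Ht. lra. }
set (step := fun n p => proj1_sig (constructive_indefinite_description _ (Hstep n p))).
assert (Hs : forall n p, norm (minus (fst (step n p)) (fst p)) + snd (step n p) <= snd p /\
  snd (step n p) <= snd p / 2 /\
  exists i, forall y, norm (minus y (fst (step n p))) <= snd (step n p) -> INR n <= norm (T i y)).
{ intros n p. exact (proj2_sig (constructive_indefinite_description _ (Hstep n p))). }
set (s := nat_rect (fun _ => (X * posreal)%type) (zero, mkposreal 1 Rlt_0_1) step).
assert (Hsn : forall n, s (S n) = step n (s n)) by reflexivity.
destruct (nested_balls (fun n => fst (s n)) (fun n => snd (s n))) as [l Hl].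
- intros n. apply cond_pos.
- intros n. rewrite Hsn. apply Hs.
- induction n as [|n IH].
  + simpl. lra.
  + rewrite Hsn. destruct (Hs n (s n)) as [_ [H _]]. simpl. lra.
- destruct (Hb l) as [M HM].
  destruct (INR_unbounded M) as [n Hn].
  destruct (Hs n (s n)) as [_ [_ [i Hi]]].
  specialize (HM i). specialize (Hi l). rewrite <- Hsn in Hi. specialize (Hi (Hl (S n))). lra.
Qed.

Lemma continuous_bounded {X : NormedModule R_AbsRing} (f : R -> X) (a b : R) :
  (forall t, a <= t <= b -> continuous f t) -> exists M, forall t, a <= t <= b -> norm (f t) <= M.
Proof.
intros Hf. destruct (Rle_dec a b) as [Hab|Hab].
2:{ exists 0. intros t Ht. lra. }
destruct (continuity_ab_maj (fun t => norm (f t)) a b Hab) as [m [Hm _]].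
- intros t Ht. apply continuity_pt_filterlim. apply (continuous_comp f norm).
  now apply Hf. apply (filterlim_norm (V := X)).
- now exists (norm (f m)).
Qed.

(** * Convolution with powers *)

Lemma norm_scal_ge {X : NormedModule R_AbsRing} (k : R) (x : X) :
  0 < k -> k * norm x <= norm (scal k x).
Proof.
intros Hk. apply Rmult_le_reg_l with (/ k); [now apply Rinv_0_lt_compat|].
rewrite <- Rmult_assoc, Rinv_l, Rmult_1_l by lra.
eapply Rle_trans; [|apply norm_scal_le; left; now apply Rinv_0_lt_compat].
right. f_equal. symmetry.
refine (eq_trans (scal_assoc (V := X) _ _ _) _).
transitivity (scal (one : R_AbsRing) x); [|apply (scal_one (V := X))].
f_equal. change (/ k * k = 1). field. lra.
Qed.

Lemma scal_inv_cancel {X : NormedModule R_AbsRing} (k : R) (x : X) : k <> 0 -> scal k (scal (/ k) x) = x.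
Proof.
intros Hk. refine (eq_trans (scal_assoc (V := X) _ _ _) _).
transitivity (scal (one : R_AbsRing) x); [|apply (scal_one (V := X))].
f_equal. change (k * / k = 1). field. trivial.
Qed.

Lemma scal_scal {X : NormedModule R_AbsRing} (k l : R) (x : X) : scal k (scal l x) = scal (k * l) x.
Proof. exact (scal_assoc (V := X) k l x). Qed.

Lemma scal_eq_zero {X : NormedModule R_AbsRing} (k : R) (x : X) : k <> 0 -> scal k x = zero -> x = zero.
Proof.
intros Hk H. rewrite <- (scal_inv_cancel (/ k) x) by now apply Rinv_neq_0_compat.
rewrite Rinv_inv, H. exact (scal_zero_r (V := X) _).
Qed.

Lemma norm_minus_zero_zero {X : NormedModule R_AbsRing} (x : X) :
  norm (minus (minus zero zero) x) = norm x.
Proof.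
rewrite <- (norm_opp x). f_equal. rewrite minus_eq_zero. apply (plus_zero_l (G := X)).
Qed.

Lemma is_derive_zero_fun {X : NormedModule R_AbsRing} (x : R) (l : X) :
  is_derive (fun _ : R => (zero : X)) x l -> l = zero.
Proof.
intros [_ H]. destruct (norm_ge_0 l) as [Hl|Hl].
2:{ apply norm_eq_zero. now rewrite <- Hl. }
exfalso. destruct (H x (fun P HP => HP) (mkposreal (norm l / 2) ltac:(lra))) as [d Hd].
specialize (Hd (x + d / 2)). pose proof (cond_pos d) as Hdp.
assert (Hb : ball x d (x + d / 2)).
{ change (Rabs (x + d / 2 - x) < d). replace (x + d / 2 - x) with (d / 2) by ring. rewrite Rabs_pos_eq; lra. }
specialize (Hd Hb). simpl in Hd.
change (norm (minus (minus zero zero) (scal (x + d / 2 - x) l)) <= norm l / 2 * Rabs (x + d / 2 - x)) in Hd.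
replace (x + d / 2 - x) with (d / 2) in Hd by ring.
apply (Rle_trans _ _ _ (Req_le _ _ (eq_sym (norm_minus_zero_zero _)))) in Hd.
rewrite Rabs_pos_eq in Hd by lra.
pose proof (norm_scal_ge (d / 2) l ltac:(lra)). nra.
Qed.

Lemma is_derive_unique_vec {X : NormedModule R_AbsRing} (f : R -> X) (x : R) (l1 l2 : X) :
  is_derive f x l1 -> is_derive f x l2 -> l1 = l2.
Proof.
intros H1 H2. apply minus_eq_zero_eq. apply (is_derive_zero_fun x).
apply is_derive_ext with (fun t => minus (f t) (f t)).
- intros t. exact (minus_eq_zero (G := X) (f t)).
- now apply (is_derive_minus f f).
Qed.

(** Formulas for the derivative depend on a cut near each point; uniqueness of derivatives glues
    them into one function, chosen pointwise. *)
Lemma C1_pos_local {X : CompleteNormedModule R_AbsRing} (f : R -> X) :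
  (forall t0, 0 < t0 -> exists D : R -> X,
    locally t0 (fun t => is_derive f t (D t)) /\ continuous D t0) ->
  C1_pos f.
Proof.
intros H.
assert (H' : forall t, exists l, 0 < t -> is_derive f t l).
{ intros t. destruct (Rlt_dec 0 t) as [Ht|Ht].
  - destruct (H t Ht) as [D [HD _]]. exists (D t). intros _. exact (locally_singleton _ _ HD).
  - exists zero. intros; lra. }
set (f' := fun t => proj1_sig (constructive_indefinite_description _ (H' t))).
assert (Hf' : forall t, 0 < t -> is_derive f t (f' t)).
{ intros t. exact (proj2_sig (constructive_indefinite_description _ (H' t))). }
exists f'. intros t Ht. split; [now apply Hf'|].
destruct (H t Ht) as [D [HD HDc]].
apply continuous_ext_loc with D; trivial.
generalize (filter_and _ _ HD (locally_pos t Ht)). apply filter_imp.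
intros y [Hy Hy0]. apply (is_derive_unique_vec (X := X) f y); trivial. now apply Hf'.
Qed.

Lemma RInt_zero_integrand {X : CompleteNormedModule R_AbsRing} (g : R -> X) :
  (forall t, continuous g t) -> (forall T, 0 < T -> RInt g 0 T = zero) -> forall t, 0 < t -> g t = zero.
Proof.
intros Hg H t Ht. apply (is_derive_zero_fun (X := X) t).
apply is_derive_ext_loc with (fun T => RInt g 0 T).
- generalize (locally_pos t Ht). apply filter_imp. exact H.
- now apply is_derive_RInt_cont.
Qed.

(** For T > 0, the Riemann-Liouville integral of order a + 1 without its Gamma factor; the
    truncation makes it vanish for T <= 0. *)
Definition conv {X : CompleteNormedModule R_AbsRing} (a : R) (f : R -> X) (T : R) : X :=
  RInt (fun t => scal (tpow a (T - t)) (f t)) 0 T.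

Lemma continuous_conv_kernel {X : NormedModule R_AbsRing} (a T : R) (f : R -> X) (t : R) :
  0 < a -> (forall t, continuous f t) -> continuous (fun t => scal (tpow a (T - t)) (f t)) t.
Proof.
intros Ha Hf. apply (continuous_scal (fun t => tpow a (T - t)) f); trivial.
apply (continuous_comp (fun t => T - t) (tpow a)); [|now apply continuous_tpow].
apply (continuous_minus (fun _ => T) (fun t : R => t)). apply continuous_const. apply continuous_id.
Qed.

Lemma jointly_continuous_conv_kernel {X : NormedModule R_AbsRing} (a : R) (f : R -> X) (T t : R) :
  0 < a -> (forall t, continuous f t) -> jointly_continuous (fun T t => scal (tpow a (T - t)) (f t)) T t.
Proof.
intros Ha Hf. apply (jointly_continuous_scal (fun T t => tpow a (T - t)) (fun _ t => f t)).
- apply (jointly_continuous_comp (fun T t => T - t) (tpow a)); [|now apply continuous_tpow].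
  apply (jointly_continuous_minus (fun T _ => T) (fun _ t => t)).
  apply (jointly_continuous_fst (fun T => T)), continuous_id.
  apply (jointly_continuous_snd (fun T => T)), continuous_id.
- now apply (jointly_continuous_snd f).
Qed.

Lemma conv_upper {X : CompleteNormedModule R_AbsRing} (a : R) (f : R -> X) (T b : R) :
  0 < a -> (forall t, continuous f t) -> T <= b ->
  conv a f T = RInt (fun t => scal (tpow a (T - t)) (f t)) 0 b.
Proof.
intros Ha Hf HTb. unfold conv.
rewrite <- (RInt_Chasles _ 0 T b)
  by (apply ex_RInt_cont; intros; now apply (continuous_conv_kernel (X := X))).
rewrite (RInt_zero _ T b). symmetry; apply (plus_zero_r (G := X)).
intros t Ht. rewrite Rmin_left in Ht by trivial. rewrite tpow_npos by lra. exact (scal_zero_l (V := X) _).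
Qed.

Lemma continuous_conv {X : CompleteNormedModule R_AbsRing} (a : R) (f : R -> X) (T : R) :
  0 < a -> (forall t, continuous f t) -> continuous (conv a f) T.
Proof.
intros Ha Hf. set (b := Rmax 0 (T + 1)).
apply continuous_ext_loc with (fun T => RInt (fun t => scal (tpow a (T - t)) (f t)) 0 b).
- exists (mkposreal 1 Rlt_0_1). intros y Hy. symmetry. apply conv_upper; trivial.
  apply Rle_trans with (T + 1); [|apply Rmax_r].
  change (Rabs (y - T) < 1) in Hy. apply Rabs_lt_between in Hy. lra.
- apply (continuous_RInt_param_global (fun T t => scal (tpow a (T - t)) (f t))).
  apply Rmax_l. intros. now apply (jointly_continuous_conv_kernel (X := X)).
Qed.

Lemma RInt_scal_l {X : CompleteNormedModule R_AbsRing} (k : R -> R) (x : X) (a b : R) :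
  (forall t, continuous k t) -> RInt (fun t => scal (k t) x) a b = scal (RInt k a b) x.
Proof.
intros Hk. apply (is_linear_RInt (X := R_CompleteNormedModule) (Y := X) (fun k : R => scal k x) k); trivial.
apply (is_linear_scal_l (K := R_AbsRing) (V := X) x).
Qed.

(** Euler's Beta(a + 1, b + 1); of its value only the positivity is used. *)
Definition Beta_tpow (a b : R) : R := RInt (fun u => tpow b (1 - u) * tpow a u) 0 1.

Lemma Beta_tpow_gt_0 (a b : R) : 0 < a -> 0 < b -> 0 < Beta_tpow a b.
Proof.
intros Ha Hb. apply RInt_gt_0. lra.
- intros u Hu. apply Rmult_lt_0_compat; apply tpow_gt_0; lra.
- intros u _. apply (continuous_conv_kernel (X := R_NormedModule) b 1 (tpow a)); trivial.
  intros; now apply continuous_tpow.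
Qed.

Lemma RInt_tpow_tpow (a b T t : R) : 0 < a -> 0 < b -> 0 <= t <= T ->
  RInt (fun s => tpow b (T - s) * tpow a (s - t)) 0 T = Beta_tpow a b * tpow (a + b + 1) (T - t).
Proof.
intros Ha Hb Ht. set (h := fun s => tpow b (T - s) * tpow a (s - t)).
assert (Hh : forall s, continuous h s).
{ intros s. apply (continuous_conv_kernel (X := R_NormedModule) b T (fun s => tpow a (s - t))); trivial.
  intros r. apply (continuous_comp (fun r => r - t) (tpow a)); [|now apply continuous_tpow].
  apply (continuous_minus (fun r : R => r) (fun _ => t)). apply continuous_id. apply continuous_const. }
rewrite <- (RInt_Chasles h 0 t T) by (apply (ex_RInt_cont (X := R_CompleteNormedModule)); trivial).
rewrite (RInt_zero (X := R_CompleteNormedModule) h 0 t).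
2:{ intros s Hs. rewrite Rmax_right in Hs by lra. unfold h. rewrite (tpow_npos a) by lra. apply Rmult_0_r. }
rewrite (plus_zero_l (G := R_AbelianGroup)).
destruct (Rle_lt_dec T t) as [H|H].
- replace t with T by lra. rewrite Rminus_diag, tpow_npos, Rmult_0_r by lra.
  apply (RInt_point (V := R_CompleteNormedModule)).
- assert (E := RInt_comp_lin h (T - t) t 0 1).
  replace ((T - t) * 0 + t) with t in E by ring. replace ((T - t) * 1 + t) with T in E by ring.
  rewrite <- E by (apply (ex_RInt_cont (X := R_CompleteNormedModule)); trivial).
  unfold Beta_tpow. rewrite Rmult_comm. rewrite <- (RInt_scal (V := R_CompleteNormedModule)).
  2:{ apply (ex_RInt_cont (X := R_CompleteNormedModule)). intros u.
      apply (continuous_conv_kernel (X := R_NormedModule) b 1 (tpow a)); trivial.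
      intros; now apply continuous_tpow. }
  apply RInt_ext. intros u Hu. rewrite Rmin_left, Rmax_right in Hu by lra. unfold h.
  change ((T - t) * (tpow b (T - ((T - t) * u + t)) * tpow a ((T - t) * u + t - t)) =
    tpow (a + b + 1) (T - t) * (tpow b (1 - u) * tpow a u)).
  replace (T - ((T - t) * u + t)) with ((T - t) * (1 - u)) by ring.
  replace ((T - t) * u + t - t) with ((T - t) * u) by ring.
  rewrite !tpow_mult_base, (tpow_pos (a + b + 1)), !Rpower_plus, Rpower_1 by lra. ring.
Qed.

(** The semigroup law of fractional integration. Thanks to the truncated kernels, the interchange
    takes place on the square [0, T]^2 instead of a triangle, and the inner integral is a Beta
    integral on [t, T]. *)
Lemma conv_conv {X : CompleteNormedModule R_AbsRing} (a b : R) (f : R -> X) (T : R) :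
  0 < a -> 0 < b -> (forall t, continuous f t) -> 0 <= T ->
  conv b (conv a f) T = scal (Beta_tpow a b) (conv (a + b + 1) f T).
Proof.
intros Ha Hb Hf HT.
set (h := fun s t => scal (tpow b (T - s) * tpow a (s - t)) (f t)).
assert (Hk : forall s t, jointly_continuous (fun s t => tpow b (T - s) * tpow a (s - t)) s t).
{ intros s t. apply (jointly_continuous_scal (X := R_NormedModule) (fun s _ => tpow b (T - s)) (fun s t => tpow a (s - t))).
  - apply (jointly_continuous_fst (fun s => tpow b (T - s))).
    apply (continuous_comp (fun t => T - t) (tpow b)); [|now apply continuous_tpow].
    apply (continuous_minus (fun _ => T) (fun t : R => t)). apply continuous_const. apply continuous_id.
  - apply (jointly_continuous_comp (fun T t => T - t) (tpow a)); [|now apply continuous_tpow].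
    apply (jointly_continuous_minus (fun T _ => T) (fun _ t => t)).
    apply (jointly_continuous_fst (fun T => T)), continuous_id.
    apply (jointly_continuous_snd (fun T => T)), continuous_id. }
assert (Hh : forall s t, jointly_continuous h s t).
{ intros s t. apply (jointly_continuous_scal (X := X) _ (fun _ t => f t) s t (Hk s t)).
  now apply (jointly_continuous_snd f). }
transitivity (RInt (fun s => RInt (fun t => h s t) 0 T) 0 T).
- unfold conv at 1. apply RInt_ext. intros s Hs. rewrite Rmin_left, Rmax_right in Hs by lra.
  rewrite (conv_upper a f s T) by (trivial; lra).
  rewrite <- RInt_scal.
  + apply RInt_ext. intros t _. apply (scal_scal (X := X)).
  + apply ex_RInt_cont. intros; now apply (continuous_conv_kernel (X := X)).
- rewrite Fubini by trivial.
  unfold conv. rewrite <- RInt_scal.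
  2:{ apply ex_RInt_cont. intros; apply (continuous_conv_kernel (X := X)); trivial. lra. }
  apply RInt_ext. intros t Ht. rewrite Rmin_left, Rmax_right in Ht by lra.
  unfold h. rewrite (RInt_scal_l (fun s => tpow b (T - s) * tpow a (s - t))).
  + rewrite RInt_tpow_tpow by lra. symmetry. apply (scal_scal (X := X)).
  + intros s. exact (jointly_continuous_1 _ s t (Hk s t)).
Qed.

Lemma is_derive_minus_const (y t : R) : is_derive (fun y => y - t) y 1.
Proof. auto_derive; [trivial|ring]. Qed.

(** Near [T] the upper limit is replaced by the constant T + 1, so no boundary term appears; [1 < a]
    makes the truncated kernel continuously differentiable across 0. *)
Lemma conv_derive {X : CompleteNormedModule R_AbsRing} (a : R) (f : R -> X) (T : R) :
  1 < a -> (forall t, continuous f t) -> 0 <= T ->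
  is_derive (conv a f) T (scal a (conv (a - 1) f T)).
Proof.
intros Ha Hf HT.
apply is_derive_ext_loc with (fun y => RInt (fun t => scal (tpow a (y - t)) (f t)) 0 (T + 1)).
- exists (mkposreal 1 Rlt_0_1). intros y Hy. symmetry. apply conv_upper; trivial; try lra.
  change (Rabs (y - T) < 1) in Hy. apply Rabs_lt_between in Hy. lra.
- rewrite (conv_upper (a - 1) f T (T + 1)) by (trivial; lra).
  rewrite <- RInt_scal.
  2:{ apply ex_RInt_cont. intros; apply (continuous_conv_kernel (X := X)); trivial. lra. }
  apply (is_derive_RInt_param_vec (fun y t => scal (tpow a (y - t)) (f t))
    (fun y t => scal a (scal (tpow (a - 1) (y - t)) (f t)))).
  + lra.
  + apply filter_forall. intros y t _. split.
    * rewrite (scal_scal (X := X)).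
      apply (is_derive_scal_l (V := X) (fun y => tpow a (y - t)) y (a * tpow (a - 1) (y - t)) (f t)).
      rewrite <- (Rmult_1_l (a * _)).
      apply (is_derive_comp (V := R_NormedModule) (tpow a) (fun y => y - t)).
      now apply is_derive_tpow. apply is_derive_minus_const.
    * apply (continuous_scal_r (V := X) a (fun s => scal (tpow (a - 1) (s - t)) (f t))).
      apply (jointly_continuous_1 (fun s t => scal (tpow (a - 1) (s - t)) (f t))).
      apply (jointly_continuous_conv_kernel (X := X)); trivial. lra.
  + intros t _. unfold jointly_continuous.
    apply (continuous_scal_r (V := X) a (fun p : R * R => scal (tpow (a - 1) (fst p - snd p)) (f (snd p)))).
    apply (jointly_continuous_conv_kernel (X := X)); trivial. lra.
  + apply filter_forall. intros y. apply ex_RInt_cont. intros; apply (continuous_conv_kernel (X := X)); trivial. lra.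
Qed.

(** Integration by parts against T - t: one boundary term has the factor T - T, the other an empty
    integral. *)
Lemma conv_1_RInt {X : CompleteNormedModule R_AbsRing} (f : R -> X) (T : R) :
  (forall t, continuous f t) -> 0 < T -> conv 1 f T = RInt (fun s => RInt f 0 s) 0 T.
Proof.
intros Hf HT. unfold conv.
rewrite (RInt_ext _ (fun t => scal (T - t) (f t))).
2:{ intros t Ht. rewrite Rmin_left, Rmax_right in Ht by lra. now rewrite tpow_1 by lra. }
assert (HP : forall t, continuous (fun s => RInt f 0 s) t) by (intros; now apply continuous_RInt_end).
assert (HI : is_RInt (fun t => scal (-1) (RInt f 0 t)) 0 T (scal (-1) (RInt (fun s => RInt f 0 s) 0 T))).
{ apply (is_RInt_scal (V := X)). apply RInt_correct. now apply ex_RInt_cont. }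
assert (H := is_RInt_scal_derive_r (fun t => T - t) (fun s => RInt f 0 s) (fun _ => -1) f 0 T _
  ltac:(intros; auto_derive; trivial; ring) ltac:(intros; now apply is_derive_RInt_cont)
  ltac:(intros; apply continuous_const) ltac:(intros; apply Hf) HI).
apply is_RInt_unique in H. simpl in H. rewrite H.
rewrite RInt_point, Rminus_diag.
assert (E : forall p q : X, minus (minus (scal 0 p) (scal (T - 0) zero)) (scal (-1) q) = q).
{ intros p q. transitivity (minus (minus (zero : X) zero) (opp q)).
  - f_equal. f_equal. exact (scal_zero_l (V := X) p). exact (scal_zero_r (V := X) (T - 0)).
    exact (scal_opp_one (V := X) q).
  - rewrite minusE, opp_opp, minus_eq_zero. apply plus_zero_l. }
apply E.
Qed.

(* Composing with another power kernel raises the exponent to 3, from where one differentiates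
   down to the integrand. *)
Lemma conv_injective {X : CompleteNormedModule R_AbsRing} (a : R) (f : R -> X) :
  0 < a < 2 -> (forall t, continuous f t) -> (forall T, 0 < T -> conv a f T = zero) ->
  forall t, 0 < t -> f t = zero.
Proof.
intros Ha Hf H.
assert (H3 : forall T, 0 < T -> conv 3 f T = zero).
{ intros T HT. apply (scal_eq_zero (X := X) (Beta_tpow a (2 - a))).
  - apply Rgt_not_eq, Beta_tpow_gt_0; lra.
  - replace 3 with (a + (2 - a) + 1) by ring. 
    refine (eq_trans (eq_sym (conv_conv a (2 - a) f T _ _ Hf _)) _); try lra.
    unfold conv at 1. apply RInt_zero. intros t Ht. rewrite Rmin_left, Rmax_right in Ht by lra.
    rewrite H by lra. exact (scal_zero_r (V := X) _). }
assert (Hd : forall b, 1 < b -> (forall T, 0 < T -> conv b f T = zero) -> forall T, 0 < T -> conv (b - 1) f T = zero).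
{ intros b Hb Hz T HT. apply (scal_eq_zero (X := X) b); [lra|].
  apply (is_derive_zero_fun (X := X) T).
  apply is_derive_ext_loc with (conv b f).
  - generalize (locally_pos T HT). apply filter_imp. exact Hz.
  - apply conv_derive; trivial. lra. }
assert (H2 := Hd 3 ltac:(lra) H3). replace (3 - 1) with 2 in H2 by ring.
assert (H1 := Hd 2 ltac:(lra) H2). replace (2 - 1) with 1 in H1 by ring.
apply RInt_zero_integrand; trivial. apply RInt_zero_integrand.
- intros; now apply continuous_RInt_end.
- intros T HT. rewrite <- conv_1_RInt by trivial. now apply H1.
Qed.

(** * Riemann-Liouville integrals of regular functions *)

Lemma regular_ext {X : NormedModule R_AbsRing} (theta : R) (f g : R -> X) (l : X) :
  (forall t, 0 < t -> f t = g t) -> regular theta f l -> regular theta g l.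
Proof.
intros H [Hc H0]. split.
- intros t Ht. apply continuous_ext_loc with f; [|now apply Hc].
  generalize (locally_pos t Ht). apply filter_imp. exact H.
- apply filterlim_ext_loc with (2 := H0). exists (mkposreal 1 Rlt_0_1). intros y _ Hy. now rewrite H.
Qed.

Lemma filterlim_minus_vec {X : NormedModule R_AbsRing} {T : Type} (F : (T -> Prop) -> Prop) {FF : Filter F}
    (f g : T -> X) (l m : X) :
  filterlim f F (locally l) -> filterlim g F (locally m) ->
  filterlim (fun t => minus (f t) (g t)) F (locally (minus l m)).
Proof.
intros Hf Hg.
apply (filterlim_comp_2 (G := locally l) (H := locally (opp m)) f (fun t => opp (g t)) plus); trivial.
- exact (filterlim_comp _ _ _ g opp _ _ _ Hg (filterlim_opp (V := X) m)).
- apply (filterlim_plus (V := X)).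
Qed.

Lemma scal_minus {X : NormedModule R_AbsRing} (k : R) (x y : X) :
  scal k (minus x y) = minus (scal k x) (scal k y).
Proof. exact (scal_minus_distr_l (V := X) k x y). Qed.

Lemma regular_minus {X : NormedModule R_AbsRing} (theta : R) (f g : R -> X) (l m : X) :
  regular theta f l -> regular theta g m -> regular theta (fun t => minus (f t) (g t)) (minus l m).
Proof.
intros [Hf Hf0] [Hg Hg0]. split.
- intros t Ht. apply (continuous_minus (V := X) f g); auto.
- apply filterlim_ext with
    (fun t => minus (scal (/ Rpower t (theta - 1)) (f t)) (scal (/ Rpower t (theta - 1)) (g t))).
  + intros t. symmetry. apply (scal_minus (X := X)).
  + exact (filterlim_minus_vec (X := X) _ _ _ _ _ Hf0 Hg0).
Qed.

Lemma regular_linear {X Y : NormedModule R_AbsRing} (L : X -> Y) (theta : R) (f : R -> X) (l : X) :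
  is_linear L -> regular theta f l -> regular theta (fun t => L (f t)) (L l).
Proof.
intros HL [Hf Hf0]. split.
- intros t Ht. apply (continuous_comp f L). auto. now apply is_linear_continuous.
- apply filterlim_ext with (fun t => L (scal (/ Rpower t (theta - 1)) (f t))).
  + intros t. exact (linear_scal L HL _ _).
  + apply filterlim_comp with (1 := Hf0). exact (is_linear_continuous L l HL).
Qed.

Lemma desing_minus {X : NormedModule R_AbsRing} (theta : R) (f g : R -> X) (l m : X) (r : R) :
  desing theta (fun t => minus (f t) (g t)) (minus l m) r = minus (desing theta f l r) (desing theta g m r).
Proof. unfold desing. destruct (Rle_dec r 0); apply scal_minus. Qed.

Lemma desing_linear {X Y : NormedModule R_AbsRing} (L : X -> Y) (theta : R) (f : R -> X) (l : X) (r : R) :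
  is_linear L -> desing theta (fun t => L (f t)) (L l) r = L (desing theta f l r).
Proof. intros HL. unfold desing. destruct (Rle_dec r 0); symmetry; exact (linear_scal L HL _ _). Qed.

Lemma continuous_J_integrand {X : NormedModule R_AbsRing} (theta alpha t : R) (f : R -> X) (l : X) (r : R) :
  0 < theta -> 1 < alpha -> regular theta f l ->
  continuous (fun r => scal (tpow (alpha - 1) (t - tpow (/ theta) r)) (desing theta f l r)) r.
Proof.
intros Hth Hal Hf.
apply (continuous_scal (fun r => tpow (alpha - 1) (t - tpow (/ theta) r)) (desing theta f l)).
apply continuous_kernel; lra. now apply continuous_desing.
Qed.

Section Riemann_Liouville.

Context {X : CompleteNormedModule R_AbsRing}.
Variables theta alpha : R.
Hypotheses (Hth : 0 < theta) (Hal : 1 < alpha).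

Lemma J_ext_pos (f g : R -> X) (l : X) (t : R) :
  (forall t, 0 < t -> f t = g t) -> regular theta f l -> 0 < t -> J alpha f t = J alpha g t.
Proof.
intros H Hf Ht. assert (Hg := regular_ext (X := X) theta f g l H Hf).
rewrite (J_desing theta alpha f l t (tpow theta t)), (J_desing theta alpha g l t (tpow theta t)); trivial; try lra.
f_equal. apply RInt_ext. intros r Hr. f_equal. unfold desing. destruct (Rle_dec r 0); trivial.
f_equal. apply H, Rpower_gt_0.
Qed.

Lemma J_linear (L : X -> X) (f : R -> X) (l : X) (t : R) :
  is_linear L -> regular theta f l -> 0 < t -> J alpha (fun r => L (f r)) t = L (J alpha f t).
Proof.
intros HL Hf Ht.
rewrite (J_desing theta alpha f l t (tpow theta t)); trivial; try lra.
rewrite (J_desing theta alpha _ (L l) t (tpow theta t)); trivial; try lra.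
2: now apply (regular_linear (X := X) (Y := X)).
refine (eq_trans _ (eq_sym (linear_scal L HL _ _))). f_equal.
rewrite <- is_linear_RInt; trivial.
- apply RInt_ext. intros r _. rewrite (desing_linear (X := X) (Y := X)) by trivial.
  symmetry. exact (linear_scal L HL _ _).
- intros r. now apply (continuous_J_integrand (X := X)).
Qed.

Lemma J_minus (f g : R -> X) (l m : X) (t : R) :
  regular theta f l -> regular theta g m -> 0 < t ->
  J alpha (fun r => minus (f r) (g r)) t = minus (J alpha f t) (J alpha g t).
Proof.
intros Hf Hg Ht.
rewrite (J_desing theta alpha f l t (tpow theta t)), (J_desing theta alpha g m t (tpow theta t)); trivial; try lra.
rewrite (J_desing theta alpha _ (minus l m) t (tpow theta t)); trivial; try lra.
2: now apply (regular_minus (X := X)).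
refine (eq_trans _ (scal_minus (X := X) _ _ _)). f_equal.
rewrite <- (RInt_minus (V := X)).
- apply RInt_ext. intros r _. rewrite (desing_minus (X := X)). apply (scal_minus (X := X)).
- apply ex_RInt_cont. intros r. now apply (continuous_J_integrand (X := X)).
- apply ex_RInt_cont. intros r. now apply (continuous_J_integrand (X := X)).
Qed.

(** For t <= 0 the improper integral in [J] has no meaning; extension by zero gives a function
    continuous on the whole line, as the convolution lemmas require. *)
Definition J0 (f : R -> X) (t : R) : X := if Rle_dec t 0 then zero else J alpha f t.

Lemma J0_pos (f : R -> X) (t : R) : 0 < t -> J0 f t = J alpha f t.
Proof. intros Ht. unfold J0. destruct (Rle_dec t 0); [lra|reflexivity]. Qed.

Lemma J0_npos (f : R -> X) (t : R) : t <= 0 -> J0 f t = zero.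
Proof. intros Ht. unfold J0. destruct (Rle_dec t 0); [reflexivity|lra]. Qed.

Lemma J0_desing (f : R -> X) (l : X) (t b : R) :
  regular theta f l -> t <= tpow (/ theta) b ->
  J0 f t = scal (/ Gamma alpha)
    (RInt (fun r => scal (tpow (alpha - 1) (t - tpow (/ theta) r)) (desing theta f l r)) 0 b).
Proof.
intros Hf Hb. destruct (Rle_dec t 0) as [Ht|Ht].
- rewrite J0_npos by trivial. rewrite RInt_zero.
  + symmetry. exact (scal_zero_r (V := X) _).
  + intros r _. rewrite tpow_npos. exact (scal_zero_l (V := X) _). pose proof (tpow_ge_0 (/ theta) r). lra.
- rewrite J0_pos by lra. apply J_desing; trivial. lra.
  destruct (Rle_dec 0 b) as [H0|H0].
  + rewrite <- (tpow_inv_r theta b) by trivial. apply tpow_le; lra.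
  + rewrite (tpow_npos (/ theta) b) in Hb by lra. lra.
Qed.

(** One upper limit, chosen for t + 1, serves all nearby arguments, and [J0] becomes an integral
    with a continuous parameter. *)
Lemma continuous_J0 (f : R -> X) (l : X) (t : R) : regular theta f l -> continuous (J0 f) t.
Proof.
intros Hf. set (b := tpow theta (Rmax 0 (t + 1))).
assert (Hb : forall y, y <= t + 1 -> y <= tpow (/ theta) b).
{ intros y Hy. unfold b. rewrite tpow_inv_l by (trivial; apply Rmax_l).
  eapply Rle_trans; [exact Hy|apply Rmax_r]. }
apply continuous_ext_loc with (fun t => scal (/ Gamma alpha)
    (RInt (fun r => scal (tpow (alpha - 1) (t - tpow (/ theta) r)) (desing theta f l r)) 0 b)).
- exists (mkposreal 1 Rlt_0_1). intros y Hy. symmetry. apply J0_desing; trivial. apply Hb.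
  change (Rabs (y - t) < 1) in Hy. apply Rabs_lt_between in Hy. lra.
- apply (continuous_scal_r (V := X)).
  apply (continuous_RInt_param_global (fun t r => scal (tpow (alpha - 1) (t - tpow (/ theta) r)) (desing theta f l r))).
  + apply tpow_ge_0.
  + intros s r. apply (jointly_continuous_scal (X := X) (fun t r => tpow (alpha - 1) (t - tpow (/ theta) r))
      (fun _ r => desing theta f l r)).
    * apply (jointly_continuous_comp (fun t r => t - tpow (/ theta) r) (tpow (alpha - 1))).
      -- apply (jointly_continuous_minus (fun t _ => t) (fun _ r => tpow (/ theta) r)).
         apply (jointly_continuous_fst (fun t => t)), continuous_id.
         apply (jointly_continuous_snd (tpow (/ theta))), continuous_tpow. now apply Rinv_0_lt_compat.
      -- apply continuous_tpow. lra.
    * apply (jointly_continuous_snd (desing theta f l)). now apply continuous_desing.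
Qed.

Lemma J_Rpower (k s : R) (x : X) : 0 < s ->
  J alpha (fun t => scal (k * Rpower t (theta - 1)) x) s =
  scal (k * (Gamma theta / Gamma (alpha + theta)) * Rpower s (alpha + theta - 1)) x.
Proof.
intros Hs.
rewrite (J_desing theta alpha _ (scal k x) s (tpow theta s)); trivial; try lra.
2: apply (regular_Rpower (X := X)).
rewrite (RInt_ext _ (fun r => scal (tpow (alpha - 1) (s - tpow (/ theta) r) * / theta) (scal k x))).
2:{ intros r _. rewrite (desing_Rpower (X := X)). rewrite !(scal_scal (X := X)). f_equal. ring. }
rewrite (RInt_scal_l (fun r => tpow (alpha - 1) (s - tpow (/ theta) r) * / theta)).
2:{ intros r. apply (continuous_mult (fun r => tpow (alpha - 1) (s - tpow (/ theta) r)) (fun _ => / theta)).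
    apply continuous_kernel; lra. apply continuous_const. }
rewrite convolution_Rpower by (trivial; lra).
rewrite !(scal_scal (X := X)). f_equal. rewrite tpow_pos by trivial.
destruct (Gamma_gt_1 (alpha + theta)) as [_ [H1 _]]; [lra|].
destruct (Gamma_gt_1 alpha) as [_ [H2 _]]; [lra|].
assert (E : Beta_desing alpha theta = Gamma alpha * Gamma theta / Gamma (alpha + theta)).
{ rewrite Gamma_mult by trivial. field. lra. }
rewrite E. field. lra.
Qed.

(** After scaling, the quotient is a function of q = s^theta that is continuous up to q = 0, so the
    limit is its value there. *)
Lemma J_limit (f : R -> X) (l : X) : regular theta f l ->
  filterlim (fun s => scal (/ Rpower s (alpha + theta - 1)) (J alpha f s)) (at_right 0)
    (locally (scal (Gamma theta / Gamma (alpha + theta)) l)).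
Proof.
intros Hf.
set (F := desing theta f l). assert (HF : forall r, continuous F r) by now apply continuous_desing.
set (G := fun q => RInt (fun u => scal (tpow (alpha - 1) (1 - tpow (/ theta) u)) (F (q * u))) 0 1).
assert (HG : forall q, continuous G q).
{ intros q. apply (continuous_RInt_param_global
    (fun q u => scal (tpow (alpha - 1) (1 - tpow (/ theta) u)) (F (q * u)))). lra.
  intros s t. apply (jointly_continuous_scal (X := X) (fun _ u => tpow (alpha - 1) (1 - tpow (/ theta) u))
    (fun q u => F (q * u))).
  - apply (jointly_continuous_snd (fun u => tpow (alpha - 1) (1 - tpow (/ theta) u))).
    apply continuous_kernel; lra.
  - apply (jointly_continuous_comp Rmult F); trivial.
    apply (jointly_continuous_scal (X := R_NormedModule) (fun q _ => q) (fun _ u => u)).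
    apply (jointly_continuous_fst (fun t => t)), continuous_id.
    apply (jointly_continuous_snd (fun t => t)), continuous_id. }
(* At q = 0 the desingularized function is frozen at l / theta, which leaves a Beta integral,
   evaluated by [Gamma_mult]. *)
assert (E0 : scal (/ Gamma alpha) (G (tpow theta 0)) = scal (Gamma theta / Gamma (alpha + theta)) l).
{ unfold G. rewrite (tpow_npos theta) by lra.
  rewrite (RInt_ext _ (fun u => scal (tpow (alpha - 1) (1 - tpow (/ theta) u) * / theta) l)).
  2:{ intros u _. rewrite Rmult_0_l. unfold F, desing. destruct (Rle_dec 0 0); [|lra].
      apply (scal_scal (X := X)). }
  rewrite (RInt_scal_l (fun r => tpow (alpha - 1) (1 - tpow (/ theta) r) * / theta)).
  2:{ intros r. apply (continuous_mult (fun r => tpow (alpha - 1) (1 - tpow (/ theta) r)) (fun _ => / theta)).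
      apply continuous_kernel; lra. apply continuous_const. }
  change (RInt (fun t => tpow (alpha - 1) (1 - tpow (/ theta) t) * / theta) 0 1) with (Beta_desing alpha theta).
  rewrite (scal_scal (X := X)). f_equal.
  destruct (Gamma_gt_1 (alpha + theta)) as [_ [H1 _]]; [lra|].
  destruct (Gamma_gt_1 alpha) as [_ [H2 _]]; [lra|].
  assert (E : Beta_desing alpha theta = Gamma alpha * Gamma theta / Gamma (alpha + theta)).
  { rewrite Gamma_mult by trivial. field. lra. }
  rewrite E. field. lra. }
rewrite <- E0.
apply filterlim_ext_loc with (fun s => scal (/ Gamma alpha) (G (tpow theta s))).
- exists (mkposreal 1 Rlt_0_1). intros s _ Hs.
  rewrite (J_desing theta alpha f l s (tpow theta s)); trivial; try lra.
  refine (eq_trans _ (f_equal (fun v => scal (/ Rpower s (alpha + theta - 1)) (scal (/ Gamma alpha) v))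
    (eq_sym (kernel_scaling theta alpha s F Hth Hal Hs HF)))).
  rewrite !(scal_scal (X := X)). f_equal. pose proof (Rpower_gt_0 s (alpha + theta - 1)).
  destruct (Gamma_gt_1 alpha) as [_ [H2 _]]; [lra|].
  field. lra.
- apply (continuous_at_right (fun s => scal (/ Gamma alpha) (G (tpow theta s)))).
  apply (continuous_scal_r (V := X)). apply (continuous_comp (tpow theta) G); trivial.
  now apply continuous_tpow.
Qed.

End Riemann_Liouville.

(** * The generator *)

Lemma lim_filterlim {X : CompleteNormedModule R_AbsRing} {T : Type} (F : (T -> Prop) -> Prop)
    {FF : ProperFilter F} (f : T -> X) (l : X) :
  filterlim f F (locally l) -> lim (filtermap f F) = l.
Proof.
intros H. apply (filterlim_locally_unique (V := X) (F := F) f); trivial.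
apply filterlim_locally. apply (complete_cauchy (filtermap f F)).
- now apply filtermap_proper_filter.
- intros eps. exists l. apply (proj1 (filterlim_locally f l) H eps).
Qed.

Lemma minus_swap {G : AbelianGroup} (a b c d : G) : minus a b = minus c d -> minus a c = minus b d.
Proof.
intros H. rewrite <- (minus_plus_cancel a b c), H, plus_comm. apply minus_plus_cancel.
Qed.

Lemma minus_plus_eq {G : AbelianGroup} (a b c : G) : c = minus a b -> a = plus b c.
Proof. intros ->. now rewrite minusE, (plus_comm a), plus_assoc, plus_opp_r, plus_zero_l. Qed.

Lemma is_linear_scal {X : NormedModule R_AbsRing} (k : R) : is_linear (fun x : X => scal k x).
Proof. apply (is_linear_scal_r (K := R_AbsRing) (V := X) k). exact Rmult_comm. Qed.

Lemma is_linear_of_minus {X : NormedModule R_AbsRing} (L : X -> X) (M : R) :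
  (forall x y, L (minus x y) = minus (L x) (L y)) -> (forall k x, L (scal k x) = scal k (L x)) ->
  0 < M -> (forall x, norm (L x) <= M * norm x) -> is_linear L.
Proof.
intros Hm Hs HM HMx. split; trivial.
- intros x y.
  assert (E : forall y : X, opp y = scal (opp one : R_AbsRing) y) by (intros; symmetry; apply (scal_opp_one (V := X))).
  transitivity (L (minus x (opp y))); [f_equal; now rewrite minusE, opp_opp|].
  rewrite Hm, minusE. f_equal. rewrite (E y).
  refine (eq_trans (f_equal opp (Hs (opp one : R_AbsRing) y)) _).
  refine (eq_trans (f_equal opp (eq_sym (E (L y)))) _). apply (opp_opp (G := X)).
- now exists M.
Qed.

Lemma minus_minus_minus {G : AbelianGroup} (a b c d : G) :
  minus (minus a c) (minus b d) = minus (minus a b) (minus c d).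
Proof.
transitivity (plus (plus a (opp c)) (plus d (opp b))).
- exact (f_equal (plus (minus a c)) (opp_minus b d)).
- transitivity (plus (plus a (opp b)) (plus d (opp c))).
  + rewrite <- !plus_assoc. f_equal. rewrite !plus_assoc, (plus_comm (opp c)), (plus_comm (opp b)).
    rewrite <- !plus_assoc. f_equal. apply plus_comm.
  + exact (eq_sym (f_equal (plus (minus a b)) (opp_minus c d))).
Qed.

Section Generator.

Context {X : CompleteNormedModule R_AbsRing}.
Variables (gamma delta : R) (C : R -> X -> X).
Hypotheses (Hga : 1 < gamma < 2) (Hde : 0 <= delta <= 1) (HC : general_fractional_cosine gamma delta C).

Let theta : R := gamma + delta * (2 - gamma) - 1.
Let w : R -> R := cos_weight gamma delta.
Let K (t : R) (x : X) : X := J gamma (fun r => C r x) t.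
Let l0 (x : X) : X := scal (/ Gamma theta) x.

Lemma theta_bounds : 0 < theta <= 1.
Proof. unfold theta. split; nra. Qed.

Lemma theta_pos : 0 < theta.
Proof. apply theta_bounds. Qed.

Lemma gamma_gt_1 : 1 < gamma.
Proof. apply Hga. Qed.

Lemma Gamma_theta_gt_0 : 0 < Gamma theta.
Proof. apply Gamma_pos, theta_pos. Qed.

Lemma Gamma_gamma_theta_gt_0 : 0 < Gamma (gamma + theta).
Proof. apply Gamma_gt_1. pose proof theta_pos. pose proof gamma_gt_1. lra. Qed.

Lemma cos_weight_Rpower (t : R) : w t = / Gamma theta * Rpower t (theta - 1).
Proof.
unfold w, cos_weight, theta. replace (gamma + delta * (2 - gamma) - 1 - 1) with (gamma + delta * (2 - gamma) - 2) by ring.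
apply Rmult_comm.
Qed.

Lemma regular_cosine (x : X) : regular theta (fun r => C r x) (l0 x).
Proof.
split.
- intros t Ht. now apply (gfc_strongly_continuous HC).
- unfold l0, theta. replace (gamma + delta * (2 - gamma) - 1 - 1) with (gamma + delta * (2 - gamma) - 2) by ring.
  apply (gfc_initial HC).
Qed.

(** A bounded operator that commutes with the family passes through the integral; used for the
    multiples of the identity and for each [C s]. *)
Lemma K_commute (L : X -> X) (x : X) (t : R) :
  is_linear L -> (forall r, 0 < r -> C r (L x) = L (C r x)) -> 0 < t -> K t (L x) = L (K t x).
Proof.
intros HL H Ht. unfold K.
rewrite (J_ext_pos theta gamma theta_pos gamma_gt_1 (fun r => C r (L x)) (fun r => L (C r x)) (l0 (L x)) t);
  trivial.
- apply (J_linear theta gamma theta_pos gamma_gt_1 L (fun r => C r x) (l0 x)); trivial.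
  apply regular_cosine.
- apply regular_cosine.
Qed.

Lemma K_scal (k : R) (x : X) (t : R) : 0 < t -> K t (scal k x) = scal k (K t x).
Proof.
apply (K_commute (fun x => scal k x)). apply (is_linear_scal (X := X)).
intros r Hr. exact (linear_scal _ (gfc_bounded_linear HC Hr) k x).
Qed.

Lemma K_minus (x y : X) (t : R) : 0 < t -> K t (minus x y) = minus (K t x) (K t y).
Proof.
intros Ht. unfold K.
rewrite (J_ext_pos theta gamma theta_pos gamma_gt_1 (fun r => C r (minus x y))
  (fun r => minus (C r x) (C r y)) (l0 (minus x y)) t); trivial.
- apply (J_minus theta gamma theta_pos gamma_gt_1 _ _ (l0 x) (l0 y)); trivial; apply regular_cosine.
- intros r Hr. exact (linear_minus _ _ _ (gfc_bounded_linear HC Hr)).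
- apply regular_cosine.
Qed.

(** The operators C(t) themselves may blow up at 0, but the desingularized family is strongly
    continuous up to r = 0, where it is a multiple of the identity. Uniform boundedness thus applies
    on all of [0, b]. *)
Lemma desing_cosine_bound (b : R) :
  exists M, 0 < M /\ forall r, 0 <= r <= b -> forall x,
    norm (desing theta (fun s => C s x) (l0 x) r) <= M * norm x.
Proof.
destruct (uniform_boundedness (I := {r | 0 <= r <= b}) (X := X) (Y := X)
  (fun i x => desing theta (fun s => C s x) (l0 x) (proj1_sig i))) as [M [HM H]].
- intros [r Hr]. simpl. unfold desing. destruct (Rle_dec r 0).
  + apply (is_linear_comp (U := X) (V := X) (W := X) l0); apply (is_linear_scal (X := X)).
  + apply (is_linear_comp (U := X) (V := X) (W := X) (C (Rpower r (/ theta)))).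
    apply (gfc_bounded_linear HC). apply Rpower_gt_0. apply (is_linear_scal (X := X)).
- intros x. destruct (continuous_bounded (X := X) (desing theta (fun s => C s x) (l0 x)) 0 b) as [M HM].
  + intros t _. apply continuous_desing. apply theta_pos. apply regular_cosine.
  + exists M. intros [r Hr]. now apply HM.
- exists M. split; trivial. intros r Hr x. exact (H (exist _ r Hr) x).
Qed.

Lemma K_bound (b : R) : exists M, 0 < M /\ forall t x, 0 < t <= b -> norm (K t x) <= M * norm x.
Proof.
set (B := tpow theta b). destruct (desing_cosine_bound B) as [M [HM HMx]].
assert (HG : 0 < Gamma gamma) by apply Gamma_gt_1, gamma_gt_1.
assert (HGi : 0 < / Gamma gamma) by now apply Rinv_0_lt_compat.
assert (HB : 0 <= B) by apply tpow_ge_0.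
assert (Hpb : 0 <= tpow (gamma - 1) b) by apply tpow_ge_0.
(* Length of the range times the bounds on kernel and orbit; the [+ 1] keeps the constant positive
   when b <= 0. *)
exists (/ Gamma gamma * (B * (tpow (gamma - 1) b * M)) + 1). split.
{ assert (0 <= / Gamma gamma * (B * (tpow (gamma - 1) b * M))); [|lra].
  apply Rmult_le_pos; [lra|]. apply Rmult_le_pos; trivial. apply Rmult_le_pos; lra. }
intros t x Ht. unfold K.
rewrite (J_desing theta gamma _ (l0 x) t B); try lra.
2: apply theta_pos. 2: apply regular_cosine.
2:{ apply tpow_le. pose proof theta_pos. lra. lra. }
eapply Rle_trans. { apply (norm_scal_le (X := X)). lra. }
apply Rle_trans with (/ Gamma gamma * (B * (tpow (gamma - 1) b * M * norm x))).
2:{ rewrite Rmult_plus_distr_r.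
    assert (0 <= norm x) by apply (norm_ge_0 (V := X)). apply Rle_trans with (/ Gamma gamma * (B * (tpow (gamma - 1) b * M)) * norm x).
    right; ring. lra. }
apply Rmult_le_compat_l; [lra|].
rewrite <- (Rminus_0_r B) at 2.
apply (norm_RInt_le_const (V := X) (fun r => scal (tpow (gamma - 1) (t - tpow (/ theta) r))
  (desing theta (fun s => C s x) (l0 x) r)) 0 B); trivial.
- intros r Hr. eapply Rle_trans. { apply (norm_scal_le (X := X)). apply tpow_ge_0. }
  rewrite Rmult_assoc. apply Rmult_le_compat.
  + apply tpow_ge_0.
  + apply (norm_ge_0 (V := X)).
  + apply tpow_le. lra. pose proof (tpow_ge_0 (/ theta) r). lra.
  + now apply HMx.
- apply RInt_correct, ex_RInt_cont. intros r.
  apply (continuous_J_integrand (X := X)). apply theta_pos. apply gamma_gt_1. apply regular_cosine.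
Qed.

Lemma K_is_linear (t : R) : 0 < t -> is_linear (K t).
Proof.
intros Ht. destruct (K_bound t) as [M [HM HMx]].
apply (is_linear_of_minus (X := X) (K t) M); trivial.
- intros; now apply K_minus.
- intros; now apply K_scal.
- intros x. apply HMx. lra.
Qed.

Lemma K_cosine (t s : R) (x : X) : 0 < t -> 0 < s -> K t (C s x) = C s (K t x).
Proof.
intros Ht Hs. apply K_commute; trivial. now apply (gfc_bounded_linear HC).
intros r Hr. now apply (gfc_commute HC).
Qed.

Lemma K_limit (x : X) :
  filterlim (fun s => scal (/ Rpower s (gamma + theta - 1)) (K s x)) (at_right 0)
    (locally (scal (/ Gamma (gamma + theta)) x)).
Proof.
replace (scal (/ Gamma (gamma + theta)) x) with (scal (Gamma theta / Gamma (gamma + theta)) (l0 x)).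
- exact (J_limit theta gamma theta_pos gamma_gt_1 (fun r => C r x) (l0 x) (regular_cosine x)).
- unfold l0. rewrite (scal_scal (X := X)). f_equal.
  pose proof Gamma_theta_gt_0. pose proof Gamma_gamma_theta_gt_0. field. lra.
Qed.

Lemma generator_quotient_eq (x : X) (t : R) :
  generator_quotient gamma delta C x t =
  scal (/ Rpower t (gamma + theta - 1)) (minus (C t x) (scal (w t) x)).
Proof.
unfold generator_quotient, theta.
now replace (2 * gamma + delta * (2 - gamma) - 2) with (gamma + (gamma + delta * (2 - gamma) - 1) - 1) by ring.
Qed.

(** The graph of the generator as a relation, free of [lim]: since gamma + theta - 1 = 2 gamma +
    delta (2 - gamma) - 2, the quotient is the one in [generator], with the Gamma factor moved into
    the limit. *)
Definition generates (x y : X) : Prop :=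
  filterlim (fun t => scal (/ Rpower t (gamma + theta - 1)) (minus (C t x) (scal (w t) x)))
    (at_right 0) (locally (scal (/ Gamma (gamma + theta)) y)).

Lemma generates_generator (x y : X) : generates x y ->
  dom (generator gamma delta C) x /\ app (generator gamma delta C) x = y.
Proof.
intros H.
assert (H' : filterlim (generator_quotient gamma delta C x) (at_right 0) (locally (scal (/ Gamma (gamma + theta)) y))).
{ apply filterlim_ext with (2 := H). intros t. symmetry. apply generator_quotient_eq. }
split.
- now exists (scal (/ Gamma (gamma + theta)) y).
- simpl. rewrite (lim_filterlim (at_right 0) _ _ H').
  replace (2 * gamma + delta * (2 - gamma) - 1) with (gamma + theta) by (unfold theta; ring).
  apply (scal_inv_cancel (X := X)). pose proof Gamma_gamma_theta_gt_0. lra.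
Qed.

Lemma generator_generates (x : X) : dom (generator gamma delta C) x -> generates x (app (generator gamma delta C) x).
Proof.
intros [y Hy]. assert (E := lim_filterlim (at_right 0) _ _ Hy). simpl. rewrite E.
replace (2 * gamma + delta * (2 - gamma) - 1) with (gamma + theta) by (unfold theta; ring).
unfold generates. rewrite (scal_scal (X := X)), Rinv_l.
2:{ pose proof Gamma_gamma_theta_gt_0. lra. }
refine (eq_ind y (fun z : X => filterlim _ _ (locally z)) _ _ (eq_sym (scal_one (V := X) y))).
apply filterlim_ext with (2 := Hy). intros t. apply generator_quotient_eq.
Qed.

Lemma generates_unique (x y z : X) : generates x y -> generates x z -> y = z.
Proof.
intros H1 H2. rewrite <- (proj2 (generates_generator x y H1)). now apply generates_generator.
Qed.

(** Continuity carries [L] through the limit. With L = C(t) this is (a); with L = K(t) it prepares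
    (c). *)
Lemma generates_commute (L : X -> X) (x y : X) :
  is_linear L -> (forall r, 0 < r -> C r (L x) = L (C r x)) -> generates x y -> generates (L x) (L y).
Proof.
intros HL H Hxy. unfold generates.
replace (scal (/ Gamma (gamma + theta)) (L y)) with (L (scal (/ Gamma (gamma + theta)) y)) by exact (linear_scal L HL _ _).
apply filterlim_ext_loc with
  (fun t => L (scal (/ Rpower t (gamma + theta - 1)) (minus (C t x) (scal (w t) x)))).
- exists (mkposreal 1 Rlt_0_1). intros t _ Ht.
  refine (eq_trans (linear_scal L HL _ _) _). f_equal.
  refine (eq_trans (linear_minus _ _ _ HL) _). rewrite H by trivial. f_equal. exact (linear_scal L HL _ _).
- apply filterlim_comp with (1 := Hxy). exact (is_linear_continuous (X := X) (Y := X) L _ HL).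
Qed.

Lemma generates_cosine (x y : X) (t : R) : 0 < t -> generates x y -> generates (C t x) (C t y).
Proof.
intros Ht. apply generates_commute. now apply (gfc_bounded_linear HC).
intros r Hr. now apply (gfc_commute HC).
Qed.

Lemma K_difference_eq (x : X) (t s : R) : 0 < t -> 0 < s ->
  minus (C s (K t x)) (scal (w s) (K t x)) = K s (minus (C t x) (scal (w t) x)).
Proof.
intros Ht Hs. rewrite K_minus, K_scal by trivial.
apply (minus_swap (G := X)). now apply (gfc_functional_equation HC).
Qed.

Lemma generates_K (x : X) (t : R) : 0 < t -> generates (K t x) (minus (C t x) (scal (w t) x)).
Proof.
intros Ht. unfold generates.
apply filterlim_ext_loc with (2 := K_limit (minus (C t x) (scal (w t) x))).
exists (mkposreal 1 Rlt_0_1). intros s _ Hs. now rewrite K_difference_eq.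
Qed.

(** The generator is evaluated at K(t) x in two ways: commutation gives K(t) y, and (b) gives C(t) x
    - w(t) x. *)
Lemma K_generates (x y : X) (t : R) : 0 < t -> generates x y -> K t y = minus (C t x) (scal (w t) x).
Proof.
intros Ht H. apply (generates_unique (K t x)).
- apply (generates_commute (K t)); trivial. now apply K_is_linear.
  intros r Hr. symmetry. now apply K_cosine.
- now apply generates_K.
Qed.

(** The converse of (c): the integral identity for all t characterizes the graph. Linearity and
    closedness then follow from identities between bounded operators, with no limit left to
    interchange. *)
Lemma generates_of_K (x y : X) :
  (forall t, 0 < t -> K t y = minus (C t x) (scal (w t) x)) -> generates x y.
Proof.
intros H. unfold generates. apply filterlim_ext_loc with (2 := K_limit y).
exists (mkposreal 1 Rlt_0_1). intros s _ Hs. now rewrite H.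
Qed.

Lemma generates_minus (x y x' y' : X) : generates x y -> generates x' y' -> generates (minus x x') (minus y y').
Proof.
intros H H'. apply generates_of_K. intros t Ht.
rewrite K_minus, (K_generates x y), (K_generates x' y') by trivial.
rewrite (minus_minus_minus (G := X)). f_equal.
- symmetry. exact (linear_minus _ _ _ (gfc_bounded_linear HC Ht)).
- symmetry. apply (scal_minus (X := X)).
Qed.

Lemma generator_linear : linear_operator (generator gamma delta C).
Proof.
set (A := generator gamma delta C).
assert (Hcos : forall t, 0 < t -> is_linear (C t)) by (intros; now apply (gfc_bounded_linear HC)).
assert (Hsc : forall k x y, generates x y -> generates (scal k x) (scal k y)).
{ intros k x y. apply (generates_commute (fun x => scal k x)). apply (is_linear_scal (X := X)).
  intros r Hr. exact (linear_scal _ (Hcos r Hr) k x). }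
assert (Hpl : forall x y x' y', generates x y -> generates x' y' -> generates (plus x x') (plus y y')).
{ intros x y x' y' H H'. apply generates_of_K. intros t Ht.
  rewrite (linear_plus _ (K_is_linear t Ht)), (K_generates x y), (K_generates x' y') by trivial.
  rewrite (linear_plus _ (Hcos t Ht)).
  assert (E : forall a b c d k : X, k = plus c d -> plus (minus a c) (minus b d) = minus (plus a b) k).
  { intros a b c d k ->. rewrite !(minusE (G := X)), (opp_plus (G := X)), <- !(plus_assoc (G := X)).
    f_equal. rewrite !(plus_assoc (G := X)). f_equal. apply plus_comm. }
  apply E. exact (scal_distr_l (V := X) _ _ _). }
split; [|split].
- assert (H0 : generates zero zero).
  { apply generates_of_K. intros t Ht. transitivity (zero : X).
    exact (linear_zero _ (K_is_linear t Ht)).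
    symmetry. transitivity (minus (zero : X) zero); [f_equal|apply (minus_eq_zero (G := X))].
    exact (linear_zero _ (Hcos t Ht)). exact (scal_zero_r (V := X) _). }
  now apply generates_generator in H0.
- intros x y Hx Hy. apply generates_generator. apply Hpl; now apply generator_generates.
- intros k x Hx. apply generates_generator. apply Hsc. now apply generator_generates.
Qed.

Lemma generator_closed : closed_operator (generator gamma delta C).
Proof.
intros [x y] Hxy. simpl.
enough (Hg : generates x y).
{ destruct (generates_generator x y Hg) as [Hd <-]. now split. }
(* If the identity failed at (x, y) for one t, then by continuity of [Phi] it would fail on a whole
   neighbourhood, which would therefore miss the graph. *)
apply generates_of_K. intros t Ht. apply NNPP. intros Hne. apply Hxy.
set (Phi := fun p : X * X => minus (K t (snd p)) (minus (C t (fst p)) (scal (w t) (fst p)))).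
assert (HPhi : continuous Phi (x, y)).
{ apply (continuous_minus (V := X) (fun p : X * X => K t (snd p)) (fun p => minus (C t (fst p)) (scal (w t) (fst p)))).
  - apply (continuous_comp (fun p : X * X => snd p) (K t)). apply continuous_snd.
    apply (is_linear_continuous (X := X) (Y := X)). now apply K_is_linear.
  - apply (continuous_minus (V := X) (fun p : X * X => C t (fst p)) (fun p => scal (w t) (fst p))).
    + apply (continuous_comp (fun p : X * X => fst p) (C t)). apply continuous_fst.
      apply (is_linear_continuous (X := X) (Y := X)). now apply (gfc_bounded_linear HC).
    + apply (continuous_scal_r (V := X) (w t) (fun p : X * X => fst p)). apply continuous_fst. }
assert (Hn : 0 < norm (Phi (x, y))).
{ apply (norm_minus_gt_0 (V := X)). exact Hne. }
generalize (proj1 (continuous_normP (X := X) Phi (x, y)) HPhi (mkposreal _ Hn)). apply filter_imp.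
intros [x' y'] Hp [Hd Happ]. simpl in Hd, Happ.
apply generator_generates in Hd. simpl in Hd. rewrite <- Happ in Hd.
assert (E : Phi (x', y') = zero).
{ unfold Phi. simpl. rewrite (K_generates x' y' t Ht Hd). apply (minus_eq_zero (G := X)). }
(* The tolerance was the norm of [Phi] at (x, y) itself, and [Phi] is zero on the graph. *)
apply (Rlt_irrefl (norm (Phi (x, y)))).
eapply Rle_lt_trans; [|exact Hp]. right.
transitivity (norm (opp (Phi (x, y)))). symmetry; apply (norm_opp (V := X)).
f_equal. transitivity (minus (zero : X) (Phi (x, y))).
- symmetry. apply (plus_zero_l (G := X)).
- f_equal. symmetry. exact E.
Qed.

(** The normalized vectors Gamma(gamma + theta) s^(1-gamma-theta) K(s) x lie in the domain and tend
    to x as s decreases to 0. *)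
Lemma generator_dense : densely_defined (generator gamma delta C).
Proof.
intros x eps. pose proof Gamma_gamma_theta_gt_0 as HG.
assert (H : filterlim (fun s => scal (Gamma (gamma + theta)) (scal (/ Rpower s (gamma + theta - 1)) (K s x)))
  (at_right 0) (locally x)).
{ assert (E := scal_inv_cancel (X := X) (Gamma (gamma + theta)) x ltac:(lra)).
  refine (eq_ind _ (fun z : X => filterlim (fun s => scal (Gamma (gamma + theta))
    (scal (/ Rpower s (gamma + theta - 1)) (K s x))) _ (locally z)) _ _ E). 
  exact (filterlim_comp _ _ _ _ (fun v : X => scal (Gamma (gamma + theta)) v) _ _ _ (K_limit x)
    (is_linear_continuous (X := X) (Y := X) _ _ (is_linear_scal (X := X) (Gamma (gamma + theta))))). }
destruct (proj1 (filterlim_locally _ x) H eps) as [d Hd].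
assert (Hd2 : 0 < d / 2) by (destruct d as [d Hdp]; simpl; lra).
assert (Hb : ball 0 d (d / 2)).
{ change (Rabs (d / 2 - 0) < d). rewrite Rminus_0_r, Rabs_pos_eq; lra. }
specialize (Hd (d / 2) Hb Hd2).
eexists. split; [|exact Hd].
destruct generator_linear as [_ [_ Hs]].
apply Hs. apply Hs. apply (generates_generator _ _ (generates_K x _ Hd2)).
Qed.

End Generator.

(** * Continuous differentiability of Riemann-Liouville integrals *)

Lemma continuous_tpow_pos (a x : R) : 0 < x -> continuous (tpow a) x.
Proof.
intros Hx. apply (ex_derive_continuous (V := R_NormedModule)). eexists. now apply is_derive_tpow_pos.
Qed.

Lemma continuous_sub_l (t s : R) : continuous (fun s => t - s) s.
Proof. apply (continuous_minus (fun _ => t) (fun r : R => r)). apply continuous_const. apply continuous_id. Qed.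

Lemma continuous_sub_r (t s : R) : continuous (fun s => s - t) s.
Proof. apply (continuous_minus (fun r : R => r) (fun _ => t)). apply continuous_id. apply continuous_const. Qed.

Lemma RInt_kernel (alpha a b t : R) : 1 < alpha -> t <= b ->
  RInt (fun s => tpow (alpha - 1) (t - s)) a b = tpow alpha (t - a) / alpha.
Proof.
intros Hal Ht. apply is_RInt_unique.
replace (tpow alpha (t - a) / alpha) with (minus (- / alpha * tpow alpha (t - b)) (- / alpha * tpow alpha (t - a))).
- apply (is_RInt_derive (fun s => - / alpha * tpow alpha (t - s))).
  + intros s _.
    assert (H := is_derive_comp (V := R_NormedModule) (tpow alpha) (fun s => t - s) s _ (-1)
      (is_derive_tpow alpha (t - s) Hal) ltac:(auto_derive; trivial; ring)).
    apply (is_derive_scal _ _ (- / alpha)) in H.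
    refine (eq_ind _ (is_derive _ s) H _ _).
    change (- / alpha * (-1 * (alpha * tpow (alpha - 1) (t - s))) = tpow (alpha - 1) (t - s)). field. lra.
  + intros s _. apply (continuous_comp (fun s => t - s) (tpow (alpha - 1))). apply continuous_sub_l.
    apply continuous_tpow. lra.
- change (- / alpha * tpow alpha (t - b) - - / alpha * tpow alpha (t - a) = tpow alpha (t - a) / alpha).
  rewrite (tpow_npos alpha (t - b)) by lra. field. lra.
Qed.

Lemma continuous_shifted {X : UniformSpace} (m : R) (f : R -> X) (t v : R) :
  0 < m -> (forall s, continuous f s) -> jointly_continuous (fun t v => f (t - tpow m v)) t v.
Proof.
intros Hm Hf. apply (jointly_continuous_comp (fun t v => t - tpow m v) f); trivial.
apply (jointly_continuous_minus (fun t _ => t) (fun _ v => tpow m v)).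
apply (jointly_continuous_fst (fun t => t)), continuous_id.
apply (jointly_continuous_snd (tpow m)). now apply continuous_tpow.
Qed.

(* The substitution [t - s = v^m] followed by an integration by parts moves the singularity of
   the derivative of the kernel out of the way. *)
Lemma RInt_kernel_by_parts {X : CompleteNormedModule R_AbsRing} (alpha a b t : R) (f : R -> X) :
  1 < alpha < 2 -> (forall s, continuous f s) -> (forall s, s <= a -> f s = zero) ->
  0 < a -> a <= t <= b ->
  RInt (fun s => scal (tpow (alpha - 1) (t - s)) (f s)) a b =
  RInt (fun v => RInt f a (t - tpow (/ (alpha - 1)) v)) 0 (tpow (alpha - 1) b).
Proof.
intros Hal Hf Hfa Ha Ht. set (m := / (alpha - 1)). set (V := tpow (alpha - 1) b).
assert (Hm : 1 < m).
{ unfold m. rewrite <- Rinv_1 at 1. apply Rinv_lt_contravar; lra. }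
assert (HmV : tpow m V = b) by (apply tpow_inv_l; lra).
assert (HV : 0 <= V) by apply tpow_ge_0.
set (g := fun s => scal (tpow (alpha - 1) (t - s)) (f s)).
assert (Hg : forall s, continuous g s).
{ intros s. apply (continuous_conv_kernel (X := X)); trivial. lra. }
assert (HP0 : forall s, s <= a -> RInt f a s = zero).
{ intros s Hs. apply RInt_zero. intros r Hr. rewrite Rmin_right, Rmax_left in Hr by trivial. apply Hfa. lra. }
(* Below [a] the function vanishes and above [t] the kernel does. Ending the range at t - b makes v
   run over [0, V], independently of t. *)
assert (E1 : RInt g a b = opp (RInt g t (t - b))).
{ transitivity (RInt g a t).
  - rewrite <- (RInt_Chasles g a t b) by now apply ex_RInt_cont.
    rewrite (RInt_zero g t b). apply (plus_zero_r (G := X)).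
    intros s Hs. rewrite Rmin_left in Hs by lra. unfold g. rewrite tpow_npos by lra. exact (scal_zero_l (V := X) _).
  - rewrite <- (RInt_Chasles g t a (t - b)) by now apply ex_RInt_cont.
    rewrite (RInt_zero g a (t - b)).
    + transitivity (opp (RInt g t a)). symmetry. apply opp_RInt_swap. now apply ex_RInt_cont.
      f_equal. symmetry. apply (plus_zero_r (G := X)).
    + intros s Hs. rewrite Rmin_right, Rmax_left in Hs by lra. unfold g. rewrite Hfa by lra.
      exact (scal_zero_r (V := X) _). }
set (dg := fun v => - (m * tpow (m - 1) v)).
assert (Hdg : forall v, is_derive (fun v => t - tpow m v) v (dg v)).
{ intros v. unfold dg. assert (H := is_derive_tpow m v Hm).
  apply (is_derive_opp (V := R_NormedModule)) in H.
  apply (is_derive_ext (fun v => - tpow m v + t)). intros; simpl; ring.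
  refine (eq_ind _ (is_derive _ v) (is_derive_plus (V := R_NormedModule) _ (fun _ => t) v _ _ H
    (is_derive_const (V := R_NormedModule) t v)) _ _). apply (plus_zero_r (G := R_AbelianGroup)). }
assert (Hdgc : forall v, continuous dg v).
{ intros v. apply (continuous_opp (V := R_NormedModule) (fun v => m * tpow (m - 1) v)).
  apply (continuous_scal_r (V := R_NormedModule) m (tpow (m - 1))). apply continuous_tpow. lra. }
assert (E2 := RInt_comp g (fun v => t - tpow m v) dg 0 V ltac:(intros; apply Hg) ltac:(intros; split; auto)).
cbv beta in E2. rewrite HmV, (tpow_npos m 0), Rminus_0_r in E2 by lra.
set (q := fun v => RInt f a (t - tpow m v)).
set (dq := fun v => scal (dg v) (f (t - tpow m v))).
assert (Hq : forall v, is_derive q v (dq v)).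
{ intros v. apply (is_derive_comp (V := X) (fun s => RInt f a s) (fun v => t - tpow m v)); trivial.
  now apply is_derive_RInt_cont. }
assert (Hdq : forall v, continuous dq v).
{ intros v. apply (continuous_scal (V := X) dg (fun v => f (t - tpow m v))); trivial.
  apply (continuous_comp (fun v => t - tpow m v) f); trivial.
  apply (continuous_minus (fun _ => t) (tpow m)). apply continuous_const. apply continuous_tpow; lra. }
assert (HI : is_RInt (fun v => scal v (dq v)) 0 V (RInt g t (t - b))).
{ rewrite <- E2. apply (is_RInt_ext (fun v => scal (dg v) (g (t - tpow m v)))).
  - intros v Hv. rewrite Rmin_left in Hv by trivial. unfold g, dq.
    replace (t - (t - tpow m v)) with (tpow m v) by ring.
    unfold m at 2. rewrite tpow_inv_r by lra. rewrite !(scal_scal (X := X)). f_equal. ring.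
  - apply RInt_correct, ex_RInt_cont. intros v.
    apply (continuous_scal (V := X) dg (fun v => g (t - tpow m v))); trivial.
    apply (continuous_comp (fun v => t - tpow m v) g); trivial.
    apply (continuous_minus (fun _ => t) (tpow m)). apply continuous_const. apply continuous_tpow; lra. }
assert (H := is_RInt_scal_derive_l (fun v => v) q (fun _ => 1) dq 0 V _
  ltac:(intros; apply (is_derive_id (K := R_AbsRing))) ltac:(intros; apply Hq)
  ltac:(intros; apply continuous_const) ltac:(intros; apply Hdq) HI).
apply is_RInt_unique in H. fold g. rewrite E1.
transitivity (RInt (fun v => scal 1 (q v)) 0 V).
2:{ apply RInt_ext. intros v _. exact (scal_one (V := X) (q v)). }
refine (eq_trans _ (eq_sym H)).
(* Both boundary terms vanish: at V because t - b <= 0 < a, at 0 because of the factor v. *)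
assert (EqV : q V = zero). { unfold q. rewrite HmV. apply HP0. lra. }
transitivity (minus (minus (zero : X) zero) (RInt g t (t - b))).
- symmetry. transitivity (plus (zero : X) (opp (RInt g t (t - b)))).
  + refine (f_equal (fun u => plus u _) (minus_eq_zero (G := X) zero)).
  + apply (plus_zero_l (G := X)).
- refine (f_equal (fun u => minus u (RInt g t (t - b))) _).
  transitivity (minus (scal V (zero : X)) (scal 0 (q 0))).
  + f_equal; symmetry. exact (scal_zero_r (V := X) V). exact (scal_zero_l (V := X) (q 0)).
  + do 2 f_equal. now symmetry.
Qed.

(** Freezing [f] below [a] and subtracting f(a) gives a continuous function on R that vanishes left
    of [a], as [RInt_kernel_by_parts] demands. *)
Lemma continuous_tail {X : NormedModule R_AbsRing} (f : R -> X) (a s : R) :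
  (forall t, 0 < t -> continuous f t) -> 0 < a -> continuous (fun s => minus (f (Rmax s a)) (f a)) s.
Proof.
intros Hf Ha. apply (continuous_minus (V := X) (fun s => f (Rmax s a)) (fun _ => f a)).
2: apply continuous_const.
apply (continuous_comp (fun s => Rmax s a) f).
- apply (continuous_ext (fun s => (s + a + Rabs (s - a)) / 2)).
  { intros x. unfold Rmax, Rabs. destruct (Rle_dec x a), (Rcase_abs (x - a)); lra. }
  apply (continuous_mult (fun s => s + a + Rabs (s - a)) (fun _ => / 2)). 2: apply continuous_const.
  apply (continuous_plus (V := R_NormedModule) (fun s => s + a) (fun s => Rabs (s - a))).
  + apply (continuous_plus (V := R_NormedModule) (fun s => s) (fun _ => a)).
    apply continuous_id. apply continuous_const.
  + apply (continuous_comp (fun s => s - a) Rabs). apply continuous_sub_r. apply continuous_Rabs.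
- apply Hf. eapply Rlt_le_trans; [exact Ha|apply Rmax_r].
Qed.

(** On (0, a) the kernel is smooth in t, since s stays below t; on (a, t) the function is continuous
    and is treated by parts after subtraction of f(a); the constant f(a) is integrated explicitly.
    All outer limits are independent of t. *)
Lemma J_split {X : CompleteNormedModule R_AbsRing} (theta alpha a b t : R) (f : R -> X) (l : X) :
  0 < theta -> 1 < alpha < 2 -> regular theta f l -> 0 < a -> a <= t <= b ->
  J alpha f t = scal (/ Gamma alpha)
    (plus (RInt (fun r => scal (tpow (alpha - 1) (t - tpow (/ theta) r)) (desing theta f l r)) 0 (tpow theta a))
      (plus (RInt (fun v => RInt (fun s => minus (f (Rmax s a)) (f a)) a (t - tpow (/ (alpha - 1)) v))
               0 (tpow (alpha - 1) b))
            (scal (tpow alpha (t - a) / alpha) (f a)))).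
Proof.
intros Hth Hal Hf Ha Ht.
assert (Hthi : 0 < / theta) by now apply Rinv_0_lt_compat.
rewrite (J_desing theta alpha f l t (tpow theta b)); trivial; try lra.
2: apply tpow_le; lra.
f_equal.
match goal with |- RInt ?h _ _ = _ => set (k := h) end.
assert (Hk : forall r, continuous k r) by (intros; apply (continuous_J_integrand (X := X)); trivial; lra).
rewrite <- (RInt_Chasles k 0 (tpow theta a) (tpow theta b)) by now apply ex_RInt_cont.
f_equal.
assert (HI := is_RInt_desing theta f l (fun s => tpow (alpha - 1) (t - s)) a b Hth Hf
  ltac:(intros x; apply (continuous_comp (fun s => t - s) (tpow (alpha - 1)));
        [apply continuous_sub_l|apply continuous_tpow; lra]) Ha ltac:(lra)).
apply is_RInt_unique in HI. refine (eq_trans (eq_sym HI) _). clear HI.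
set (fb := fun s => minus (f (Rmax s a)) (f a)).
assert (Hfb : forall s, continuous fb s).
{ intros s. apply (continuous_tail (X := X)); trivial. apply Hf. }
rewrite <- (RInt_kernel_by_parts alpha a b t fb); trivial.
2:{ intros s Hs. unfold fb. rewrite Rmax_right by trivial. apply (minus_eq_zero (G := X)). }
rewrite <- (RInt_kernel alpha a b t) by lra.
assert (Hc : forall s, continuous (fun s => tpow (alpha - 1) (t - s)) s).
{ intros s. apply (continuous_comp (fun s => t - s) (tpow (alpha - 1))). apply continuous_sub_l. apply continuous_tpow; lra. }
rewrite <- RInt_scal_l by trivial.
rewrite <- (RInt_plus (V := X)).
- apply RInt_ext. intros s Hs. rewrite Rmin_left in Hs by lra. unfold fb. rewrite Rmax_left by lra.
  refine (eq_trans _ (scal_distr_l (V := X) _ _ _)). f_equal.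
  transitivity (plus (f s) (zero : X)). symmetry; apply (plus_zero_r (G := X)).
  refine (eq_trans _ (plus_assoc (G := X) _ _ _)). f_equal. symmetry. apply (plus_opp_l (G := X)).
- apply ex_RInt_cont. intros s. apply (continuous_conv_kernel (X := X)); trivial. lra.
- apply ex_RInt_cont. intros s. apply (continuous_scal_l (V := X) (fun s => tpow (alpha - 1) (t - s)) (f a)). apply Hc.
Qed.

Lemma J_C1_pos {X : CompleteNormedModule R_AbsRing} (theta alpha : R) (f : R -> X) (l : X) :
  0 < theta -> 1 < alpha < 2 -> regular theta f l -> C1_pos (J alpha f).
Proof.
intros Hth Hal Hf. apply C1_pos_local. intros t0 Ht0.
assert (Hthi : 0 < / theta) by now apply Rinv_0_lt_compat.
(* The cuts depend on t0 only and stay valid within t0 / 2 of it: t0 / 4 for the point, t0 / 4 for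
   its neighbourhood. *)
set (a := t0 / 2). set (b := 2 * t0). set (m := / (alpha - 1)).
assert (Hm : 1 < m). { unfold m. rewrite <- Rinv_1 at 1. apply Rinv_lt_contravar; lra. }
set (F := desing theta f l). assert (HF : forall r, continuous F r) by now apply continuous_desing.
set (fb := fun s => minus (f (Rmax s a)) (f a)).
assert (Ha : 0 < a) by (unfold a; lra).
assert (Hfb : forall s, continuous fb s) by (intros; apply (continuous_tail (X := X)); trivial; apply Hf).
set (r0 := tpow theta a). set (V := tpow (alpha - 1) b).
(* Left of the cut the argument of the kernel stays positive, so the exponent alpha - 2 < 0 of its
   derivative does no harm. *)
assert (Hr0 : forall r t, 0 <= r <= r0 -> a < t -> 0 < t - tpow (/ theta) r).
{ intros r t Hr Ht. enough (tpow (/ theta) r <= a) by lra.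
  rewrite <- (tpow_inv_l theta a) by lra. apply tpow_le; fold r0; lra. }
set (q1 := fun t r => scal (tpow (alpha - 1) (t - tpow (/ theta) r)) (F r)).
set (dq1 := fun t r => scal ((alpha - 1) * tpow (alpha - 1 - 1) (t - tpow (/ theta) r)) (F r)).
set (q2 := fun t v => RInt fb a (t - tpow m v)).
set (dq2 := fun t v => fb (t - tpow m v)).
assert (Hj1 : forall t r, 0 <= r <= r0 -> a < t -> jointly_continuous dq1 t r).
{ intros t r Hr Ht.
  apply (jointly_continuous_scal (X := X) (fun t r => (alpha - 1) * tpow (alpha - 1 - 1) (t - tpow (/ theta) r)) (fun _ r => F r)).
  2: now apply (jointly_continuous_snd F).
  apply (jointly_continuous_scal (X := R_NormedModule) (fun _ _ => alpha - 1)
    (fun t r => tpow (alpha - 1 - 1) (t - tpow (/ theta) r))). apply continuous_const.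
  apply (jointly_continuous_comp (fun t r => t - tpow (/ theta) r)).
  2: now apply continuous_tpow_pos, Hr0.
  apply (jointly_continuous_minus (fun t _ => t) (fun _ v => tpow (/ theta) v)).
  apply (jointly_continuous_fst (fun t => t)), continuous_id.
  apply (jointly_continuous_snd (tpow (/ theta))). now apply continuous_tpow. }
assert (Hj2 : forall t v, jointly_continuous dq2 t v).
{ intros t v. apply (continuous_shifted (X := X)); trivial. lra. }
(* Term by term derivative of [J_split]; in the middle term t occurs only in the limit of the inner
   integral, so its derivative is [fb] at that limit, without any kernel. *)
set (D := fun t => scal (/ Gamma alpha) (plus (RInt (dq1 t) 0 r0)
  (plus (RInt (dq2 t) 0 V) (scal (tpow (alpha - 1) (t - a)) (f a))))).
assert (HP : forall s, continuous (fun s => RInt fb a s) s) by (intros; now apply continuous_RInt_end).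
exists D. split.
- exists (mkposreal (t0 / 4) ltac:(lra)). intros t Ht. change (Rabs (t - t0) < t0 / 4) in Ht.
  apply Rabs_lt_between in Ht.
  assert (Hat : a < t) by (unfold a; lra).
  apply is_derive_ext_loc with (fun t => scal (/ Gamma alpha) (plus (RInt (q1 t) 0 r0)
    (plus (RInt (q2 t) 0 V) (scal (tpow alpha (t - a) / alpha) (f a))))).
  + exists (mkposreal (t0 / 4) ltac:(lra)). intros y Hy. change (Rabs (y - t) < t0 / 4) in Hy.
    apply Rabs_lt_between in Hy. symmetry. apply (J_split theta alpha a b y f l); trivial.
    unfold a, b; lra.
  + apply (is_linear_is_derive (X := X) (Y := X) (fun x => scal (/ Gamma alpha) x)).
    { apply (is_linear_scal (X := X)). }
    apply (is_derive_plus (V := X)); [|apply (is_derive_plus (V := X))].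
    * apply (is_derive_RInt_param_vec q1 dq1). apply tpow_ge_0.
      -- generalize (open_gt a t Hat). apply filter_imp. intros y Hy r Hr. split.
         ++ apply (is_derive_scal_l (V := X) (fun y => tpow (alpha - 1) (y - tpow (/ theta) r)) y
              ((alpha - 1) * tpow (alpha - 1 - 1) (y - tpow (/ theta) r)) (F r)).
            rewrite <- (Rmult_1_l ((alpha - 1) * _)).
            apply (is_derive_comp (V := R_NormedModule) (tpow (alpha - 1)) (fun y => y - tpow (/ theta) r)).
            now apply is_derive_tpow_pos, Hr0. apply is_derive_minus_const.
         ++ apply (jointly_continuous_1 dq1). now apply Hj1.
      -- intros r Hr. now apply Hj1.
      -- apply filter_forall. intros y. apply ex_RInt_cont. intros r.
         apply (continuous_J_integrand (X := X)); trivial. lra.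
    * apply (is_derive_RInt_param_vec q2 dq2). apply tpow_ge_0.
      -- apply filter_forall. intros y v _. split.
         ++ unfold q2, dq2. rewrite <- (scal_one (V := X) (fb (y - tpow m v))).
            apply (is_derive_comp (V := X) (fun s => RInt fb a s) (fun y => y - tpow m v) y (fb (y - tpow m v)) 1).
            now apply is_derive_RInt_cont. apply is_derive_minus_const.
         ++ now apply (jointly_continuous_1 dq2).
      -- trivial.
      -- apply filter_forall. intros y. apply ex_RInt_cont. intros v.
         apply (jointly_continuous_2 q2). apply (continuous_shifted (X := X) m (fun s => RInt fb a s)); trivial. lra.
    * apply (is_derive_scal_l (V := X) (fun t => tpow alpha (t - a) / alpha)).
      assert (H := is_derive_comp (V := R_NormedModule) (tpow alpha) (fun s => s - a) t _ 1
        (is_derive_tpow alpha (t - a) ltac:(lra)) (is_derive_minus_const t a)).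
      apply (is_derive_scal _ _ (/ alpha)) in H.
      apply (is_derive_ext (fun x => / alpha * tpow alpha (x - a))).
      { intros x. apply Rmult_comm. }
      refine (eq_ind _ (is_derive _ t) H _ _).
      change (/ alpha * (1 * (alpha * tpow (alpha - 1) (t - a))) = tpow (alpha - 1) (t - a)). field. lra.
- apply (continuous_scal_r (V := X) (/ Gamma alpha)).
  assert (Hat : a < t0) by (unfold a; lra).
  apply (continuous_plus (V := X)); [|apply (continuous_plus (V := X))].
  + apply (continuous_RInt_param dq1). apply tpow_ge_0. intros r Hr. now apply Hj1.
    generalize (open_gt a t0 Hat). apply filter_imp. intros y Hy.
    apply ex_RInt_continuous. intros r Hr. rewrite Rmin_left, Rmax_right in Hr by apply tpow_ge_0.
    apply (jointly_continuous_2 dq1). now apply Hj1.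
  + apply (continuous_RInt_param_global dq2); trivial. apply tpow_ge_0.
  + apply (continuous_scal_l (V := X) (fun t => tpow (alpha - 1) (t - a)) (f a)).
    apply (continuous_comp (fun t => t - a) (tpow (alpha - 1))). apply continuous_sub_r.
    apply continuous_tpow. lra.
Qed.

(** * Uniqueness *)

Lemma RInt_reflect {X : CompleteNormedModule R_AbsRing} (f : R -> X) (T : R) :
  (forall t, continuous f t) -> RInt (fun t => f (T - t)) 0 T = RInt f 0 T.
Proof.
intros Hf.
assert (E := RInt_comp_lin f (-1) T 0 T (ex_RInt_cont f _ _ Hf)).
replace (-1 * 0 + T) with T in E by ring. replace (-1 * T + T) with 0 in E by ring.
assert (Hc : forall t, continuous (fun t => f (T - t)) t).
{ intros t. apply (continuous_comp (fun t => T - t) f); trivial. apply continuous_sub_l. }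
rewrite (RInt_ext _ (fun t => scal (-1) (f (T - t)))) in E.
2:{ intros t _. do 2 f_equal. ring. }
rewrite RInt_scal in E by now apply ex_RInt_cont.
apply (f_equal (fun x : X => scal (-1) x)) in E.
rewrite (scal_scal (X := X)) in E. replace (-1 * -1) with 1 in E by ring.
transitivity (scal 1 (RInt (fun t => f (T - t)) 0 T)). { symmetry. exact (scal_one (V := X) _). }
refine (eq_trans E _). transitivity (opp (RInt f T 0)). { exact (scal_opp_one (V := X) _). }
apply opp_RInt_swap. now apply ex_RInt_cont.
Qed.

Lemma jointly_continuous_diagonal {X : NormedModule R_AbsRing} (a T : R) (U : R -> R -> X) (t s : R) :
  0 < a -> (forall r s, jointly_continuous U r s) ->
  jointly_continuous (fun t s => scal (tpow a (t - s)) (U (T - t) s)) t s.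
Proof.
intros Ha HU. apply (jointly_continuous_scal (X := X) (fun t s => tpow a (t - s)) (fun t s => U (T - t) s)).
- apply (jointly_continuous_comp (fun t s => t - s) (tpow a)); [|now apply continuous_tpow].
  apply (jointly_continuous_minus (fun t _ => t) (fun _ s => s)).
  apply (jointly_continuous_fst (fun t => t)), continuous_id.
  apply (jointly_continuous_snd (fun t => t)), continuous_id.
- refine (continuous_comp_2 (fun p : R * R => T - fst p) (fun p => snd p) U (t, s) _ _ (HU (T - t) s)).
  + apply (jointly_continuous_fst (fun t => T - t)). apply continuous_sub_l.
  + apply continuous_snd.
Qed.

Lemma minus_minus_r {G : AbelianGroup} (a b c : G) : minus (minus a c) (minus b c) = minus a b.
Proof. rewrite <- (minus_plus_cancel a c b), <- (opp_minus b c). reflexivity. Qed.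

Lemma minus_of_minus {G : AbelianGroup} (a b c : G) : a = minus b c -> minus b a = c.
Proof.
intros ->. rewrite !minusE, opp_plus, opp_opp, plus_assoc, plus_opp_r. apply plus_zero_l.
Qed.

(* Both sides integrate [tpow a (T - r - s) U(r, s)] over the square. *)
Lemma RInt_conv_diagonal {X : CompleteNormedModule R_AbsRing} (a T : R) (U : R -> R -> X) :
  0 < a -> 0 <= T -> (forall r s, jointly_continuous U r s) ->
  RInt (fun t => RInt (fun s => scal (tpow a (t - s)) (U (T - t) s)) 0 T) 0 T =
  RInt (fun t => RInt (fun r => scal (tpow a (T - t - r)) (U r t)) 0 T) 0 T.
Proof.
intros Ha HT HU.
assert (Hj := fun t s => jointly_continuous_diagonal (X := X) a T U t s Ha HU).
rewrite Fubini by trivial.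
apply RInt_ext. intros s _.
rewrite <- (RInt_reflect (fun t => scal (tpow a (t - s)) (U (T - t) s))).
- apply RInt_ext. intros r _. replace (T - (T - r)) with r by ring.
  now replace (T - r - s) with (T - s - r) by ring.
- intros t. exact (jointly_continuous_1 _ t s (Hj t s)).
Qed.

Lemma J_conv {X : CompleteNormedModule R_AbsRing} (alpha t : R) (f : R -> X) :
  1 < alpha -> (forall t, continuous f t) -> 0 < t ->
  J alpha f t = scal (/ Gamma alpha) (conv (alpha - 1) f t).
Proof. intros Hal Hf Ht. apply J_continuous; trivial. lra. Qed.

Section Uniqueness.

Context {X : CompleteNormedModule R_AbsRing}.
Variables (gamma delta : R) (C : R -> X -> X).
Hypotheses (Hga : 1 < gamma < 2) (Hde : 0 <= delta <= 1) (HC : general_fractional_cosine gamma delta C).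

Let theta : R := gamma + delta * (2 - gamma) - 1.
Let w : R -> R := cos_weight gamma delta.
Let K (t : R) (x : X) : X := J gamma (fun r => C r x) t.
Let K0 (t : R) (x : X) : X := J0 gamma (fun r => C r x) t.

Let Hth : 0 < theta := theta_pos gamma delta Hga Hde.
Let Hga1 : 1 < gamma := proj1 Hga.

(** Strong continuity in time together with a local bound on the operator norms gives joint
    continuity along a continuous [y]. *)
Lemma continuous_K0_2 (y : R -> X) (a b : R) : (forall t, continuous y t) ->
  jointly_continuous (fun a b => K0 a (y b)) a b.
Proof.
intros Hy.
(* One bound for all times up to a + 1; the radius below is at most 1 for this reason. *)
destruct (K_bound gamma delta C Hga Hde HC (Rmax 0 (a + 1))) as [M [HM HMx]].
assert (HK0 : forall t x x', t <= a + 1 -> norm (minus (K0 t x) (K0 t x')) <= M * norm (minus x x')).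
{ intros t x x' Ht. unfold K0. destruct (Rle_dec t 0) as [H0|H0].
  - rewrite !J0_npos by trivial. eapply Rle_trans.
    { right. refine (eq_trans _ (norm_zero (V := X))). f_equal. apply (minus_eq_zero (G := X)). }
    apply Rmult_le_pos; [lra|apply (norm_ge_0 (V := X))].
  - rewrite !J0_pos by lra.
    refine (Rle_trans _ _ _ (Req_le _ _ _) (HMx t (minus x x') _)).
    + f_equal. symmetry. apply (K_minus gamma delta C Hga Hde HC). lra.
    + split; [lra|]. eapply Rle_trans; [exact Ht|apply Rmax_r]. }
refine (proj2 (continuous_normP (X := X) (fun p : R * R => K0 (fst p) (y (snd p))) (a, b)) _).
intros eps. simpl.
assert (He : 0 < eps / 2) by (destruct eps as [e He]; simpl; lra).
assert (HeM : 0 < eps / (2 * M)) by (apply Rdiv_lt_0_compat; [apply cond_pos|lra]).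
assert (Hc : continuous (fun t => K0 t (y b)) a).
{ apply (continuous_J0 theta gamma Hth Hga1 _ (scal (/ Gamma theta) (y b))).
  apply (regular_cosine gamma delta C HC). }
destruct (proj1 (continuous_normP (U := R_UniformSpace) (X := X) _ _) Hc (mkposreal _ He)) as [d1 Hd1].
destruct (proj1 (continuous_normP (U := R_UniformSpace) (X := X) _ _) (Hy b) (mkposreal _ HeM)) as [d2 Hd2].
simpl in Hd1, Hd2.
assert (Hd : 0 < Rmin 1 (Rmin d1 d2)).
{ repeat apply Rmin_glb_lt; try apply cond_pos. lra. }
exists (mkposreal _ Hd). intros [a' b'] [Ha Hb]. simpl in *.
change (Rabs (a' - a) < Rmin 1 (Rmin d1 d2)) in Ha. change (Rabs (b' - b) < Rmin 1 (Rmin d1 d2)) in Hb.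
pose proof (Rmin_l 1 (Rmin d1 d2)). pose proof (Rmin_r 1 (Rmin d1 d2)).
pose proof (Rmin_l d1 d2). pose proof (Rmin_r d1 d2).
assert (Ha1 : a' <= a + 1).
{ assert (Ha2 : Rabs (a' - a) < 1) by lra. apply Rabs_lt_between in Ha2. lra. }
specialize (Hd1 a' ltac:(change (Rabs (a' - a) < d1); lra)).
specialize (Hd2 b' ltac:(change (Rabs (b' - b) < d2); lra)).
assert (E1 := HK0 a' (y b') (y b) Ha1).
eapply Rle_lt_trans. { apply (norm_minus_triangle (X := X) _ (K0 a' (y b))). }
assert (E2 : M * norm (minus (y b') (y b)) < eps / 2).
{ replace (eps / 2) with (M * (eps / (2 * M))) by (field; lra). now apply Rmult_lt_compat_l. }
apply Rlt_le_trans with (eps / 2 + eps / 2); [|lra].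
apply Rplus_lt_compat; trivial. eapply Rle_lt_trans; [exact E1|exact E2].
Qed.

Section Homogeneous.

Variables (z : R -> X) (l : X).
Hypotheses (Hz : regular theta z l)
  (Hgen : forall t, 0 < t -> generates gamma delta C (J gamma z t) (z t)).

Let y : R -> X := J0 gamma z.
Let Y : R -> X := J gamma y.

Lemma continuous_primitive (t : R) : continuous y t.
Proof. exact (continuous_J0 theta gamma Hth Hga1 z l t Hz). Qed.

Lemma J_cos_weight (s : R) (x : X) : 0 < s ->
  J gamma (fun r => scal (w r) x) s = scal (/ Gamma (gamma + theta) * tpow (gamma + theta - 1) s) x.
Proof.
intros Hs.
pose proof (Gamma_theta_gt_0 gamma delta Hga Hde) as H1. fold theta in H1.
pose proof (Gamma_gamma_theta_gt_0 gamma delta Hga Hde) as H2. fold theta in H2.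
rewrite <- (J_ext_pos theta gamma Hth Hga1 (fun t => scal (/ Gamma theta * Rpower t (theta - 1)) x) _
  (scal (/ Gamma theta) x)); trivial.
- rewrite J_Rpower by trivial. rewrite tpow_pos by trivial. f_equal. field. lra.
- intros r Hr. unfold w. now rewrite cos_weight_Rpower.
- apply (regular_Rpower (X := X)).
Qed.

Lemma regular_cos_weight (x : X) : regular theta (fun r => scal (w r) x) (scal (/ Gamma theta) x).
Proof.
apply (regular_ext (X := X) theta (fun t => scal (/ Gamma theta * Rpower t (theta - 1)) x)).
- intros r Hr. unfold w. now rewrite cos_weight_Rpower.
- apply (regular_Rpower (X := X)).
Qed.

(** Only the family [C] enters: [z] is any regular solution of the homogeneous equation z = A J z,
    and need not be built from a second cosine function. *)
Lemma K_homogeneous (s t : R) : 0 < s -> 0 < t ->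
  K s (z t) = minus (C s (y t)) (scal (w s) (y t)).
Proof.
intros Hs Ht. apply (K_generates gamma delta C Hga Hde HC (y t) (z t) s Hs).
unfold y. rewrite J0_pos by trivial. now apply Hgen.
Qed.

(** [J] in t is applied to [K_homogeneous]; the bounded operators K(s), C(s) and the scalar w(s)
    pass through it. *)
Lemma K_homogeneous_integrated (s t : R) : 0 < s -> 0 < t ->
  K s (y t) = minus (C s (Y t)) (scal (w s) (Y t)).
Proof.
intros Hs Ht.
assert (Hy := regular_continuous (X := X) y continuous_primitive).
assert (HCs := gfc_bounded_linear HC Hs).
assert (Hsc := is_linear_scal (X := X) (w s)).
assert (HKs := K_is_linear gamma delta C Hga Hde HC s Hs).
transitivity (J gamma (fun t => K s (z t)) t).
- unfold y. rewrite J0_pos by trivial. symmetry.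
  exact (J_linear theta gamma Hth Hga1 (K s) z l t HKs Hz Ht).
- rewrite (J_ext_pos theta gamma Hth Hga1 (fun t => K s (z t)) (fun t => minus (C s (y t)) (scal (w s) (y t)))
    (K s l) t); trivial.
  + rewrite (J_minus 1 gamma Rlt_0_1 Hga1 (fun t => C s (y t)) (fun t => scal (w s) (y t))
      (C s (y 0)) (scal (w s) (y 0))); trivial.
    * rewrite (J_linear 1 gamma Rlt_0_1 Hga1 (C s) y (y 0)) by trivial.
      now rewrite (J_linear 1 gamma Rlt_0_1 Hga1 (fun x => scal (w s) x) y (y 0)) by trivial.
    * now apply (regular_linear (X := X) (Y := X)).
    * now apply (regular_linear (X := X) (Y := X) (fun x => scal (w s) x)).
  + intros r Hr. now apply K_homogeneous.
  + now apply (regular_linear (X := X) (Y := X) (K s)).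
Qed.

(** Apply [J] in s to the integrated identity: C(r) Y(t) gives K(s) Y(t), which is the [J] in t of
    K(s) y, and the weight gives a power with constant 1 / Gamma(gamma + theta). *)
Lemma K_two_times (s t : R) : 0 < s -> 0 < t ->
  J gamma (fun r => K0 r (y t)) s =
  minus (J gamma (fun r => K0 s (y r)) t) (scal (/ Gamma (gamma + theta) * tpow (gamma + theta - 1) s) (Y t)).
Proof.
intros Hs Ht.
assert (HKs := K_is_linear gamma delta C Hga Hde HC s Hs).
assert (E1 : J gamma (fun r => K0 s (y r)) t = K s (Y t)).
{ unfold K0. rewrite (J_ext_pos 1 gamma Rlt_0_1 Hga1 _ (fun r => K s (y r)) (K0 s (y 0))); trivial.
  - apply (J_linear 1 gamma Rlt_0_1 Hga1 (K s) y (y 0)); trivial.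
    apply (regular_continuous (X := X) y continuous_primitive).
  - intros r Hr. exact (J0_pos gamma (fun q => C q (y r)) s Hs).
  - apply (regular_continuous (X := X) (fun r => K0 s (y r))). intros r.
    apply (jointly_continuous_2 (fun a b => K0 a (y b))). apply continuous_K0_2, continuous_primitive. }
rewrite E1.
rewrite <- (J_ext_pos theta gamma Hth Hga1 (fun r => minus (C r (Y t)) (scal (w r) (Y t))) _
  (minus (scal (/ Gamma theta) (Y t)) (scal (/ Gamma theta) (Y t)))); trivial.
- rewrite (J_minus theta gamma Hth Hga1 _ _ (scal (/ Gamma theta) (Y t)) (scal (/ Gamma theta) (Y t))); trivial.
  + f_equal. now apply J_cos_weight.
  + apply (regular_cosine gamma delta C HC).
  + apply regular_cos_weight.
- intros r Hr. unfold K0. rewrite J0_pos by trivial. symmetry. now apply K_homogeneous_integrated.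
- apply (regular_minus (X := X)). apply (regular_cosine gamma delta C HC). apply regular_cos_weight.
Qed.

Lemma conv_conv_zero (T : R) : 0 < T -> conv (gamma + theta - 1) (conv (gamma - 1) y) T = zero.
Proof.
intros HT. set (U := fun a b => K0 a (y b)).
assert (HU : forall a b, jointly_continuous U a b) by (intros; apply continuous_K0_2, continuous_primitive).
pose proof (Gamma_gamma_theta_gt_0 gamma delta Hga Hde) as H2. fold theta in H2.
assert (HG : 0 < Gamma gamma) by now apply Gamma_gt_1.
assert (Ha : 0 < gamma - 1) by lra.
set (A1 := fun t => RInt (fun r => scal (tpow (gamma - 1) (T - t - r)) (U r t)) 0 T).
set (A2 := fun t => RInt (fun s => scal (tpow (gamma - 1) (t - s)) (U (T - t) s)) 0 T).
(* On s = T - t the identity is solved for its power term. Both integrals get the common range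
   [0, T], so [RInt_conv_diagonal] applies to [A1] and [A2]. *)
assert (Hpt : forall t, 0 < t < T ->
  scal (tpow (gamma + theta - 1) (T - t)) (conv (gamma - 1) y t) =
  scal (Gamma (gamma + theta)) (minus (A2 t) (A1 t))).
{ intros t Ht.
  assert (E := K_two_times (T - t) t ltac:(lra) ltac:(lra)).
  rewrite (J_continuous gamma (fun r => K0 r (y t)) (T - t) T) in E; try lra.
  2:{ intros r. exact (jointly_continuous_1 U r t (HU r t)). }
  rewrite (J_continuous gamma (fun r => K0 (T - t) (y r)) t T) in E; try lra.
  2:{ intros r. exact (jointly_continuous_2 U (T - t) r (HU (T - t) r)). }
  unfold Y in E. rewrite (J_conv gamma t y Hga1 continuous_primitive) in E by lra.
  fold (U) in E.
  change (scal (/ Gamma gamma) (A1 t) = minus (scal (/ Gamma gamma) (A2 t))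
    (scal (/ Gamma (gamma + theta) * tpow (gamma + theta - 1) (T - t)) (scal (/ Gamma gamma) (conv (gamma - 1) y t)))) in E.
  apply (minus_of_minus (G := X)) in E.
  refine (eq_trans _ (eq_trans (f_equal (fun x : X => scal (Gamma (gamma + theta) * Gamma gamma) x) (eq_sym E)) _)).
  - rewrite !(scal_scal (X := X)). f_equal. field. lra.
  - refine (eq_trans (f_equal _ (eq_sym (scal_minus (X := X) _ _ _))) _).
    rewrite (scal_scal (X := X)). f_equal. field. lra. }
unfold conv at 1. rewrite (RInt_ext _ (fun t => scal (Gamma (gamma + theta)) (minus (A2 t) (A1 t)))).
2:{ intros t Ht. rewrite Rmin_left, Rmax_right in Ht by lra. now apply Hpt. }
assert (HA1 : forall t, continuous A1 t).
{ intros t. apply (continuous_RInt_param_global (fun t r => scal (tpow (gamma - 1) (T - t - r)) (U r t))). lra.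
  intros s r. apply (jointly_continuous_scal (X := X) (fun t r => tpow (gamma - 1) (T - t - r)) (fun t r => U r t)).
  - apply (jointly_continuous_comp (fun t r => T - t - r)); [|apply continuous_tpow; lra].
    apply (jointly_continuous_minus (fun t _ => T - t) (fun _ s => s)).
    apply (jointly_continuous_fst (fun t => T - t)), continuous_sub_l.
    apply (jointly_continuous_snd (fun t => t)), continuous_id.
  - now apply (jointly_continuous_swap U). }
assert (HA2 : forall t, continuous A2 t).
{ intros t. apply (continuous_RInt_param_global (fun t s => scal (tpow (gamma - 1) (t - s)) (U (T - t) s))). lra.
  intros s r. now apply (jointly_continuous_diagonal (X := X)). }
rewrite RInt_scal.
2:{ apply ex_RInt_cont. intros t. now apply (continuous_minus (V := X) A2 A1). }
refine (eq_trans (f_equal (fun v : X => scal (Gamma (gamma + theta)) v) (RInt_minus (V := X) A2 A1 0 T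
  (ex_RInt_cont A2 0 T HA2) (ex_RInt_cont A1 0 T HA1))) _).
refine (eq_trans _ (scal_zero_r (V := X) _)). f_equal.
transitivity (minus (RInt A2 0 T) (RInt A2 0 T)).
- f_equal. symmetry. apply RInt_conv_diagonal; trivial. lra.
- apply (minus_eq_zero (G := X)).
Qed.

(** Two cancellations of a power kernel give y = 0; then z(t) is the generator applied to y(t) = 0,
    hence zero. *)
Lemma homogeneous_zero (t : R) : 0 < t -> z t = zero.
Proof.
intros Ht. pose proof (theta_bounds gamma delta Hga Hde) as Hb. fold theta in Hb.
(* This uses theta <= 1 and puts the exponent in the range of [conv_injective]. *)
assert (Hb2 : gamma + theta - 1 < 2) by lra.
assert (Hy0 : y t = zero).
{ apply (conv_injective (gamma - 1) y); trivial. lra. intros; apply continuous_primitive.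
  intros s Hs. apply (conv_injective (gamma + theta - 1) (conv (gamma - 1) y)); trivial. lra.
  - intros r. apply continuous_conv. lra. intros; apply continuous_primitive.
  - exact conv_conv_zero. }
apply (generates_unique gamma delta C Hga Hde zero).
- rewrite <- Hy0. unfold y. rewrite J0_pos by trivial. now apply Hgen.
- destruct (generator_linear gamma delta C Hga Hde HC) as [H0 [_ Hs]].
  destruct (Hs 0 zero H0) as [H1 H2].
  replace (zero : X) with (app (generator gamma delta C) zero) at 2.
  + now apply generator_generates.
  + transitivity (app (generator gamma delta C) (scal 0 zero)).
    * f_equal. symmetry. exact (scal_zero_l (V := X) _).
    * exact (eq_trans H2 (scal_zero_l (V := X) _)).
Qed.

End Homogeneous.

End Uniqueness.

(** * Assembly of the assertions (a) to (f) *)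

Theorem proposition4 :
  forall (gamma delta : R) (X : CompleteNormedModule R_AbsRing) (C : R -> X -> X),
    1 < gamma < 2 ->
    0 <= delta <= 1 ->
    general_fractional_cosine gamma delta C ->
    let A : operator X := generator gamma delta C in
    (* (a) *)
    (forall (x : X) (t : R), 0 < t -> dom A x ->
       dom A (C t x) /\ C t (app A x) = app A (C t x)) /\
    (* (b) *)
    (forall (x : X) (t : R), 0 < t ->
       dom A (J gamma (fun r : R => C r x) t) /\
       C t x = plus (scal (cos_weight gamma delta t) x)
                    (app A (J gamma (fun r : R => C r x) t))) /\
    (* (c) *)
    (forall (x : X) (t : R), 0 < t -> dom A x ->
       C t x = plus (scal (cos_weight gamma delta t) x)
                    (J gamma (fun r : R => C r (app A x)) t)) /\
    (* (d) *)
    (linear_operator A /\ closed_operator A /\ densely_defined A) /\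
    (* (e) *)
    (forall C' : R -> X -> X,
       general_fractional_cosine gamma delta C' ->
       same_operator (generator gamma delta C') A ->
       forall (t : R) (x : X), 0 < t -> C' t x = C t x) /\
    (* (f) *)
    (forall x : X, dom A x -> C1_pos (fun t : R => C t x)).
Proof.
intros gamma delta X C Hga Hde HC A.
set (theta := gamma + delta * (2 - gamma) - 1).
assert (Hth : 0 < theta) by exact (theta_pos gamma delta Hga Hde).
assert (Hc : forall x t, 0 < t -> dom A x ->
  J gamma (fun r => C r (app A x)) t = minus (C t x) (scal (cos_weight gamma delta t) x)).
{ intros x t Ht Hx. apply (K_generates gamma delta C Hga Hde HC x (app A x) t Ht).
  now apply generator_generates. }
split; [|split; [|split; [|split; [|split]]]].
- intros x t Ht Hx. apply (generator_generates gamma delta C Hga Hde) in Hx.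
  destruct (generates_generator gamma delta C Hga Hde _ _ (generates_cosine gamma delta C HC _ _ t Ht Hx)) as [H1 H2].
  split; [exact H1|symmetry; exact H2].
- intros x t Ht.
  destruct (generates_generator gamma delta C Hga Hde _ _ (generates_K gamma delta C Hga Hde HC x t Ht)) as [H1 H2].
  split; [exact H1|]. apply (minus_plus_eq (G := X)). exact H2.
- intros x t Ht Hx. apply (minus_plus_eq (G := X)). now apply Hc.
- split; [|split].
  + now apply generator_linear.
  + now apply generator_closed.
  + now apply generator_dense.
- intros C' HC' [Hdom Happ] t x Ht. symmetry. apply (minus_eq_zero_eq (X := X)).
  set (z := fun r => minus (C r x) (C' r x)).
  assert (Hz : regular theta z (minus (scal (/ Gamma theta) x) (scal (/ Gamma theta) x))).
  { apply (regular_minus (X := X)); now apply (regular_cosine gamma delta). }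
  apply (homogeneous_zero gamma delta C Hga Hde HC z _ Hz); trivial.
  intros s Hs.
  assert (H1 := generates_K gamma delta C Hga Hde HC x s Hs).
  (* Assertion (b) for [C'] is carried over to [C] by equality of the generators; this is the only
     place where the generator of [C'] is involved. *)
  destruct (generates_generator gamma delta C' Hga Hde _ _ (generates_K gamma delta C' Hga Hde HC' x s Hs)) as [D2 A2].
  rewrite (Happ _ D2) in A2. apply Hdom in D2.
  apply (generator_generates gamma delta C Hga Hde) in D2. unfold A in A2. rewrite A2 in D2.
  assert (H := generates_minus gamma delta C Hga Hde HC _ _ _ _ H1 D2).
  (* Both orbits start from the same x, so the weight terms w(s) x cancel and z = A J z results. *)
  unfold z. rewrite <- (minus_minus_r (G := X) _ _ (scal (cos_weight gamma delta s) x)).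
  rewrite (J_minus theta gamma Hth (proj1 Hga) _ _ (scal (/ Gamma theta) x) (scal (/ Gamma theta) x));
    trivial; now apply (regular_cosine gamma delta).
- intros x Hx.
  apply (generator_generates gamma delta C Hga Hde) in Hx. set (v := app _ _) in Hx.
  destruct (J_C1_pos theta gamma (fun r => C r v) _ Hth Hga (regular_cosine gamma delta C HC v)) as [f' Hf'].
  (* By (c) the orbit is w(t) x plus the fractional integral of the orbit of v = A x: the first
     summand is differentiated as a power, the second by [J_C1_pos]. *)
  exists (fun t => plus (scal (/ Gamma theta * ((theta - 1) * Rpower t (theta - 1 - 1))) x) (f' t)).
  intros t Ht. destruct (Hf' t Ht) as [Hd Hcont]. split.
  + apply is_derive_ext_loc with (fun t => plus (scal (/ Gamma theta * Rpower t (theta - 1)) x)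
      (J gamma (fun r => C r v) t)).
    * generalize (locally_pos t Ht). apply filter_imp. intros s Hs. symmetry.
      apply (minus_plus_eq (G := X)).
      refine (eq_trans (K_generates gamma delta C Hga Hde HC x v s Hs Hx) _).
      do 2 f_equal. now apply cos_weight_Rpower.
    * apply (is_derive_plus (V := X)); trivial.
      apply (is_derive_scal_l (V := X) (fun t => / Gamma theta * Rpower t (theta - 1))).
      apply (is_derive_scal (fun t => Rpower t (theta - 1))). now apply is_derive_Rpower.
  + apply (continuous_plus (V := X)); trivial.
    apply (continuous_scal_l (V := X) (fun t => / Gamma theta * ((theta - 1) * Rpower t (theta - 1 - 1))) x).
    apply (continuous_scal_r (V := R_NormedModule) (/ Gamma theta) (fun t => (theta - 1) * Rpower t (theta - 1 - 1))).
    apply (continuous_scal_r (V := R_NormedModule) (theta - 1) (fun t => Rpower t (theta - 1 - 1))).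
    now apply continuous_Rpower.
Qed.
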